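(* Let $\{\boldsymbol{\xi}_t\}_{0\le t\le1}$ be an $n$-dimensional GLP. If $\mathbb{E}(|\boldsymbol{\xi}_t|)<\infty$ for all $t\in(0,1]$, then $\{\boldsymbol{\xi}_t\}_{0\le t<1}$ admits the canonical semimartingale representation $$\boldsymbol{\xi}_t=\int_0^t\frac{\mathbb{E}(\boldsymbol{\xi}_1\mid\mathcal{F}^{\boldsymbol{\xi}}_s)-\boldsymbol{\xi}_s}{1-s}\,ds+\mathbf{M}_t,\qquad 0\le t<1,$$ where $\{\mathbf{M}_t\}_{0\le t<1}$ is an $(\mathcal{F}^{\boldsymbol{\xi}}_t,\mathbb{P})$-martingale.
   Context: All processes are càdlàg on a probability space $(\Omega,\mathcal{F},\mathbb{P})$; $\mathcal{F}^{\boldsymbol{\xi}}_t=\sigma(\boldsymbol{\xi}_u:0\le u\le t)$, and filtrations are assumed right-continuous and complete. Lévy random bridge (LRB). Let $T>0$, let $\nu$ be a probability law on $\mathbb{R}$, and let $\{X_t\}$ be a real-valued Lévy process such that $X_t$ has a density $f_t$ for all $t\in(0,T]$, with $f_t(x)=\int_{\mathbb{R}}f_{t-s}(x-y)f_s(y)\,dy$ for $0<s<t\le T$, $x\in\mathbb{R}$, and $0<f_T(z)<\infty$ for $\nu$-a.e. $z$. A process $\{L_t\}_{0\le t\le T}$ is an LRB with generating law $\nu$ if $L_T$ has law $\nu$ and, for all $k\ge 1$, $0<t_1<\cdots<t_k<T$, $(x_1,\dots,x_k)\in\mathbb{R}^k$ and $\nu$-a.e. $z$, $\mathbb{P}(L_{t_1}\le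 x_1,\dots,L_{t_k}\le x_k\mid L_T=z)=\mathbb{P}(X_{t_1}\le x_1,\dots,X_{t_k}\le x_k\mid X_T=z)$. Equivalently (with $t_0=0$, $x_0=0$), $$\mathbb{P}(L_{t_1}\in dx_1,\dots,L_{t_k}\in dx_k,L_T\in dz)=\prod_{i=1}^k\big(f_{t_i-t_{i-1}}(x_i-x_{i-1})\,dx_i\big)\frac{f_{T-t_k}(z-x_k)}{f_T(z)}\,\nu(dz).$$ Generalised Liouville process (GLP). Let $n\ge2$, $m_1,\dots,m_n>0$, $u_0=0$, $u_i=u_{i-1}+m_i$. A process $\{\boldsymbol{\xi}_t\}_{0\le t\le1}$ is an $n$-dimensional GLP with generating law $\nu$ and activity parameter $\mathbf{m}=(m_1,\dots,m_n)^\top$ if it is equal in law to the process with coordinates $L_{tm_i+u_{i-1}}-L_{u_{i-1}}$, $i=1,\dots,n$, $0\le t\le1$, for some LRB $\{L_t\}_{0\le t\le u_n}$ with generating law $\nu$. It is assumed throughout that $\nu$ has no continuous singular part. *)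

(* Defs.v *)
From HB Require Import structures.
From mathcomp Require Import all_boot all_order all_algebra.
From mathcomp Require Import all_classical all_reals all_analysis.
From mathcomp Require Import measurable_realfun.

Set Implicit Arguments.
Unset Strict Implicit.
Unset Printing Implicit Defensive.

Import Order.TTheory GRing.Theory Num.Theory.
Import numFieldNormedType.Exports.

Local Open Scope classical_set_scope.
Local Open Scope ring_scope.

(* Time is the whole of R; a process indexed by an interval is given by a family
   indexed by R, and only its values at times of the interval are ever used.
   At an endpoint of D the corresponding one-sided condition is void, because
   the filter [within D _] is then improper. *)
Definition cadlag_on (R : realType) (D : set R) (x : R -> R) : Prop :=
  forall t, D t ->
    x s @[s --> within D (at_right t)] --> x t /\
    exists l : R, x s @[s --> within D (at_left t)] --> l.

(* The increment clause, with some of the B j equal to setT, is mutual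
   independence. Continuity in probability follows from cadlag paths and
   stationarity. *)
Record levy_process (R : realType) (d : measure_display) (Om : measurableType d)
    (Q : probability Om R) (X : R -> {RV Q >-> R}) : Prop := LevyProcess {
  levy_start : {ae Q, forall w, X 0 w = 0} ;
  levy_indep : forall (k : nat) (t : nat -> R) (B : nat -> set R),
    0 <= t 0%N ->
    (forall j, (j < k)%N -> t j <= t j.+1) ->
    (forall j, measurable (B j)) ->
    Q [set w | forall j, (j < k)%N -> B j (X (t j.+1) w - X (t j) w)]
    = (\prod_(j < k) Q [set w | B j (X (t j.+1) w - X (t j) w)%R])%E ;
  levy_stat : forall (s h : R) (B : set R), 0 <= s -> 0 <= h -> measurable B ->
    Q [set w | B (X (s + h) w - X s w)] = Q [set w | B (X h w)] ;
  levy_cadlag : forall w, cadlag_on [set t | 0 <= t] (fun t => X t w) }.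

(* The standing conditions on the family (f_t) of densities, 0 < t <= T.
   The values are extended reals, since f_t may be infinite at some points (for
   instance at 0 for a gamma process). *)
Record levy_densities (R : realType) (T : R) (nu : probability (measurableTypeR R) R)
    (d : measure_display) (Om : measurableType d) (Q : probability Om R)
    (X : R -> {RV Q >-> R}) (f : R -> R -> \bar R) : Prop := LevyDensities {
  dens_meas : forall t, 0 < t <= T -> measurable_fun [set: R] (f t) ;
  dens_ge0 : forall t x, 0 < t <= T -> (0 <= f t x)%E ;
  dens_law : forall t (B : set R), 0 < t <= T -> measurable B ->
    Q (X t @^-1` B) = (\int[lebesgue_measure]_(x in B) f t x)%E ;
  dens_conv : forall s t x, 0 < s -> s < t -> t <= T ->
    f t x = (\int[lebesgue_measure]_y (f (t - s)%R (x - y)%R * f s y))%E ;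
  dens_end : {ae nu, forall z, (0 < f T z < +oo)%E} }.

(* For l = [:: (t_1, x_1); ...; (t_k, x_k)] and (s, y) = (t_0, y_0),
   [bridge_int f T z s y l] is the iterated integral over y_1 <= x_1, ...,
   y_k <= x_k of
     \prod_i f_(t_i - t_(i-1)) (y_i - y_(i-1)) * f_(T - t_k) (z - y_k) / f_T z. *)
Fixpoint bridge_int (R : realType) (f : R -> R -> \bar R) (T z s y : R)
    (l : seq (R * R)) : \bar R :=
  match l with
  | [::] => (f (T - s)%R (z - y)%R * (fine (f T z))^-1%:E)%E
  | p :: l' => (\int[lebesgue_measure]_(y' in [set y' : R | (y' <= p.2)%R])
                  (f (p.1 - s)%R (y' - y)%R * bridge_int f T z p.1 y' l'))%E
  end.

(* P(X_(t_1) <= x_1, ..., X_(t_k) <= x_k | X_T = z): the conditional law of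
   (X_(t_1), ..., X_(t_k)) given X_T = z is the one whose density is the joint
   density of (X_(t_1), ..., X_(t_k), X_T) divided by the density of X_T at z. *)
Definition levy_bridge_cdf (R : realType) (f : R -> R -> \bar R) (T : R)
    (l : seq (R * R)) (z : R) : \bar R := bridge_int f T z 0 0 l.

(* g z = P(A | Y = z) for almost every z with respect to the law of Y *)
Definition cond_prob_given (R : realType) (d : measure_display)
    (Om : measurableType d) (P : probability Om R) (Y : {RV P >-> R})
    (A : set Om) (g : R -> \bar R) : Prop :=
  measurable_fun [set: R] g /\
  forall B : set R, measurable B ->
    P (A `&` Y @^-1` B) = (\int[distribution P Y]_(z in B) g z)%E.

(* The condition [path <%R 0 (rcons (unzip1 l) T)] is 0 < t_1 < ... < t_k < T. *)
Definition levy_random_bridge (R : realType) (T : R)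
    (nu : probability (measurableTypeR R) R) (d : measure_display)
    (Om : measurableType d) (P : probability Om R) (L : R -> {RV P >-> R}) : Prop :=
  0 < T /\
  exists (d' : measure_display) (Om' : measurableType d') (Q : probability Om' R)
         (X : R -> {RV Q >-> R}) (f : R -> R -> \bar R),
    [/\ levy_process X,
        levy_densities T nu X f,
        forall w, cadlag_on [set t | 0 <= t <= T] (fun t => L t w),
        forall B : set R, measurable B -> P (L T @^-1` B) = nu B &
        forall l : seq (R * R), l <> [::] -> path <%R 0 (rcons (unzip1 l) T) ->
          cond_prob_given (L T) [set w | forall p, p \in l -> L p.1 w <= p.2]
            (levy_bridge_cdf f T l)].

Definition cylinders (R : realType) (n : nat) : set (set (R -> 'I_n -> R)) :=
  [set A | exists (t : R) (i : 'I_n) (B : set R),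
     [/\ 0 <= t <= 1, measurable B & A = [set x | B (x t i)]]].

(* Equality of the laws, on path space with the cylinder sigma-algebra, of two
   R^n-valued processes indexed by [0, 1]. *)
Definition equal_in_law (R : realType) (n : nat)
    (d : measure_display) (Om : measurableType d) (P : probability Om R)
    (xi : R -> 'I_n -> Om -> R)
    (d' : measure_display) (Om' : measurableType d') (P' : probability Om' R)
    (xi' : R -> 'I_n -> Om' -> R) : Prop :=
  forall A : set (R -> 'I_n -> R), <<s @cylinders R n >> A ->
    P [set w | A (fun t i => xi t i w)] = P' [set w | A (fun t i => xi' t i w)].

(* u_0, ..., u_n; coordinate i : 'I_n is the (i+1)-st one, which starts at
   time u_i of the bridge. *)
Definition partial_sum (R : realType) (n : nat) (m : 'I_n -> R) (k : nat) : R :=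
  \sum_(j < n | (j < k)%N) m j.

Definition generalised_liouville_process (R : realType) (n : nat)
    (m : 'I_n -> R) (nu : probability (measurableTypeR R) R)
    (d : measure_display) (Om : measurableType d) (P : probability Om R)
    (xi : R -> 'I_n -> {RV P >-> R}) : Prop :=
  (forall i w, cadlag_on [set t | 0 <= t <= 1] (fun t => xi t i w)) /\
  exists (d' : measure_display) (Om' : measurableType d') (P' : probability Om' R)
         (L : R -> {RV P' >-> R}),
    levy_random_bridge (partial_sum m n) nu L /\
    equal_in_law P (fun t i w => xi t i w)
      P' (fun t i w => L (t * m i + partial_sum m i) w - L (partial_sum m i) w).

(* nu is the sum of a measure carried by a countable set and of an absolutely
   continuous measure. *)
Definition no_continuous_singular_part (R : realType)
    (nu : probability (measurableTypeR R) R) : Prop :=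
  exists (nu_d nu_ac : {measure set (measurableTypeR R) -> \bar R}) (C : set R),
    [/\ countable C, nu_d (~` C) = 0%E,
        nu_ac `<< lebesgue_measure &
        forall A : set R, measurable A -> nu A = (nu_d A + nu_ac A)%E].

Definition raw_events (R : realType) (n : nat) (d : measure_display)
    (Om : measurableType d) (xi : R -> 'I_n -> Om -> R) (s : R) : set (set Om) :=
  [set A | exists (u : R) (i : 'I_n) (B : set R),
     [/\ 0 <= u <= Num.min s 1, measurable B & A = xi u i @^-1` B]].

(* The natural filtration of a process indexed by [0, 1], made complete and
   right-continuous. *)
Definition filtration_of (R : realType) (n : nat) (d : measure_display)
    (Om : measurableType d) (P : probability Om R) (xi : R -> 'I_n -> Om -> R)
    (t : R) : set (set Om) :=
  \bigcap_(s in [set s : R | t < s])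
    <<s raw_events xi s `|` [set N | measurable N /\ P N = 0%E] >>.

(* Y is a version of E(Z | G), for a sub-sigma-algebra G. *)
Definition cond_exp (R : realType) (d : measure_display) (Om : measurableType d)
    (P : probability Om R) (G : set (set Om)) (Z Y : Om -> R) : Prop :=
  [/\ forall B : set R, measurable B -> G (Y @^-1` B),
      P.-integrable setT (EFin \o Y) &
      forall A, G A ->
        (\int[P]_(w in A) (Y w)%:E = \int[P]_(w in A) (Z w)%:E)%E].

(* An R^n-valued martingale indexed by [0, 1); adaptedness and integrability are
   the case s = t. *)
Definition martingale (R : realType) (n : nat) (d : measure_display)
    (Om : measurableType d) (P : probability Om R) (F : R -> set (set Om))
    (M : R -> 'I_n -> Om -> R) : Prop :=
  forall (i : 'I_n) (s t : R), 0 <= s -> s <= t -> t < 1 ->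
    cond_exp P (F s) (M t i) (M s i).

(* Y is a version of the process E(Z | F_s), 0 <= s < 1; the values at each s
   only determine Y up to a null set depending on s, so joint measurability is
   what gives a meaning to its time integrals. *)
Definition cond_exp_process (R : realType) (n : nat) (d : measure_display)
    (Om : measurableType d) (P : probability Om R) (F : R -> set (set Om))
    (Z : 'I_n -> Om -> R) (Y : R -> 'I_n -> Om -> R) : Prop :=
  forall i : 'I_n,
    measurable_fun ([set s : R | 0 <= s < 1] `*` [set: Om])
      (fun p : measurableTypeR R * Om => Y p.1 i p.2) /\
    forall s : R, 0 <= s < 1 -> cond_exp P (F s) (Z i) (Y s i).

(* Main.v *)
Require Import Defs.
From HB Require Import structures.
From mathcomp Require Import all_boot all_order all_algebra.
From mathcomp Require Import all_classical all_reals all_analysis.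
From mathcomp Require Import measurable_realfun.
From mathcomp Require Import ring lra.

Set Implicit Arguments.
Unset Strict Implicit.
Unset Printing Implicit Defensive.

Import Order.TTheory GRing.Theory Num.Theory.
Import numFieldNormedType.Exports.

Local Open Scope classical_set_scope.
Local Open Scope ring_scope.

(** The process has the harness property: for s <= t < 1 and an event A of the past
of s, the integral over A of xi_t - xi_s is (t - s) / (1 - s) times the integral
over A of xi_1 - xi_s. It follows that the drift
D_s = (E(xi_1 | F_s) - xi_s) / (1 - s) is a martingale, and that the integral over A
of xi_t - xi_s is (t - s) times that of D_s. By Fubini and the martingale property of
D, the latter is the integral over A of the time integral of D from s to t. So the
difference M of xi and the time integral of D is a martingale.

The harness property comes from a symmetry of the bridge. Given the values p and r at
the times a and a + 2h, the value q at a + h has a density proportional to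
f_h(q - p) f_h(r - q), which is invariant under q -> p + r - q whatever f_h is
([midpoint_balance]); hence the increments over [a, a + h] and [a + h, a + 2h] have
the same integral over each event that does not depend on the bridge between a and
a + 2h ([increments_exchange]). The individual values of a bridge need not have a
mean, so the symmetry is stated as an identity of nonnegative integrals, and
integrated in this form along the chain of times that defines the law of the bridge;
that these iterated integrals determine the law is seen by treating both sides as
positive functionals of one weight at a time, which agree as soon as they agree on
indicators of rays ([positive_functional_rays_eq], [box_law_sets]). The coordinates
of xi are increments of the bridge over disjoint intervals, so that adjacent
increments of equal length of a coordinate have the same integral over events of the
completed past H_r ([midpoint_increments]), which is the harness property from r to
the points of the regular grids of [r, 1] ([grid_harness]).

To pass to all s and t and to the right-continuous filtration, let r decrease to s
along times such that t is on a grid of [r, 1]. The grid identity expresses xi_r by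
E(xi_t | H_r) and E(xi_1 | H_r). Conditional expectations are Cauchy in L1 as r
decreases ([backward_cauchy]), so xi_r converges in L1, necessarily to xi_s by right
continuity, and the identity holds in the limit ([harness]).

For the time integrals, a jointly measurable version of E(xi_1 | F_s) is built by
following E(xi_1 | H_r) along rationals r decreasing to s fast enough for almost sure
convergence ([cond_exp_measurable_version]). As D is a martingale, the mean of |D_s|
is at most that of |D_t| for s <= t, which makes D integrable over [0, t] * Om
([product_integrable]). The time integral is measurable with respect to F_t by an
orthogonality argument ([time_integral_adapted]), and is the same for all versions
([time_integrals_unique]). *)

(** * Functionals on the nonnegative measurable functions of a real variable *)

Definition rays (R : realType) : set (set (measurableTypeR R)) :=
  [set A | exists x : R, A = `]-oo, x]%classic].

Lemma measurable_raysE (R : realType) :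
  @measurable _ (measurableTypeR R) = <<s @rays R >>.
Proof.
have -> : @measurable _ (measurableTypeR R) = <<s @RGenOInfty.G R >>.
  exact: RGenOInfty.measurableE.
rewrite eqEsubset; split => A; apply: smallest_sub => //; try exact: smallest_sigma_algebra.
- move=> _ [x ->]; rewrite -setCitvl.
  pose GT := g_sigma_algebraType (@rays R).
  by apply: (@measurableC _ GT); apply: sub_sigma_algebra; exists x.
- move=> _ [x ->]; rewrite -setCitvr.
  pose GT := g_sigma_algebraType (@RGenOInfty.G R).
  by apply: (@measurableC _ GT); apply: sub_sigma_algebra; exists x.
Qed.

Lemma finite_measure_rays_eq (R : realType)
    (m1 m2 : {measure set (measurableTypeR R) -> \bar R}) :
  (forall x : R, (m1 `]-oo, x]%classic < +oo)%E) ->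
  (forall x : R, m1 `]-oo, x]%classic = m2 `]-oo, x]%classic) ->
  forall A : set R, measurable A -> m1 A = m2 A.
Proof.
move=> m1oo m12 A mA.
apply: (measure_unique (@rays R)
  (fun k : nat => `]-oo, (k%:R : R)]%classic : set (measurableTypeR R))) => //=.
- exact: measurable_raysE.
- move=> _ _ [x ->] [y ->]; exists (Num.min x y).
  by apply/seteqP; split => z /=; rewrite !in_itv/= le_min => /andP.
- by move=> i; eexists; reflexivity.
- apply/seteqP; split => // x _; exists (Num.bound `|x|) => //=.
  by rewrite in_itv/= ltW// (le_lt_trans (ler_norm _) (archi_boundP (normr_ge0 x))).
- by move=> _ [x ->].
Qed.

(** These properties characterise integration against a measure; every nested
integral below has them in each of its weight functions. *)
Record positive_functional (R : realType) (La : (R -> \bar R) -> \bar R) : Prop :=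
  PositiveFunctional {
    pf_0 : La (cst 0%E) = 0%E ;
    pf_ge0 : forall phi, measurable_fun [set: R] phi -> (forall x, 0 <= phi x)%E ->
      (0 <= La phi)%E ;
    pf_lin : forall (c : R) phi psi, 0 <= c ->
      measurable_fun [set: R] phi -> (forall x, 0 <= phi x)%E ->
      measurable_fun [set: R] psi -> (forall x, 0 <= psi x)%E ->
      La (fun x => c%:E * phi x + psi x)%E = (c%:E * La phi + La psi)%E ;
    pf_cvg : forall (phi_ : nat -> R -> \bar R) phi,
      (forall k, measurable_fun [set: R] (phi_ k)) ->
      (forall k x, 0 <= phi_ k x)%E ->
      (forall x, nondecreasing_seq (phi_ ^~ x)) ->
      (forall x, phi_ k x @[k --> \oo] --> phi x) ->
      La (phi_ k) @[k --> \oo] --> La phi }.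

Section positive_functional_measure.
Variables (R : realType) (La : (R -> \bar R) -> \bar R).
Hypothesis pf : positive_functional La.

(** A measure is a function of all sets, hence the case distinction. The proof
argument is what the canonical measure structure below is found from. *)
Definition functional_measure (_ : positive_functional La)
    (A : set (measurableTypeR R)) : \bar R :=
  if pselect (measurable A) then La (EFin \o \1_A) else 0%E.
Local Notation m := (functional_measure pf).

Let mind (A : set (measurableTypeR R)) : measurable A -> measurable_fun [set: R] (EFin \o (\1_A : R -> R)).
Proof. by move=> mA; apply/measurable_EFinP; exact: measurable_indic. Qed.

Let ind_ge0 (A : set R) x : (0 <= (EFin \o (\1_A : R -> R)) x)%E.
Proof. by rewrite /= lee_fin. Qed.

Let mE (A : set (measurableTypeR R)) : measurable A -> m A = La (EFin \o \1_A).
Proof. by move=> mA; rewrite /functional_measure; case: pselect. Qed.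

Let pf_sum (I : eqType) (r : seq I) (c : I -> R) (F : I -> R -> \bar R) :
  (forall i, i \in r -> 0 <= c i) -> (forall i, measurable_fun [set: R] (F i)) ->
  (forall i x, 0 <= F i x)%E ->
  La (fun x => \sum_(i <- r) (c i)%:E * F i x)%E = (\sum_(i <- r) (c i)%:E * La (F i))%E.
Proof.
move=> + mF F0; elim: r => [|i r IH] c0.
  rewrite big_nil -[RHS](pf_0 pf); congr La; apply/funext => x; by rewrite big_nil.
have c0' j : j \in r -> 0 <= c j by move=> jr; apply: c0; rewrite inE jr orbT.
rewrite big_cons -IH// -(pf_lin pf)//; last 3 first.
  - by apply: c0; rewrite mem_head.
  - by apply: emeasurable_sum => j; apply: measurable_funeM.
  - move=> x; rewrite big_seq; apply: sume_ge0 => j jr.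
    by rewrite mule_ge0// lee_fin; exact: c0'.
by congr La; apply/funext => x; rewrite big_cons.
Qed.

Let m0 : m set0 = 0%E.
Proof.
rewrite mE// -(pf_0 pf); congr La; apply/funext => x.
by rewrite /= indic0.
Qed.

Let m_ge0 A : (0 <= m A)%E.
Proof. by rewrite /functional_measure; case: pselect => // mA; apply: (pf_ge0 pf) => //; exact: mind. Qed.

Let m_sigma : semi_sigma_additive m.
Proof.
move=> F mF tF mUF; rewrite mE//.
have -> : (fun n => \sum_(0 <= i < n) m (F i))%E =
    (fun n => La (fun x => \sum_(0 <= i < n) (1 : R)%:E * (\1_(F i) x)%:E)%E).
  apply/funext => n; rewrite (@pf_sum _ _ (fun=> 1) (fun i => EFin \o (\1_(F i) : R -> R)))//.
  - by apply: eq_bigr => i _; rewrite mE// mul1e.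
  - by move=> i; apply: mind; exact: mF.
apply: (pf_cvg pf).
- by move=> k; apply: emeasurable_sum => j; apply: measurable_funeM; apply: mind; exact: mF.
- by move=> k x; apply: sume_ge0 => j _; rewrite mule_ge0// lee_fin.
- move=> x i j ij; apply: lee_sum_nneg_natr => // k _ _; by rewrite mule_ge0// lee_fin.
- move=> x.
  under eq_fun do under eq_bigr do rewrite mul1e.
  rewrite /= indic_bigcup//; apply: is_cvg_nneseries => k _ _; by rewrite lee_fin.
Qed.

HB.instance Definition _ := isMeasure.Build _ _ _ m m0 m_ge0 m_sigma.

Import HBNNSimple.

(** The two sides agree on indicators, hence on simple functions by additivity, and
both are continuous along increasing sequences. *)
Lemma positive_functionalE phi : measurable_fun [set: R] phi ->
  (forall x, 0 <= phi x)%E -> La phi = (\int[m]_x phi x)%E.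
Proof.
move=> mphi phi0.
pose g := @nnsfun_approx _ (measurableTypeR R) R setT measurableT phi mphi.
have gphi x : EFin \o (fun n => g n x) @ \oo --> phi x.
  by apply: cvg_nnsfun_approx.
have ndg x : nondecreasing_seq (fun n => (g n x)%:E).
  by move=> a b ab; rewrite lee_fin; exact/lefP/nd_nnsfun_approx.
have mg k : measurable_fun [set: measurableTypeR R] (EFin \o g k) by exact/measurable_EFinP.
have L1 : La (EFin \o g k) @[k --> \oo] --> La phi.
  apply: (pf_cvg pf) => //.
  by move=> k x; rewrite /= lee_fin.
have L2 : (\int[m]_x (g k x)%:E)%E @[k --> \oo] --> (\int[m]_x phi x)%E.
  have -> : (\int[m]_x phi x = \int[m]_x (limn (fun k => (g k x)%:E)))%E.
    by apply: eq_integral => x _; apply/esym/cvg_lim => //; exact: gphi.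
  apply: cvg_monotone_convergence => //.
  by move=> k x _; rewrite lee_fin.
rewrite -(cvg_lim _ L1)// -(cvg_lim _ L2)//; congr (limn _).
suff -> : (fun k => La (EFin \o g k)) = (fun k => \int[m]_x (g k x)%:E)%E by [].
apply/funext => k.
have fr := @fimfunP _ _ (g k).
rewrite integralT_nnsfun sintegralE fsbig_finite//=.
have -> : EFin \o g k = (fun x => \sum_(y <- finmap.enum_fset (fset_set (range (g k))))
    y%:E * (\1_(g k @^-1` [set y]) x)%:E)%E.
  apply/funext => x; rewrite /= fimfunE fsbig_finite//= -sumEFin.
  by apply: eq_bigr => y _; rewrite EFinM.
rewrite (@pf_sum _ _ id (fun y => EFin \o (\1_(g k @^-1` [set y]) : R -> R))).
- by apply: eq_bigr => y _; rewrite mE//.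
- by move=> y; rewrite in_fset_set// inE => -[x _ <-].
- by move=> y; apply: mind.
- by move=> y x; rewrite /= lee_fin.
Qed.

End positive_functional_measure.

(** Both functionals are integrals, against finite measures that agree on the
rays. *)
Lemma positive_functional_rays_eq (R : realType) (La1 La2 : (R -> \bar R) -> \bar R) :
  positive_functional La1 -> positive_functional La2 ->
  (forall x : R, (La1 (EFin \o \1_(`]-oo, x]%classic)) < +oo)%E) ->
  (forall x : R, La1 (EFin \o \1_(`]-oo, x]%classic)) = La2 (EFin \o \1_(`]-oo, x]%classic))) ->
  forall phi, measurable_fun [set: R] phi -> (forall x, 0 <= phi x)%E -> La1 phi = La2 phi.
Proof.
move=> pf1 pf2 fin1 eq12 phi mphi phi0.
rewrite (positive_functionalE pf1)// (positive_functionalE pf2)//.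
have mE La (pf : positive_functional La) (x : R) :
    functional_measure pf `]-oo, x]%classic = La (EFin \o \1_(`]-oo, x]%classic)).
  by rewrite /functional_measure; case: pselect.
apply: eq_measure_integral => A mA _.
by apply: finite_measure_rays_eq => // x; rewrite /= !mE.
Qed.

Lemma ge0_monotone_cvg_integral d (T : measurableType d) (R : realType)
    (mu : {measure set T -> \bar R}) (D : set T) (g_ : nat -> T -> \bar R) (g : T -> \bar R) :
  measurable D -> (forall n, measurable_fun D (g_ n)) -> (forall n x, D x -> 0 <= g_ n x)%E ->
  (forall x, D x -> nondecreasing_seq (g_ ^~ x)) ->
  (forall x, D x -> g_ n x @[n --> \oo] --> g x) ->
  (\int[mu]_(x in D) g_ n x)%E @[n --> \oo] --> (\int[mu]_(x in D) g x)%E.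
Proof.
move=> mD mg g0 ndg gc.
rewrite (_ : (\int[mu]_(x in D) g x)%E = (\int[mu]_(x in D) limn (g_ ^~ x))%E).
  exact: cvg_monotone_convergence.
by apply: eq_integral => x /set_mem Dx; apply/esym/cvg_lim => //; exact: gc.
Qed.

(** For k = +oo, the products vanish as long as u n does and are +oo afterwards. *)
Lemma mule_nondecreasing_cvg (R : realType) (k : \bar R) (u : nat -> \bar R) (l : \bar R) :
  (0 <= k)%E -> (forall n, 0 <= u n)%E -> nondecreasing_seq u ->
  u n @[n --> \oo] --> l -> (k * u n)%E @[n --> \oo] --> (k * l)%E.
Proof.
move=> k0 u0 ndu ul.
case: k k0 => [r _|_|//]; first by apply: cvgeZl.
have [[N uN]|] := pselect (exists N, u N != 0%E); last first.
  move=> /forallNP h.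
  have uE n : u n = 0%E by apply/eqP; apply: contra_notT (h n).
  have -> : l = 0%E.
    rewrite -(cvg_lim _ ul)//; under eq_fun do rewrite uE; exact: lim_cst.
  by under eq_fun do rewrite uE mule0; rewrite mule0; exact: cvg_cst.
have uN0 : (0 < u N)%E by rewrite lt_def uN u0.
have l0 : (0 < l)%E.
  rewrite (lt_le_trans uN0)// -(cvg_lim _ ul)//; apply: lime_ge; first by apply: cvgP; exact: ul.
  by exists N => // n /= Nn; exact: ndu.
rewrite (gt0_mulye l0); apply: cvg_near_cst; exists N => // n /= Nn.
by rewrite gt0_mulye// (lt_le_trans uN0)//; exact: ndu.
Qed.

Lemma positive_functional_integral d (T : measurableType d) (R : realType)
    (mu : {measure set T -> \bar R}) (D : set T) (X : T -> R) (w : T -> \bar R) :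
  measurable D -> measurable_fun [set: T] X -> measurable_fun [set: T] w ->
  (forall x, 0 <= w x)%E ->
  positive_functional (fun phi => \int[mu]_(x in D) (w x * phi (X x)))%E.
Proof.
move=> mD mX mw w0.
have mphi (phi : R -> \bar R) : measurable_fun [set: R] phi ->
    measurable_fun D (fun x => w x * phi (X x))%E.
  move=> mphi; apply: measurable_funTS; apply: emeasurable_funM => //.
  exact: measurableT_comp.
split.
- under eq_integral do rewrite mule0; exact: integral0.
- by move=> phi mp p0; apply: integral_ge0 => x _; rewrite mule_ge0.
- move=> c phi psi c0 m1 p1 m2 p2.
  rewrite -ge0_integralZl_EFin//; last 2 first.
  + by move=> x _; rewrite mule_ge0.
  + exact: mphi.
  rewrite -ge0_integralD//.
  + apply: eq_integral => x _; rewrite ge0_muleDr ?mule_ge0// ?lee_fin//.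
    by rewrite muleCA.
  + by move=> x _; rewrite !mule_ge0.
  + by apply: measurable_funeM; exact: mphi.
  + by move=> x _; rewrite mule_ge0.
  + exact: mphi.
- move=> p_ p mp p0 ndp cp; apply: ge0_monotone_cvg_integral => //.
  + by move=> n; exact: mphi.
  + by move=> n x _; rewrite mule_ge0.
  + by move=> x _ a b ab; rewrite lee_wpmul2l//; exact: ndp.
  + by move=> x _; apply: mule_nondecreasing_cvg => //.
Qed.

Lemma positive_functional_le (R : realType) (La : (R -> \bar R) -> \bar R) phi psi :
  positive_functional La ->
  measurable_fun [set: R] phi -> measurable_fun [set: R] psi ->
  (forall x, 0 <= phi x)%E -> (forall x, phi x <= psi x)%E -> (La phi <= La psi)%E.
Proof.
move=> L mphi mpsi p0 pp.
have psi0 x : (0 <= psi x)%E by exact: le_trans (pp x).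
rewrite !(positive_functionalE L)//; exact: ge0_le_integral.
Qed.

(** Continuity of the composition needs monotonicity of the inner functionals,
which holds as they are integrals. *)
Lemma positive_functional_comp (R : realType) (La : (R -> \bar R) -> \bar R)
    (Mu : R -> (R -> \bar R) -> \bar R) :
  positive_functional La -> (forall y, positive_functional (Mu y)) ->
  (forall phi, measurable_fun [set: R] phi -> (forall x, 0 <= phi x)%E ->
     measurable_fun [set: R] (Mu ^~ phi)) ->
  positive_functional (fun phi => La (Mu ^~ phi)).
Proof.
move=> L M mM; split.
- rewrite -[RHS](pf_0 L); congr La; apply/funext => y; exact: pf_0 (M y).
- move=> phi mp p0; apply: (pf_ge0 L); first exact: mM.
  by move=> y; exact: (pf_ge0 (M y)).
- move=> c phi psi c0 m1 p1 m2 p2; rewrite -(pf_lin L)//.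
  + by congr La; apply/funext => y; exact: (pf_lin (M y)).
  + exact: mM.
  + by move=> y; exact: (pf_ge0 (M y)).
  + exact: mM.
  + by move=> y; exact: (pf_ge0 (M y)).
- move=> p_ p mp p0 ndp cp; apply: (pf_cvg L).
  + by move=> k; exact: mM.
  + by move=> k y; exact: (pf_ge0 (M y)).
  + move=> y a b ab.
    have pab x : (p_ a x <= p_ b x)%E by exact: ndp.
    exact: (positive_functional_le (M y)).
  + by move=> y; exact: (pf_cvg (M y)).
Qed.

(** * Iterated integrals along a chain of times *)

Section chain.
Variables (R : realType) (T : R) (f : R -> R -> \bar R).
Hypothesis f_meas : forall t, 0 < t <= T -> measurable_fun [set: R] (f t).
Hypothesis f_ge0 : forall t x, 0 < t <= T -> (0 <= f t x)%E.

(** Extending the densities by zero outside ]0, T] spares the side conditions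
on times in all measurability statements. *)
Definition dens (t : R) : R -> \bar R := if 0 < t <= T then f t else cst 0%E.

Lemma dens_measurable t : measurable_fun [set: R] (dens t).
Proof. by rewrite /dens; case: ifPn => [/f_meas|] //. Qed.

Lemma dens_nonneg t x : (0 <= dens t x)%E.
Proof. by rewrite /dens; case: ifPn => [/f_ge0|] //. Qed.

Definition weighted_times := seq (R * (R -> \bar R)).

(** The iterated integral that defines the law of a bridge, with arbitrary
weights in place of the indicators of rays and with last factor [g]. *)
Fixpoint chain (s : R) (l : weighted_times) (g : R -> \bar R) (y : R) : \bar R :=
  match l with
  | [::] => g y
  | p :: l' => (\int[lebesgue_measure]_y'
                  (dens (p.1 - s)%R (y' - y)%R * (p.2 y' * chain p.1 l' g y')))%E
  end.

Definition admissible (l : weighted_times) : Prop :=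
  forall p, List.In p l -> measurable_fun [set: R] p.2 /\ forall x, (0 <= p.2 x)%E.

Lemma admissible_cons p l : admissible (p :: l) ->
  [/\ measurable_fun [set: R] p.2, forall x, (0 <= p.2 x)%E & admissible l].
Proof.
move=> h; have [] := h p (or_introl erefl); split => //.
by move=> q ql; apply: h; right.
Qed.

Lemma admissible_cat l1 l2 : admissible (l1 ++ l2) <-> admissible l1 /\ admissible l2.
Proof.
split=> [h|[h1 h2] p].
- by split=> p pl; apply: h; apply/List.in_or_app; [left|right].
- by move=> /(@List.in_app_or _ _ _ _)[/h1|/h2].
Qed.

Lemma admissible_rcons l t phi : admissible l -> measurable_fun [set: R] phi ->
  (forall x, 0 <= phi x)%E -> admissible (rcons l (t, phi)).
Proof.
move=> h mp p0; rewrite -cats1; apply/admissible_cat; split=> // q [<-|//].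
by [].
Qed.

Lemma chain_ge0 s l g y : admissible l -> (forall x, 0 <= g x)%E -> (0 <= chain s l g y)%E.
Proof.
move=> + g0; elim: l s y => [|p l IH] s y //= /admissible_cons[_ p0 al].
by apply: integral_ge0 => y' _; rewrite !mule_ge0// ?dens_nonneg// IH.
Qed.

Lemma chain_cat s l1 l2 g y :
  chain s (l1 ++ l2) g y = chain s l1 (chain (last s (unzip1 l1)) l2 g) y.
Proof.
elim: l1 s y => [|p l1 IH] s y //=.
by apply: eq_integral => y' _; rewrite IH.
Qed.

(** One step of the recursion, with a parameter z on which later factors depend:
Tonelli. *)
Lemma measurable_integral_step (t : R) (phi : R -> \bar R) (K : R -> R -> \bar R) :
  measurable_fun [set: R] phi -> (forall x, 0 <= phi x)%E ->
  measurable_fun [set: R * R] (fun q => K q.1 q.2) -> (forall z y, 0 <= K z y)%E ->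
  measurable_fun [set: R * R] (fun q : R * R =>
    \int[lebesgue_measure]_y' (dens t (y' - q.2)%R * (phi y' * K q.1 y')))%E.
Proof.
move=> mphi phi0 mK K0.
pose F (q : (R * R) * (measurableTypeR R)) : \bar R :=
  (dens t (q.2 - q.1.2)%R * (phi q.2 * K q.1.1 q.2))%E.
apply: (@measurable_fun_fubini_tonelli_F _ _ _ (measurableTypeR R) R lebesgue_measure F).
- apply: emeasurable_funM.
    apply: (measurableT_comp (dens_measurable t)).
    apply: measurable_funB; first exact: measurable_snd.
    exact: (measurableT_comp measurable_snd measurable_fst).
  apply: emeasurable_funM; first exact: (measurableT_comp mphi measurable_snd).
  apply: (@measurableT_comp _ _ _ _ _ _ (fun q : R * R => K q.1 q.2) setT
    (fun x => (x.1.1, x.2)) mK).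
  apply/measurable_fun_pairP; split; last exact: measurable_snd.
  exact: (measurableT_comp measurable_fst measurable_fst).
- by move=> q; rewrite !mule_ge0// dens_nonneg.
Qed.

Lemma chain_measurable2 s l (g : R -> R -> \bar R) : admissible l ->
  measurable_fun [set: R * R] (fun q => g q.1 q.2) -> (forall z y, 0 <= g z y)%E ->
  measurable_fun [set: R * R] (fun q => chain s l (g q.1) q.2).
Proof.
move=> + mg g0; elim: l s => [|p l IH] s //= /admissible_cons[mp p0 al].
apply: (@measurable_integral_step (p.1 - s) p.2 (fun z => chain p.1 l (g z))) => //.
- exact: IH.
- by move=> z y; exact: chain_ge0.
Qed.

Lemma chain_measurable s l (g : R -> \bar R) : admissible l ->
  measurable_fun [set: R] g -> (forall y, 0 <= g y)%E ->
  measurable_fun [set: R] (chain s l g).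
Proof.
move=> al mg g0.
have := @chain_measurable2 s l (fun _ => g) al (measurableT_comp mg measurable_snd) (fun _ => g0).
move=> /(measurableT_comp)/(_ (pair1_measurable (0 : R))).
by [].
Qed.

Lemma chain_positive_functional s l y : admissible l ->
  positive_functional (fun g => chain s l g y).
Proof.
elim: l s y => [|p l IH] s y.
  by move=> _; split => //=.
move=> /admissible_cons[mp p0 al] /=.
have base : positive_functional (fun psi : R -> \bar R => \int[lebesgue_measure]_(y' in setT)
     ((dens (p.1 - s)%R (y' - y)%R * p.2 y') * psi y'))%E.
  apply: (@positive_functional_integral _ (measurableTypeR R) R lebesgue_measure setT idfun) => //.
  - exact: measurable_id.
  - apply: emeasurable_funM => //; apply: (measurableT_comp (dens_measurable _)).
    exact: measurable_funB.
  - by move=> x; rewrite mule_ge0// dens_nonneg.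
have := positive_functional_comp base (fun y' => IH p.1 y' al)
  (fun phi mphi phi0 => chain_measurable p.1 al mphi phi0).
by under eq_fun do under eq_integral do rewrite -muleA.
Qed.

Lemma chain_weight_functional s l1 t l2 (g : R -> \bar R) y : admissible l1 -> admissible l2 ->
  measurable_fun [set: R] g -> (forall x, 0 <= g x)%E ->
  positive_functional (fun phi => chain s (l1 ++ (t, phi) :: l2) g y).
Proof.
move=> al1 al2 mg g0; under eq_fun do rewrite chain_cat.
have base z : positive_functional (fun phi : R -> \bar R => \int[lebesgue_measure]_(y' in setT)
     ((dens (t - last s (unzip1 l1))%R (y' - z)%R * chain t l2 g y') * phi y'))%E.
  apply: (@positive_functional_integral _ (measurableTypeR R) R lebesgue_measure setT idfun) => //.
  - exact: measurable_id.
  - apply: emeasurable_funM; last exact: chain_measurable.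
    apply: (measurableT_comp (dens_measurable _)); exact: measurable_funB.
  - by move=> x; rewrite mule_ge0// ?dens_nonneg// chain_ge0.
apply: (@positive_functional_comp _ (fun h => chain s l1 h y)
   (fun z phi => chain (last s (unzip1 l1)) ((t, phi) :: l2) g z)).
- exact: chain_positive_functional.
- move=> z /=; have := base z.
  by under eq_fun do under eq_integral do rewrite -muleA (muleC (chain _ _ _ _)).
- move=> phi mphi phi0; apply: (@chain_measurable _ ((t, phi) :: l2)) => //.
  by apply: (admissible_cat [:: (t, phi)] l2).2; split=> // q [<-|//].
Qed.

End chain.

(** * The finite-dimensional laws of a bridge *)

Section bridge_law.
Variables (R : realType) (T : R) (f : R -> R -> \bar R).
Hypothesis T_gt0 : 0 < T.
Hypothesis f_meas : forall t, 0 < t <= T -> measurable_fun [set: R] (f t).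
Hypothesis f_ge0 : forall t x, 0 < t <= T -> (0 <= f t x)%E.
Variables (d : measure_display) (Om : measurableType d) (P : probability Om R).
Variable L : R -> {RV P >-> R}.
Hypothesis L_bridge : forall l : seq (R * R), l <> [::] -> path <%R 0 (rcons (unzip1 l) T) ->
  cond_prob_given (L T) [set w | forall p, p \in l -> L p.1 w <= p.2] (levy_bridge_cdf f T l).

Let eta := distribution P (L T).

Definition last_factor (s z y : R) : \bar R :=
  (dens T f (T - s)%R (z - y)%R * (fine (f T z))^-1%:E)%E.

Fixpoint box (l : seq (R * set R)) : set Om :=
  match l with
  | [::] => setT
  | p :: l' => (L p.1 @^-1` p.2) `&` box l'
  end.

Definition indicators (l : seq (R * set R)) : weighted_times R :=
  [seq (p.1, EFin \o (\1_(p.2) : R -> R)) | p <- l].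

Definition lower (l : seq (R * R)) : seq (R * set R) :=
  [seq (p.1, `]-oo, p.2]%classic) | p <- l].

(** The value at z of the density of the weighted law of the chain with respect
to the law of the end point. *)
Definition bridge_weight (l : weighted_times R) (z : R) : \bar R :=
  chain T f 0 l (last_factor (last 0 (unzip1 l)) z) 0.

Definition times_ok (ts : seq R) : bool := path <%R 0 (rcons ts T).

Definition measurable_sets (l : seq (R * set R)) : Prop :=
  forall p, List.In p l -> measurable p.2.

Definition box_law (l : seq (R * set R)) : Prop :=
  forall B : set R, measurable B ->
    P (box l `&` L T @^-1` B) = (\int[eta]_(z in B) bridge_weight (indicators l) z)%E.

Lemma last_factor_ge0 s z y : (0 <= last_factor s z y)%E.
Proof.
rewrite mule_ge0 ?dens_nonneg// lee_fin invr_ge0 fine_ge0// f_ge0//.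
by rewrite T_gt0 lexx.
Qed.

Lemma last_factor_scale_measurable :
  measurable_fun [set: R] (fun z => (fine (f T z))^-1%:E : \bar R).
Proof.
apply/measurable_EFinP.
(* measurability of powers covers the inverse, also at 0 *)
have -> : (fun z : R => (fine (f T z))^-1) = (fun z => (fine (f T z)) `^ (-1)).
  apply/funext => z; rewrite powR_inv1// fine_ge0// f_ge0//.
  by rewrite T_gt0 lexx.
have mfT : measurable_fun [set: R] (fine \o f T).
  apply: measurableT_comp => //.
  by apply: f_meas; rewrite T_gt0 lexx.
exact: (measurableT_comp (@measurable_powR R (-1)) mfT).
Qed.

Lemma last_factor_measurable s :
  measurable_fun [set: R * R] (fun q => last_factor s q.1 q.2).
Proof.
apply: emeasurable_funM; last exact: (measurableT_comp last_factor_scale_measurable measurable_fst).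
apply: (measurableT_comp (dens_measurable f_meas _)).
by apply: measurable_funB; [exact: measurable_fst|exact: measurable_snd].
Qed.

Lemma indicators_admissible l : measurable_sets l -> admissible (indicators l).
Proof.
elim: l => [|p l IH] ml q //= [<-|ql].
- split=> [|x]; last by rewrite /= lee_fin.
  by apply/measurable_EFinP; apply: measurable_indic; apply: ml; left.
- by apply: IH ql => r rl; apply: ml; right.
Qed.

Lemma times_indicators l : unzip1 (indicators l) = unzip1 l.
Proof. by rewrite /unzip1 -map_comp. Qed.

Lemma times_lower l : unzip1 (lower l) = unzip1 l.
Proof. by rewrite /unzip1 -map_comp. Qed.

Lemma measurable_lower l : measurable_sets (lower l).
Proof. by elim: l => [//|p l IH] q /= [<-|]; [exact: measurable_itv|exact: IH]. Qed.

Lemma measurable_sets_cat l1 l2 :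
  measurable_sets (l1 ++ l2) <-> measurable_sets l1 /\ measurable_sets l2.
Proof.
split=> [h|[h1 h2] p].
- by split=> p pl; apply: h; apply/List.in_or_app; [left|right].
- by move=> /(@List.in_app_or _ _ _ _)[/h1|/h2].
Qed.

Lemma measurable_box l : measurable_sets l -> measurable (box l).
Proof.
elim: l => [|p l IH] ml //=; apply: measurableI.
- by apply: measurable_funPTI; apply: ml; left.
- by apply: IH => q ql; apply: ml; right.
Qed.

Lemma box_cat l1 l2 : box (l1 ++ l2) = box l1 `&` box l2.
Proof. by elim: l1 => [|p l IH] /=; rewrite ?setTI// IH setIA. Qed.

Lemma box_insert l1 t A l2 :
  box (l1 ++ (t, A) :: l2) = box (l1 ++ l2) `&` L t @^-1` A.
Proof. by rewrite !box_cat/= [L t @^-1` A `&` _]setIC setIA. Qed.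

Lemma bridge_weight_measurable l : admissible l -> measurable_fun [set: R] (bridge_weight l).
Proof.
move=> al; rewrite /bridge_weight.
have := chain_measurable2 f_meas f_ge0 0 al (last_factor_measurable (last 0 (unzip1 l)))
  (last_factor_ge0 _).
move=> /(measurableT_comp)/(_ (pair2_measurable (0 : R))).
by [].
Qed.

Lemma bridge_weight_ge0 l z : admissible l -> (0 <= bridge_weight l z)%E.
Proof. by move=> al; apply: chain_ge0 => // y; exact: last_factor_ge0. Qed.

Lemma bridge_int_chain s z y l : 0 <= s -> path <%R s (rcons (unzip1 l) T) ->
  bridge_int f T z s y l =
  chain T f s (indicators (lower l)) (last_factor (last s (unzip1 l)) z) y.
Proof.
elim: l s y => [|p l IH] s y s0 /=.
  rewrite andbT => sT; rewrite /last_factor /dens ifT//.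
  by rewrite subr_gt0 sT/= gerBl.
move=> /andP[sp pp].
have pT : p.1 < T.
  have := order_path_min lt_trans pp; rewrite all_rcons => /andP[].
  by [].
rewrite integral_mkcond; apply: eq_integral => y' _.
rewrite patchE; case: ifPn => y'p.
- rewrite IH//; last by rewrite (le_trans s0)// ltW.
  have -> : dens T f (p.1 - s) = f (p.1 - s).
    rewrite /dens ifT// subr_gt0 sp/= (le_trans _ (ltW pT))// gerBl//.
  by rewrite /= indicE mem_set ?mul1e//=; move: y'p; rewrite inE/= in_itv.
- rewrite /= indicE memNset ?mul0e ?mule0//=; rewrite in_itv/=.
  by move: y'p; rewrite notin_setE.
Qed.

Lemma box_law_lower l : l <> [::] -> times_ok (unzip1 l) -> box_law (lower l).
Proof.
move=> l0 ok B mB; have [_ /(_ B mB)] := L_bridge l0 ok.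
have -> : [set w | forall p, p \in l -> L p.1 w <= p.2] = box (lower l).
  elim: l {l0 ok} => [|p l IH]; first by apply/seteqP; split.
  rewrite /= -IH; apply/seteqP; split=> w /=; rewrite in_itv/=.
    by move=> h; split=> [|q ql]; apply: h; rewrite inE ?eqxx// ql orbT.
  by move=> [h1 h2] q; rewrite inE => /orP[/eqP->//|]; exact: h2.
move=> ->; apply: eq_integral => z _.
rewrite /levy_bridge_cdf bridge_int_chain//.
by rewrite /bridge_weight times_indicators times_lower.
Qed.

(** Both sides are positive functionals of the weight at time t, so that it is
enough to compare them on indicators of rays. *)
Lemma box_law_weight l1 t l2 (B : set R) :
  measurable_sets l1 -> measurable_sets l2 -> measurable B ->
  (forall x, P (box (l1 ++ (t, `]-oo, x]%classic) :: l2) `&` L T @^-1` B) =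
     \int[eta]_(z in B) bridge_weight (indicators (l1 ++ (t, `]-oo, x]%classic) :: l2)) z)%E ->
  forall phi, measurable_fun [set: R] phi -> (forall x, 0 <= phi x)%E ->
  (\int[P]_(w in box (l1 ++ l2) `&` L T @^-1` B) phi (L t w) =
   \int[eta]_(z in B) bridge_weight (indicators l1 ++ (t, phi) :: indicators l2) z)%E.
Proof.
move=> ml1 ml2 mB hx phi mphi phi0.
have mD : measurable (box (l1 ++ l2) `&` L T @^-1` B).
  apply: measurableI; last exact: measurable_funPTI.
  by apply: measurable_box; apply/measurable_sets_cat.
have al1 := indicators_admissible ml1; have al2 := indicators_admissible ml2.
pose La1 (phi : R -> \bar R) := (\int[P]_(w in box (l1 ++ l2) `&` L T @^-1` B) phi (L t w))%E.
pose La2 (phi : R -> \bar R) :=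
  (\int[eta]_(z in B) bridge_weight (indicators l1 ++ (t, phi) :: indicators l2) z)%E.
have ad (psi : R -> \bar R) : measurable_fun [set: R] psi -> (forall x, 0 <= psi x)%E ->
    admissible (indicators l1 ++ (t, psi) :: indicators l2).
  move=> m0 p0; apply/admissible_cat; split => // q [<-//|]; exact: al2.
have pf1 : positive_functional La1.
  have := @positive_functional_integral _ Om R P _ (L t) (cst 1%E) mD
    (measurable_funPT (L t)) (measurable_cst _) (fun=> lee01).
  by under eq_fun do under eq_integral do rewrite mul1e.
have pf2 : positive_functional La2.
  have base : positive_functional (fun h : R -> \bar R => \int[eta]_(z in B) (cst 1 z * h z))%E.
    by apply: (@positive_functional_integral _ _ R eta B idfun) => //; exact: measurable_id.
  have lastE psi : last 0 (unzip1 (indicators l1 ++ (t, psi) :: indicators l2)) =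
      last t (unzip1 l2).
    by rewrite /unzip1 map_cat last_cat/= -/(unzip1 _) times_indicators.
  have := @positive_functional_comp _ _ (fun z psi =>
    bridge_weight (indicators l1 ++ (t, psi) :: indicators l2) z) base.
  under eq_fun do under eq_integral do rewrite mul1e.
  apply.
  - move=> z; rewrite /bridge_weight; under eq_fun do rewrite lastE.
    apply: (chain_weight_functional f_meas f_ge0) => //.
    + have := last_factor_measurable (last t (unzip1 l2)).
      by move=> /(measurableT_comp)/(_ (pair1_measurable z)).
    + by move=> y; exact: last_factor_ge0.
  - by move=> psi mpsi psi0; apply: bridge_weight_measurable; exact: ad.
have La1E x : La1 (EFin \o \1_(`]-oo, x]%classic)) =
    P (box (l1 ++ (t, `]-oo, x]%classic) :: l2) `&` L T @^-1` B).
  rewrite /La1 box_insert setIAC [in RHS]setIC.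
  have mA : measurable (L t @^-1` `]-oo, x]%classic) by exact: measurable_funPTI.
  rewrite -(integral_indic P mD mA).
  by apply: eq_integral => w _; rewrite /= !indicE.
apply: (positive_functional_rays_eq pf1 pf2) => //.
- move=> x; rewrite La1E (le_lt_trans (probability_le1 _ _)) ?ltry//.
  apply: measurableI; last exact: measurable_funPTI.
  apply: measurable_box; apply/measurable_sets_cat; split=> // q /= [<-|]; [exact: measurable_itv|exact: ml2].
- move=> x; rewrite La1E hx; apply: eq_integral => z _.
  by rewrite /indicators map_cat.
Qed.

(** The rays are replaced by arbitrary sets one coordinate at a time, from the
last one of [l1] to the first. *)
Lemma box_law_sets l : l <> [::] -> measurable_sets l -> times_ok (unzip1 l) -> box_law l.
Proof.
suff : forall l1, measurable_sets l1 -> forall l2, l1 ++ lower l2 <> [::] ->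
    times_ok (unzip1 (l1 ++ lower l2)) -> box_law (l1 ++ lower l2).
  by move=> h l0 ml ok; have := h l ml [::]; rewrite cats0; exact.
elim/last_ind => [|l1 [t A] IH] ml1 l2 /=.
  move=> l20; rewrite times_lower; apply: box_law_lower.
  by move: l20; case: l2.
move=> _; rewrite cat_rcons => ok B mB.
have [ml1' mA] : measurable_sets l1 /\ measurable A.
  move: ml1; rewrite -cats1 => /measurable_sets_cat[? h]; split => //.
  by apply: (h (t, A)); left.
have := @box_law_weight l1 t (lower l2) B ml1' (@measurable_lower l2) mB.
move=> /(_ _ (EFin \o \1_A)) h.
rewrite box_insert setIAC setIC.
have mD : measurable (box (l1 ++ lower l2) `&` L T @^-1` B).
  apply: measurableI; last exact: measurable_funPTI.
  by apply: measurable_box; apply/measurable_sets_cat; split=> //; exact: measurable_lower.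
rewrite -(integral_indic P mD); last exact: measurable_funPTI.
transitivity (\int[P]_(w in box (l1 ++ lower l2) `&` L T @^-1` B) (EFin \o (\1_A : R -> R)) (L t w))%E.
  by apply: eq_integral => w _; rewrite /= !indicE.
rewrite h//; first by apply: eq_integral => z _; rewrite /indicators map_cat.
- move=> x; apply: (IH ml1' ((t, x) :: l2)) => //.
  + by case: (l1).
  + by move: ok; rewrite /times_ok /unzip1 !map_cat.
- by apply/measurable_EFinP; exact: measurable_indic.
- by move=> x; rewrite /= lee_fin.
Qed.

Lemma box_moment l1 t l2 (B : set R) phi :
  measurable_sets l1 -> measurable_sets l2 -> measurable B ->
  times_ok (unzip1 l1 ++ t :: unzip1 l2) ->
  measurable_fun [set: R] phi -> (forall x, 0 <= phi x)%E ->
  (\int[P]_(w in box (l1 ++ l2) `&` L T @^-1` B) phi (L t w) =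
   \int[eta]_(z in B) bridge_weight (indicators l1 ++ (t, phi) :: indicators l2) z)%E.
Proof.
move=> ml1 ml2 mB ok mphi phi0; apply: box_law_weight => // x.
apply: box_law_sets => //.
- by case: (l1).
- by apply/measurable_sets_cat; split=> // q /= [<-|]; [exact: measurable_itv|exact: ml2].
- by rewrite /unzip1 map_cat.
Qed.

(** The value at T is not a coordinate of the chain, but the variable of the outer
integral; again both sides are positive functionals of the weight. *)
Lemma box_moment_end l (B : set R) phi :
  l <> [::] -> measurable_sets l -> measurable B -> times_ok (unzip1 l) ->
  measurable_fun [set: R] phi -> (forall x, 0 <= phi x)%E ->
  (\int[P]_(w in box l `&` L T @^-1` B) phi (L T w) =
   \int[eta]_(z in B) (phi z * bridge_weight (indicators l) z))%E.
Proof.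
move=> l0 ml mB ok mphi phi0.
have al := indicators_admissible ml.
have mD : measurable (box l `&` L T @^-1` B).
  by apply: measurableI; [exact: measurable_box|exact: measurable_funPTI].
pose La1 (phi : R -> \bar R) := (\int[P]_(w in box l `&` L T @^-1` B) phi (L T w))%E.
pose La2 (phi : R -> \bar R) := (\int[eta]_(z in B) (phi z * bridge_weight (indicators l) z))%E.
have pf1 : positive_functional La1.
  have := @positive_functional_integral _ Om R P _ (L T) (cst 1%E) mD
    (measurable_funPT (L T)) (measurable_cst _) (fun=> lee01).
  by under eq_fun do under eq_integral do rewrite mul1e.
have pf2 : positive_functional La2.
  have := @positive_functional_integral _ _ R eta B idfun (bridge_weight (indicators l)) mB
    (@measurable_id _ _ _) (bridge_weight_measurable al) 
    (fun z => bridge_weight_ge0 z al).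
  by under eq_fun do under eq_integral do rewrite muleC.
have eq12 x : La1 (EFin \o \1_(`]-oo, x]%classic)) = La2 (EFin \o \1_(`]-oo, x]%classic)).
  have mx : measurable (`]-oo, x]%classic : set R) by [].
  transitivity (P (box l `&` L T @^-1` (B `&` `]-oo, x]%classic))).
    rewrite preimage_setI setIA setIC.
    rewrite -(integral_indic P mD); last exact: measurable_funPTI.
    by apply: eq_integral => w _; rewrite /= !indicE.
  rewrite (box_law_sets l0 ml ok); last exact: measurableI.
  rewrite integral_mkcondr; apply: eq_integral => z _.
  by rewrite epatch_indic/= muleC.
apply: (positive_functional_rays_eq pf1 pf2) => // x.
apply: (@le_lt_trans _ _ (\int[P]_(w in box l `&` L T @^-1` B) cst 1 w)%E).
  apply: ge0_le_integral => //.
  - by move=> w _; rewrite lee_fin.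
  - apply/measurable_EFinP; apply: measurable_funTS.
    exact: measurableT_comp (measurable_indic _) (measurable_funPT (L T)).
  - by move=> w _; rewrite /= lee_fin indicE; case: (_ \in _).
by rewrite integral_cst// mul1e (le_lt_trans (probability_le1 _ _)) ?ltry.
Qed.

End bridge_law.

(** * Reflections of the line *)

Lemma integral_reflection (R : realType) (c : R) (F : R -> \bar R) :
  measurable_fun [set: R] F -> (forall x, 0 <= F x)%E ->
  (\int[lebesgue_measure]_x F (c - x)%R = \int[lebesgue_measure]_x F x)%E.
Proof.
move=> mF F0.
pose r : measurableTypeR R -> measurableTypeR R := fun x => c - x.
have mr : measurable_fun [set: measurableTypeR R] r by apply: measurable_funB.
rewrite -[LHS](@ge0_integral_pushforward _ _ _ _ _ r mr lebesgue_measure setT F)//.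
apply: eq_measure_integral => //= A mA _; apply/esym/lebesgue_measure_unique => //= _ [[a b]] _ <-.
rewrite /pushforward (_ : r @^-1` _ = `[c - b, c - a[%classic); last first.
  by apply/seteqP; split => x; rewrite /r/= !in_itv/= => /andP[h1 h2]; apply/andP; split; lra.
by rewrite !lebesgue_measure_itv/= !lte_fin; congr (if _ then _ else _);
  [apply/idP/idP; lra|rewrite -!EFinB; congr (_%:E); lra].
Qed.

(** With [k phi] the integral of [phi] against the symmetric weight
[g (q - p) * g (r - q)], this says that the mean of q under that weight is the
midpoint of p and r. It is stated without any subtraction, so that it holds in
the extended reals even if the means do not exist: with
u q = 2 q^+ + p^- + r^- and v q = 2 q^- + p^+ + r^+, and q' = p + r - q, one has
u q + u q' = v q + v q', and the weight is invariant under q -> q'. *)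
Lemma midpoint_balance (R : realType) (g : R -> \bar R) (p r : R) :
  measurable_fun [set: R] g -> (forall x, 0 <= g x)%E ->
  let k phi := (\int[lebesgue_measure]_q (g (q - p)%R * (phi q * g (r - q)%R)))%E in
  let pos (x : R) : R := Num.max x 0 in let neg (x : R) : R := Num.max (- x) 0 in
  (2%:E * k (fun q => (pos q)%:E) + (neg p + neg r)%:E * k (cst 1) =
   2%:E * k (fun q => (neg q)%:E) + (pos p + pos r)%:E * k (cst 1))%E.
Proof.
move=> mg g0 k pos neg.
pose w q := (g (q - p)%R * g (r - q)%R)%E.
have pos0 x : 0 <= pos x by rewrite /pos le_max lexx orbT.
have neg0 x : 0 <= neg x by rewrite /neg le_max lexx orbT.
have mpos : measurable_fun [set: R] pos by apply: measurable_maxr.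
have mneg : measurable_fun [set: R] neg by apply: measurable_maxr => //; apply: measurableT_comp.
have mw : measurable_fun [set: R] w.
  apply: emeasurable_funM; apply: (measurableT_comp mg).
  - exact: measurable_funB.
  - exact: measurable_funB.
have w0 q : (0 <= w q)%E by rewrite mule_ge0.
have kE phi : k phi = (\int[lebesgue_measure]_q (w q * phi q))%E.
  by apply: eq_integral => q _; rewrite /w -muleA (muleC (phi q)).
have side (phi : R -> R) (c : R) : measurable_fun [set: R] phi -> (forall q, 0 <= phi q) -> 0 <= c ->
    (2%:E * k (fun q => (phi q)%:E) + c%:E * k (cst 1) =
     \int[lebesgue_measure]_q (w q * (2 * phi q + c)%:E))%E.
  move=> mphi phi0 c0.
  have m1 : measurable_fun [set: R] (fun q => w q * (phi q)%:E)%E.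
    by apply: emeasurable_funM => //; exact/measurable_EFinP.
  rewrite !kE -!ge0_integralZl_EFin//; last 3 first.
  - by move=> q _; rewrite /= mule_ge0// lee_fin.
  - by apply: emeasurable_funM.
  - by move=> q _; rewrite mule_ge0// lee_fin.
  rewrite -ge0_integralD//; last 4 first.
  - by move=> q _; rewrite !mule_ge0// lee_fin.
  - by apply: measurable_funeM.
  - by move=> q _; rewrite /= !mule_ge0// lee_fin.
  - by apply: measurable_funeM; apply: emeasurable_funM.
  apply: eq_integral => q _ /=.
  rewrite mule1 (EFinD (_ * _)) (EFinM _ (phi q)) ge0_muleDr ?lee_fin ?mulr_ge0//.
  by rewrite muleCA (muleC c%:E).
rewrite !side ?addr_ge0//.
pose u q := 2 * pos q + (neg p + neg r); pose v q := 2 * neg q + (pos p + pos r).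
have u0 q : 0 <= u q by rewrite !addr_ge0// mulr_ge0.
have v0 q : 0 <= v q by rewrite !addr_ge0// mulr_ge0.
have mu_ : measurable_fun [set: R] u.
  by apply: measurable_funD => //; apply: measurable_funM.
have mv_ : measurable_fun [set: R] v.
  by apply: measurable_funD => //; apply: measurable_funM.
have symw q : w (p + r - q) = w q.
  by rewrite /w muleC; congr (g _ * g _)%E; ring.
have uv q : u q + u (p + r - q) = v q + v (p + r - q).
  have pn x : pos x = neg x + x.
    by rewrite /pos /neg; case: (leP x 0) => h; case: (leP (- x) 0) => h'; lra.
  by rewrite /u /v !pn; ring.
have half (z : R -> R) : measurable_fun [set: R] z -> (forall q, 0 <= z q) ->
    (2%:E * \int[lebesgue_measure]_q (w q * (z q)%:E) =
     \int[lebesgue_measure]_q (w q * (z q + z (p + r - q))%:E))%E.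
  move=> mz z0.
  have mwz : measurable_fun [set: R] (fun q => w q * (z q)%:E)%E.
    by apply: emeasurable_funM => //; exact/measurable_EFinP.
  have wz0 q : (0 <= w q * (z q)%:E)%E by rewrite mule_ge0// lee_fin.
  rewrite (_ : 2%:E = 1 + 1)%E// ge0_muleDl// !mul1e.
  rewrite -[X in (_ + X)%E = _](integral_reflection (p + r))//.
  rewrite -ge0_integralD//.
  - by apply: eq_integral => q _; rewrite symw EFinD ge0_muleDr// lee_fin.
  - apply: (measurableT_comp mwz); exact: measurable_funB.
have two : (2%:E : \bar R) != 0%E by rewrite eqe pnatr_eq0.
have : (2%:E * \int[lebesgue_measure]_q (w q * (u q)%:E) =
        2%:E * \int[lebesgue_measure]_q (w q * (v q)%:E))%E.
  by rewrite !half//; apply: eq_integral => q _; rewrite uv.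
move=> /(congr1 (fun x => (2^-1)%:E * x)%E); rewrite !muleA -!EFinM mulVf ?pnatr_eq0// !mul1e.
by [].
Qed.

(** * Exchanging two adjacent increments of equal length *)

Section swap.
Variables (R : realType) (T : R) (f : R -> R -> \bar R).
Hypothesis T_gt0 : 0 < T.
Hypothesis f_meas : forall t, 0 < t <= T -> measurable_fun [set: R] (f t).
Hypothesis f_ge0 : forall t x, 0 < t <= T -> (0 <= f t x)%E.
Variables (d : measure_display) (Om : measurableType d) (P : probability Om R).
Variable L : R -> {RV P >-> R}.
Hypothesis L_bridge : forall l : seq (R * R), l <> [::] -> path <%R 0 (rcons (unzip1 l) T) ->
  cond_prob_given (L T) [set w | forall p, p \in l -> L p.1 w <= p.2] (levy_bridge_cdf f T l).

Let eta := distribution P (L T).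
Let pos (x : R) : R := Num.max x 0.
Let neg (x : R) : R := Num.max (- x) 0.
Let pos0 x : 0 <= pos x. Proof. by rewrite /pos le_max lexx orbT. Qed.
Let neg0 x : 0 <= neg x. Proof. by rewrite /neg le_max lexx orbT. Qed.
Let mpos : measurable_fun [set: R] pos. Proof. exact: measurable_maxr. Qed.
Let mneg : measurable_fun [set: R] neg.
Proof. by apply: measurable_maxr => //; apply: measurableT_comp. Qed.

(** The pair q consists of the neighbours of the middle point, each at the distance
h in time. *)
Definition mid (h : R) (phi : R -> \bar R) (q : R * R) : \bar R :=
  (\int[lebesgue_measure]_y (dens T f h (y - q.1)%R * (phi y * dens T f h (q.2 - y)%R)))%E.

Lemma mid_ge0 h phi q : (forall x, 0 <= phi x)%E -> (0 <= mid h phi q)%E.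
Proof. by move=> p0; apply: integral_ge0 => y _; rewrite !mule_ge0// dens_nonneg. Qed.

Lemma mid_measurable h phi : measurable_fun [set: R] phi -> (forall x, 0 <= phi x)%E ->
  measurable_fun [set: R * R] (mid h phi).
Proof.
move=> mphi phi0.
pose F (q : (R * R) * (measurableTypeR R)) : \bar R :=
  (dens T f h (q.2 - q.1.1)%R * (phi q.2 * dens T f h (q.1.2 - q.2)%R))%E.
apply: (@measurable_fun_fubini_tonelli_F _ _ _ (measurableTypeR R) R lebesgue_measure F).
- apply: emeasurable_funM.
    apply: (measurableT_comp (dens_measurable f_meas h)).
    apply: measurable_funB; first exact: measurable_snd.
    exact: (measurableT_comp measurable_fst measurable_fst).
  apply: emeasurable_funM; first exact: (measurableT_comp mphi measurable_snd).
  apply: (measurableT_comp (dens_measurable f_meas h)).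
  apply: measurable_funB; last exact: measurable_snd.
  exact: (measurableT_comp measurable_snd measurable_fst).
- by move=> q; rewrite !mule_ge0// dens_nonneg.
Qed.

(** The identity of [midpoint_balance] is integrated against [Th], the part of the
nested integral that does not involve the middle point. Here Y is the value at
the middle point, X and Z those at its neighbours. *)
Lemma balance_of_functional (h : R) (A : set Om) (X Y Z : Om -> R) (I J : set R)
    (Th : (R * R -> \bar R) -> \bar R) :
  measurable A -> measurable_fun [set: Om] X -> measurable_fun [set: Om] Y ->
  measurable_fun [set: Om] Z -> measurable I -> measurable J ->
  (forall (c : R) u v, 0 <= c -> measurable_fun [set: R * R] u -> (forall q, 0 <= u q)%E ->
     measurable_fun [set: R * R] v -> (forall q, 0 <= v q)%E ->
     Th (fun q => c%:E * u q + v q)%E = (c%:E * Th u + Th v)%E) ->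
  let IJ (q : R * R) : \bar R := ((\1_I q.1 : R) * (\1_J q.2 : R))%:E in
  (forall phi : R -> \bar R, measurable_fun [set: R] phi -> (forall x, 0 <= phi x)%E ->
    (forall x, phi x \is a fin_num) ->
    [/\ (\int[P]_(w in A) phi (Y w) = Th (fun q => IJ q * mid h phi q))%E,
        (\int[P]_(w in A) phi (X w) = Th (fun q => phi q.1 * (IJ q * mid h (cst 1) q)))%E &
        (\int[P]_(w in A) phi (Z w) = Th (fun q => phi q.2 * (IJ q * mid h (cst 1) q)))%E]) ->
  (\int[P]_(w in A) (2 * pos (Y w) + (neg (X w) + neg (Z w)))%:E =
   \int[P]_(w in A) (2 * neg (Y w) + (pos (X w) + pos (Z w)))%:E)%E.
Proof.
move=> mA mX mY mZ mI mJ ThD IJ hTh.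
have mIJ : measurable_fun [set: R * R] IJ.
  apply/measurable_EFinP; apply: measurable_funM.
  - exact: measurableT_comp (measurable_indic mI) measurable_fst.
  - exact: measurableT_comp (measurable_indic mJ) measurable_snd.
have IJ0 q : (0 <= IJ q)%E by rewrite lee_fin mulr_ge0.
have mI1 : measurable_fun [set: R * R] (fun q => IJ q * mid h (cst 1) q)%E.
  by apply: emeasurable_funM => //; apply: mid_measurable.
have alg (i m n b1 b2 : \bar R) : (0 <= i -> 0 <= m -> 0 <= n -> 0 <= b1 -> 0 <= b2 ->
    2%:E * (i * m) + (1 * (b1 * (i * n)) + b2 * (i * n)) =
    i * (2%:E * m + (b1 + b2) * n))%E.
  move=> i0 m0 n0 b10 b20.
  have two0 : (0 <= 2%:E :> \bar R)%E by rewrite lee_fin.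
  rewrite mul1e ge0_muleDl// ge0_muleDr ?adde_ge0 ?mule_ge0// ge0_muleDr ?mule_ge0//.
  by rewrite (muleCA i 2%:E) (muleCA i b1) (muleCA i b2).
have side (a b : R -> R) : measurable_fun [set: R] a -> measurable_fun [set: R] b ->
    (forall x, 0 <= a x) -> (forall x, 0 <= b x) ->
    (\int[P]_(w in A) (2 * a (Y w) + (b (X w) + b (Z w)))%:E =
     Th (fun q => IJ q * (2%:E * mid h (EFin \o a) q + (b q.1 + b q.2)%:E * mid h (cst 1) q)))%E.
  move=> ma mb a0 b0.
  have mEa : measurable_fun [set: R] (EFin \o a) by exact/measurable_EFinP.
  have mEb : measurable_fun [set: R] (EFin \o b) by exact/measurable_EFinP.
  have Ea0 x : (0 <= (EFin \o a) x)%E by rewrite lee_fin.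
  have Eb0 x : (0 <= (EFin \o b) x)%E by rewrite lee_fin.
  have [h1 _ _] := hTh _ mEa Ea0 (fun=> erefl).
  have [_ h2 h3] := hTh _ mEb Eb0 (fun=> erefl).
  have mAE (V : Om -> R) (g : R -> R) : measurable_fun [set: Om] V -> measurable_fun [set: R] g ->
      measurable_fun A (fun w => (g (V w))%:E).
    by move=> mV mg; apply: measurable_funTS; apply/measurable_EFinP; exact: measurableT_comp.
  transitivity (2%:E * \int[P]_(w in A) (a (Y w))%:E +
      (\int[P]_(w in A) (b (X w))%:E + \int[P]_(w in A) (b (Z w))%:E))%E.
    rewrite -ge0_integralD//; last 4 first.
    - by move=> w _; rewrite lee_fin.
    - exact: mAE.
    - by move=> w _; rewrite lee_fin.
    - exact: mAE.
    rewrite -ge0_integralZl_EFin//; last 2 first.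
    - by move=> w _; rewrite lee_fin.
    - exact: mAE.
    rewrite -ge0_integralD//.
    - by move=> w _; rewrite mule_ge0// lee_fin.
    - by apply: measurable_funeM; exact: mAE.
    - by move=> w _; rewrite adde_ge0// lee_fin.
    - by apply: emeasurable_funD; exact: mAE.
  have hb1 : measurable_fun [set: R * R] (fun q => (b q.1)%:E * (IJ q * mid h (cst 1) q))%E.
    by apply: emeasurable_funM => //; exact: measurableT_comp mEb measurable_fst.
  have hb2 : measurable_fun [set: R * R] (fun q => (b q.2)%:E * (IJ q * mid h (cst 1) q))%E.
    by apply: emeasurable_funM => //; exact: measurableT_comp mEb measurable_snd.
  have m1 q : (0 <= mid h (cst 1) q)%E by exact: mid_ge0.
  have hb10 q : (0 <= (b q.1)%:E * (IJ q * mid h (cst 1) q))%E by rewrite !mule_ge0// lee_fin.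
  have hb20 q : (0 <= (b q.2)%:E * (IJ q * mid h (cst 1) q))%E by rewrite !mule_ge0// lee_fin.
  have ma1 : measurable_fun [set: R * R] (fun q => IJ q * mid h (EFin \o a) q)%E.
    by apply: emeasurable_funM => //; exact: mid_measurable.
  have ma0 q : (0 <= IJ q * mid h (EFin \o a) q)%E by rewrite mule_ge0// mid_ge0.
  rewrite h1 h2 h3 -[X in (_ + (X + _))%E]mul1e -(ThD _ _ _ ler01 hb1 hb10 hb2 hb20).
  rewrite -(ThD _ _ _ (ler0n _ 2) ma1 ma0); last 2 first.
  - by apply: emeasurable_funD => //; exact: measurable_funeM.
  - by move=> q; rewrite mul1e adde_ge0.
  congr Th; apply/funext => q /=.
  by apply: alg => //; rewrite ?lee_fin//; exact: mid_ge0.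
rewrite (side pos neg)// (side neg pos)//; congr Th; apply/funext => q.
congr (_ * _)%E.
exact: (midpoint_balance q.1 q.2 (dens_measurable f_meas h) (dens_nonneg f_ge0 h)).
Qed.

Let indicator_measurable (S : set R) : measurable S -> measurable_fun [set: R] (EFin \o (\1_S : R -> R)).
Proof. by move=> mS; apply/measurable_EFinP; exact: measurable_indic. Qed.

Let indicator_ge0 (S : set R) x : (0 <= (EFin \o (\1_S : R -> R)) x)%E.
Proof. by rewrite /= lee_fin. Qed.

Let indicator_setT : EFin \o (\1_[set: R] : R -> R) = cst 1%E.
Proof. by apply/funext => x; rewrite /= indicT. Qed.

Let measurable_sets_cons t (S : set R) l : measurable S -> measurable_sets l ->
  measurable_sets ((t, S) :: l).
Proof. by move=> mS ml q /= [<-//|]; exact: ml. Qed.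

Let integral_supported (S : set R) t (A D : set Om) (phi : R -> \bar R) :
  A = D `&` L t @^-1` S ->
  (\int[P]_(w in A) phi (L t w) = \int[P]_(w in D) (fun x => phi x * (\1_S x : R)%:E) (L t w))%E.
Proof.
move=> ->; rewrite integral_mkcondr; apply: eq_integral => w _.
by rewrite epatch_indic/= !indicE.
Qed.

Let supported_measurable (S : set R) phi : measurable S -> measurable_fun [set: R] phi ->
  measurable_fun [set: R] (fun x => phi x * (\1_S x : R)%:E)%E.
Proof. by move=> mS mphi; apply: emeasurable_funM => //; exact: indicator_measurable. Qed.

Let supported_ge0 (S : set R) phi x : (forall x, 0 <= phi x)%E -> (0 <= phi x * (\1_S x : R)%:E)%E.
Proof. by move=> phi0; rewrite mule_ge0// lee_fin. Qed.

(** Integrating the later point last puts the two weights of the middle point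
together. *)
Lemma integral_middle_first (h p : R) (fm ft H : R -> \bar R) :
  measurable_fun [set: R] fm -> (forall x, 0 <= fm x)%E ->
  measurable_fun [set: R] ft -> (forall x, 0 <= ft x)%E ->
  measurable_fun [set: R] H -> (forall x, 0 <= H x)%E ->
  (\int[lebesgue_measure]_q (dens T f h (q - p)%R *
     (fm q * \int[lebesgue_measure]_r (dens T f h (r - q)%R * (ft r * H r)))) =
   \int[lebesgue_measure]_r (H r * (ft r * mid h fm (p, r))))%E.
Proof.
move=> mfm fm0 mft ft0 mH H0.
pose G (q r : R) := (dens T f h (q - p)%R * (fm q * (dens T f h (r - q)%R * (ft r * H r))))%E.
have mG : measurable_fun [set: measurableTypeR R * measurableTypeR R] (fun q => G q.1 q.2).
  apply: emeasurable_funM.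
    apply: (measurableT_comp (dens_measurable f_meas h)).
    by apply: measurable_funB => //; exact: measurable_fst.
  apply: emeasurable_funM; first exact: (measurableT_comp mfm measurable_fst).
  apply: emeasurable_funM.
    apply: (measurableT_comp (dens_measurable f_meas h)).
    by apply: measurable_funB; [exact: measurable_snd|exact: measurable_fst].
  by apply: emeasurable_funM; [exact: (measurableT_comp mft measurable_snd)
                              |exact: (measurableT_comp mH measurable_snd)].
have G0 q : (0 <= G q.1 q.2)%E by rewrite !mule_ge0// dens_nonneg.
have mdens (c : R) : measurable_fun [set: R] (fun r => dens T f h (r - c)%R).
  by apply: (measurableT_comp (dens_measurable f_meas h)); exact: measurable_funB.
have mdens' (c : R) : measurable_fun [set: R] (fun r => dens T f h (c - r)%R).
  by apply: (measurableT_comp (dens_measurable f_meas h)); exact: measurable_funB.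
transitivity (\int[lebesgue_measure]_q \int[lebesgue_measure]_r G q r)%E.
  apply: eq_integral => q _.
  rewrite ge0_integralZl//; last 3 first.
  - by apply: measurable_funeM; apply: emeasurable_funM; [exact: mdens|exact: emeasurable_funM].
  - by move=> r _; rewrite !mule_ge0// dens_nonneg.
  - exact: dens_nonneg.
  congr (_ * _)%E; rewrite ge0_integralZl//.
  - by apply: emeasurable_funM; [exact: mdens|exact: emeasurable_funM].
  - by move=> r _; rewrite !mule_ge0// dens_nonneg.
rewrite (@fubini_tonelli _ _ (measurableTypeR R) (measurableTypeR R) R lebesgue_measure
  lebesgue_measure (fun q => G q.1 q.2))//=.
apply: eq_integral => r _ /=; rewrite /mid /= muleA.
have mK : measurable_fun [set: measurableTypeR R]
    (fun x => dens T f h (x - p)%R * (fm x * dens T f h (r - x)%R))%E.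
  by apply: emeasurable_funM; [exact: mdens|apply: emeasurable_funM => //; exact: mdens'].
have K0 x : [set: measurableTypeR R] x ->
    (0 <= dens T f h (x - p)%R * (fm x * dens T f h (r - x)%R))%E.
  by move=> _; rewrite !mule_ge0// dens_nonneg.
have c0 : (0 <= H r * ft r)%E by rewrite mule_ge0.
rewrite -(ge0_integralZl lebesgue_measure measurableT mK K0 c0).
apply: eq_integral => q _; rewrite /G [RHS]muleC (muleC (H r)) -!muleA.
by [].
Qed.

(** The nested integral over the past of a, as a functional of the weight [u] of
the pair formed by the point at a and a later one; [V] integrates out the later
points. *)
Definition past_chain l1 a (V : (R * R -> \bar R) -> R -> R -> \bar R) (u : R * R -> \bar R) (z : R) :=
  chain T f 0 (rcons (indicators l1) (a, cst 1%E)) (V u z) 0.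

Lemma past_chain_lin l1 a (B : set R) (V : (R * R -> \bar R) -> R -> R -> \bar R) :
  measurable_sets l1 -> measurable B ->
  (forall u, measurable_fun [set: R * R] u -> (forall q, 0 <= u q)%E ->
     measurable_fun [set: R * R] (fun q => V u q.1 q.2)) ->
  (forall u z p, (forall q, 0 <= u q)%E -> (0 <= V u z p)%E) ->
  (forall (c : R) u v z p, 0 <= c -> measurable_fun [set: R * R] u -> (forall q, 0 <= u q)%E ->
     measurable_fun [set: R * R] v -> (forall q, 0 <= v q)%E ->
     V (fun q => c%:E * u q + v q)%E z p = (c%:E * V u z p + V v z p)%E) ->
  forall (c : R) u v, 0 <= c -> measurable_fun [set: R * R] u -> (forall q, 0 <= u q)%E ->
    measurable_fun [set: R * R] v -> (forall q, 0 <= v q)%E ->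
    (\int[eta]_(z in B) past_chain l1 a V (fun q => c%:E * u q + v q) z =
     c%:E * \int[eta]_(z in B) past_chain l1 a V u z + \int[eta]_(z in B) past_chain l1 a V v z)%E.
Proof.
move=> ml1 mB mV V0 VD c u v c0 mu_ u0 mv_ v0.
have al1 : admissible (rcons (indicators l1) (a, cst 1%E)).
  by apply: admissible_rcons => //; exact: indicators_admissible.
have mpast w : measurable_fun [set: R * R] w -> (forall q, 0 <= w q)%E ->
    measurable_fun B (past_chain l1 a V w).
  move=> mw w0; apply: measurable_funTS.
  have := chain_measurable2 f_meas f_ge0 0 al1 (mV w mw w0) (fun z p => V0 w z p w0).
  by move=> /(measurableT_comp)/(_ (pair2_measurable (0 : R))).
have past0 w z : (forall q, 0 <= w q)%E -> (0 <= past_chain l1 a V w z)%E.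
  by move=> w0; apply: chain_ge0 => // y; exact: V0.
have mpair w z : measurable_fun [set: R * R] w -> (forall q, 0 <= w q)%E ->
    measurable_fun [set: R] (V w z).
  by move=> mw w0; exact: (measurableT_comp (mV w mw w0) (pair1_measurable z)).
rewrite -ge0_integralZl_EFin//; last 2 first.
- by move=> z _; exact: past0.
- exact: mpast.
rewrite -ge0_integralD//; last 4 first.
- by move=> z _; rewrite mule_ge0// past0.
- by apply: measurable_funeM; exact: mpast.
- by move=> z _; rewrite past0.
- exact: mpast.
apply: eq_integral => z _; rewrite /past_chain.
have pfc := chain_positive_functional f_meas f_ge0 0 0 al1.
rewrite -(pf_lin pfc)//.
- apply: (congr1 (fun g => chain T f 0 (rcons (indicators l1) (a, cst 1%E)) g 0)).
  by apply/funext => p; exact: VD.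
- exact: mpair.
- by move=> p; exact: V0.
- exact: mpair.
- by move=> p; exact: V0.
Qed.

(** The points after a + 2h are integrated out first, into the kernel H, and the
middle point then sees only its two neighbours. The case a + 2h = T is separate,
since T is not a coordinate of the chain: there the right neighbour of the middle
point is the variable of the outer integral against the law of the end point. *)
Lemma box_balance_inner l1 a h l2 (I J B : set R) :
  measurable_sets l1 -> measurable_sets l2 -> measurable I -> measurable J -> measurable B ->
  times_ok T (unzip1 l1 ++ [:: a, a + h, a + h + h & unzip1 l2]) ->
  let A := box L l1 `&` (L a @^-1` I `&` (L (a + h)%R @^-1` setT `&` (L (a + h + h)%R @^-1` J `&` box L l2)))
    `&` L T @^-1` B in
  (\int[P]_(w in A) (2 * pos (L (a + h) w) + (neg (L a w) + neg (L (a + h + h) w)))%:E =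
   \int[P]_(w in A) (2 * neg (L (a + h) w) + (pos (L a w) + pos (L (a + h + h) w)))%:E)%E.
Proof.
move=> ml1 ml2 mI mJ mB ok A.
have al1 := indicators_admissible ml1; have al2 := indicators_admissible ml2.
pose s1 := last 0 (unzip1 (indicators l1)).
pose H z r := chain T f (a + h + h) (indicators l2)
  (last_factor T f (last (a + h + h) (unzip1 (indicators l2))) z) r.
have H0 z r : (0 <= H z r)%E by apply: chain_ge0 => // y; exact: last_factor_ge0.
have mH : measurable_fun [set: R * R] (fun q => H q.1 q.2).
  by apply: chain_measurable2 => //; [exact: last_factor_measurable|move=> z y; exact: last_factor_ge0].
pose V (u : R * R -> \bar R) (z p : R) := (\int[lebesgue_measure]_r (H z r * u (p, r)))%E.
have mV u : measurable_fun [set: R * R] u -> (forall q, 0 <= u q)%E ->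
    measurable_fun [set: R * R] (fun q => V u q.1 q.2).
  move=> mu_ u0.
  pose F (q : (R * R) * (measurableTypeR R)) : \bar R := (H q.1.1 q.2 * u (q.1.2, q.2))%E.
  apply: (@measurable_fun_fubini_tonelli_F _ _ _ (measurableTypeR R) R lebesgue_measure F).
  - apply: emeasurable_funM.
      apply: (@measurableT_comp _ _ _ _ _ _ (fun q : R * R => H q.1 q.2) setT
        (fun x => (x.1.1, x.2)) mH).
      apply/measurable_fun_pairP; split; last exact: measurable_snd.
      exact: (measurableT_comp measurable_fst measurable_fst).
    apply: (measurableT_comp mu_); apply/measurable_fun_pairP; split; last exact: measurable_snd.
    exact: (measurableT_comp measurable_snd measurable_fst).
  - by move=> q; rewrite mule_ge0.
have V0 u z p : (forall q, 0 <= u q)%E -> (0 <= V u z p)%E.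
  by move=> u0; apply: integral_ge0 => r _; rewrite mule_ge0.
have mpair (u : R * R -> \bar R) p : measurable_fun [set: R * R] u ->
    measurable_fun [set: R] (fun r => u (p, r)).
  by move=> mu_; exact: (measurableT_comp mu_ (pair1_measurable p)).
have VD (c : R) u v z p : 0 <= c -> measurable_fun [set: R * R] u -> (forall q, 0 <= u q)%E ->
    measurable_fun [set: R * R] v -> (forall q, 0 <= v q)%E ->
    V (fun q => c%:E * u q + v q)%E z p = (c%:E * V u z p + V v z p)%E.
  move=> c0 mu_ u0 mv_ v0.
  have pfV := @positive_functional_integral _ (measurableTypeR R) R lebesgue_measure setT idfun
    (H z) measurableT (@measurable_id _ _ _) (mpair (fun q => H q.1 q.2) z mH) (H0 z).
  by have := pf_lin pfV c0 (mpair _ p mu_) (fun r => u0 (p, r)) (mpair _ p mv_) (fun r => v0 (p, r)).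
pose last1 := past_chain l1 a V.
pose Th (u : R * R -> \bar R) := (\int[eta]_(z in B) last1 u z)%E.
have mA : measurable A.
  by rewrite /A; repeat (apply: measurableI => //); try (exact: measurable_funPTI); exact: measurable_box.
apply: (@balance_of_functional h A (L a) (L (a + h)) (L (a + h + h)) I J Th) => //.
- exact: past_chain_lin.
- pose W (fa fm ft : R -> \bar R) z :=
    bridge_weight T f (indicators l1 ++ [:: (a, fa), (a + h, fm), (a + h + h, ft) & indicators l2]) z.
  have WE fa fm ft z :
      measurable_fun [set: R] fa -> (forall x, 0 <= fa x)%E ->
      measurable_fun [set: R] fm -> (forall x, 0 <= fm x)%E ->
      measurable_fun [set: R] ft -> (forall x, 0 <= ft x)%E ->
      W fa fm ft z = last1 (fun q => fa q.1 * (ft q.2 * mid h fm q))%E z.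
    move=> mfa fa0 mfm fm0 mft ft0.
    rewrite /W /last1 /past_chain /bridge_weight chain_cat -cats1 chain_cat.
    apply: (congr1 (fun g => chain T f 0 (indicators l1) g 0)); apply/funext => y /=.
    apply: eq_integral => p _; congr (_ * _)%E; rewrite mul1e.
    have -> : a + h - a = h by ring.
    have -> : a + h + h - (a + h) = h by ring.
    have -> : last 0 (unzip1 (indicators l1 ++ [:: (a, fa), (a + h, fm), (a + h + h, ft) & indicators l2])) =
       last (a + h + h) (unzip1 (indicators l2)) by rewrite /unzip1 map_cat last_cat.
    rewrite /V -/(H z).
    have mHz : measurable_fun [set: R] (H z) by exact: (mpair (fun q => H q.1 q.2) z mH).
    rewrite (integral_middle_first h p mfm fm0 mft ft0 mHz (H0 z)).
    rewrite -ge0_integralZl//; last 2 first.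
    + apply: emeasurable_funM => //; apply: emeasurable_funM => //.
      exact: (measurableT_comp (mid_measurable h mfm fm0) (pair1_measurable p)).
    + by move=> r _; rewrite !mule_ge0// mid_ge0.
    by apply: eq_integral => r _; rewrite muleCA.
  move=> phi mphi phi0 _.
  have mEi := indicator_measurable; have Ei0 := indicator_ge0.
  have mphiS S mS := @supported_measurable S phi mS mphi.
  have phiS0 S x := @supported_ge0 S phi x phi0.
  split.
  + have -> : A = box L ((l1 ++ [:: (a, I)]) ++ (a + h + h, J) :: l2) `&` L T @^-1` B.
      by rewrite /A !box_cat/= setIT -!setIA preimage_setT setTI.
    rewrite (box_moment T_gt0 f_meas f_ge0 L_bridge)//.
    * apply: eq_integral => z _.
      have := WE _ _ _ z (mEi I mI) (Ei0 I) mphi phi0 (mEi J mJ) (Ei0 J).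
      rewrite /W /indicators map_cat -catA /= => ->.
      by apply: (congr1 (fun u => last1 u z)); apply/funext => q; rewrite muleA EFinM.
    * by apply/measurable_sets_cat; split=> //; exact: measurable_sets_cons.
    * exact: measurable_sets_cons.
    * by move: ok; rewrite /unzip1 map_cat -catA.
  + rewrite (@integral_supported I a A (box L (l1 ++ [:: (a + h, setT), (a + h + h, J) & l2]) `&` L T @^-1` B))//; last first.
      by rewrite /A !box_cat/=; apply/seteqP; split=> w /=; tauto.
    have ms' : measurable_sets [:: (a + h, setT), (a + h + h, J) & l2].
      by apply: measurable_sets_cons => //; exact: measurable_sets_cons.
    rewrite (@box_moment _ _ _ T_gt0 f_meas f_ge0 _ _ _ _ L_bridge l1 a
      _ B (fun x => phi x * (\1_I x : R)%:E)%E ml1 ms' mB ok (mphiS I mI) (phiS0 I)).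
    apply: eq_integral => z _.
    have := WE _ _ _ z (mphiS I mI) (phiS0 I) (mEi setT measurableT) (Ei0 setT) (mEi J mJ) (Ei0 J).
    rewrite /W /indicators /= => ->.
    by apply: (congr1 (fun u => last1 u z)); apply/funext => q; rewrite indicator_setT EFinM -!muleA.
  + rewrite (@integral_supported J (a + h + h) A (box L ((l1 ++ [:: (a, I); (a + h, setT)]) ++ l2) `&` L T @^-1` B))//; last first.
      by rewrite /A !box_cat/=; apply/seteqP; split=> w /=; tauto.
    have ok' : times_ok T (unzip1 (l1 ++ [:: (a, I); (a + h, setT)]) ++ (a + h + h) :: unzip1 l2).
      by move: ok; rewrite /unzip1 map_cat -catA.
    have ms' : measurable_sets (l1 ++ [:: (a, I); (a + h, setT)]).
      by apply/measurable_sets_cat; split=> //; apply: measurable_sets_cons => //; exact: measurable_sets_cons.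
    rewrite (@box_moment _ _ _ T_gt0 f_meas f_ge0 _ _ _ _ L_bridge _ (a + h + h)
      l2 B (fun x => phi x * (\1_J x : R)%:E)%E ms' ml2 mB ok' (mphiS J mJ) (phiS0 J)).
    apply: eq_integral => z _.
    have := WE _ _ _ z (mEi I mI) (Ei0 I) (mEi setT measurableT) (Ei0 setT) (mphiS J mJ) (phiS0 J).
    rewrite /W /indicators map_cat -catA /= => ->.
    by apply: (congr1 (fun u => last1 u z)); apply/funext => q; rewrite indicator_setT EFinM -!muleA [RHS]muleCA.
Qed.

Lemma box_balance_end l1 a h (I B : set R) :
  measurable_sets l1 -> measurable I -> measurable B ->
  times_ok T (unzip1 l1 ++ [:: a; a + h]) -> T = a + h + h ->
  let A := box L l1 `&` (L a @^-1` I `&` L (a + h)%R @^-1` setT) `&` L T @^-1` B in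
  (\int[P]_(w in A) (2 * pos (L (a + h) w) + (neg (L a w) + neg (L T w)))%:E =
   \int[P]_(w in A) (2 * neg (L (a + h) w) + (pos (L a w) + pos (L T w)))%:E)%E.
Proof.
move=> ml1 mI mB ok Tah A.
have al1 := indicators_admissible ml1.
pose c (z : R) : \bar R := (fine (f T z))^-1%:E.
have c0 z : (0 <= c z)%E.
  by rewrite lee_fin invr_ge0 fine_ge0// f_ge0// T_gt0 lexx.
have mc : measurable_fun [set: R] c by exact: last_factor_scale_measurable.
pose V (u : R * R -> \bar R) (z p : R) := (c z * u (p, z))%E.
have mV u : measurable_fun [set: R * R] u ->
    measurable_fun [set: R * R] (fun q => V u q.1 q.2).
  move=> mu_; apply: emeasurable_funM; first exact: (measurableT_comp mc measurable_fst).
  by apply: (measurableT_comp mu_); apply/measurable_fun_pairP;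
    split; [exact: measurable_snd|exact: measurable_fst].
have V0 u z p : (forall q, 0 <= u q)%E -> (0 <= V u z p)%E.
  by move=> u0; rewrite mule_ge0.
have mpair (u : R * R -> \bar R) p : measurable_fun [set: R * R] u ->
    measurable_fun [set: R] (fun r => u (p, r)).
  by move=> mu_; exact: (measurableT_comp mu_ (pair1_measurable p)).
pose last1 := past_chain l1 a V.
have al1' : admissible (rcons (indicators l1) (a, cst 1%E)) by exact: admissible_rcons.
have pfc := chain_positive_functional f_meas f_ge0 0 0 al1'.
pose Th (u : R * R -> \bar R) := (\int[eta]_(z in B) last1 u z)%E.
have mA : measurable A.
  by rewrite /A; repeat (apply: measurableI => //); try (exact: measurable_funPTI); exact: measurable_box.
apply: (@balance_of_functional h A (L a) (L (a + h)) (L T) I setT Th) => //.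
- apply: past_chain_lin => //; first by move=> u mu_ _; exact: mV.
  move=> k u v z p k0 _ u0 _ v0; rewrite /V ge0_muleDr ?mule_ge0 ?lee_fin//.
  by rewrite muleCA.
- pose W (fa fm : R -> \bar R) z :=
    bridge_weight T f (indicators l1 ++ [:: (a, fa); (a + h, fm)]) z.
  have WE fa fm z :
      measurable_fun [set: R] fa -> (forall x, 0 <= fa x)%E ->
      measurable_fun [set: R] fm -> (forall x, 0 <= fm x)%E ->
      W fa fm z = last1 (fun q => fa q.1 * mid h fm q)%E z.
    move=> mfa fa0 mfm fm0.
    rewrite /W /last1 /past_chain /bridge_weight chain_cat -cats1 chain_cat.
    apply: (congr1 (fun g => chain T f 0 (indicators l1) g 0)); apply/funext => y /=.
    apply: eq_integral => p _; congr (_ * _)%E; rewrite mul1e.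
    have -> : a + h - a = h by ring.
    have -> : last 0 (unzip1 (indicators l1 ++ [:: (a, fa); (a + h, fm)])) = a + h.
      by rewrite /unzip1 map_cat last_cat.
    rewrite /last_factor (_ : T - (a + h) = h); last by rewrite Tah; ring.
    have mK : measurable_fun [set: measurableTypeR R]
        (fun x => dens T f h (x - p)%R * (fm x * dens T f h (z - x)%R))%E.
      apply: emeasurable_funM.
        apply: (measurableT_comp (dens_measurable f_meas h)); exact: measurable_funB.
      apply: emeasurable_funM => //.
      apply: (measurableT_comp (dens_measurable f_meas h)); exact: measurable_funB.
    have K0 x : [set: measurableTypeR R] x ->
        (0 <= dens T f h (x - p)%R * (fm x * dens T f h (z - x)%R))%E.
      by move=> _; rewrite !mule_ge0// dens_nonneg.
    rewrite /V muleCA; congr (_ * _)%E.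
    rewrite /mid -(ge0_integralZl lebesgue_measure measurableT mK K0 (c0 z)).
    apply: eq_integral => q _.
    by rewrite [RHS]muleC -!muleA.
  move=> phi mphi phi0 phifin.
  have mEi := indicator_measurable; have Ei0 := indicator_ge0.
  have mphiS S mS := @supported_measurable S phi mS mphi.
  have phiS0 S x := @supported_ge0 S phi x phi0.
  have ms0 : @measurable_sets R [::] by [].
  have msl : measurable_sets (l1 ++ [:: (a, I); (a + h, setT)]).
    by apply/measurable_sets_cat; split=> //; do 2 apply: measurable_sets_cons => //.
  have okl : times_ok T (unzip1 (l1 ++ [:: (a, I); (a + h, setT)])) by rewrite /unzip1 map_cat.
  split.
  + have -> : A = box L ((l1 ++ [:: (a, I)]) ++ [::]) `&` L T @^-1` B.
      by rewrite /A !box_cat/=; apply/seteqP; split=> w /=; tauto.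
    have msI : measurable_sets (l1 ++ [:: (a, I)]).
      by apply/measurable_sets_cat; split=> //; exact: measurable_sets_cons.
    have okI : times_ok T (unzip1 (l1 ++ [:: (a, I)]) ++ (a + h) :: unzip1 ([::] : seq (R * set R))).
      by rewrite /unzip1 map_cat -catA.
    rewrite (@box_moment _ _ _ T_gt0 f_meas f_ge0 _ _ _ _ L_bridge _ (a + h)
      [::] B phi msI ms0 mB okI mphi phi0).
    apply: eq_integral => z _.
    have := WE _ _ z (mEi I mI) (Ei0 I) mphi phi0.
    rewrite /W /indicators map_cat -catA /= => ->.
    by apply: (congr1 (fun u => last1 u z)); apply/funext => q; rewrite indicT mulr1.
  + transitivity (\int[P]_(w in box L (l1 ++ [:: ((a + h)%R, setT)]) `&` L T @^-1` B)
        (fun x => phi x * (\1_I x : R)%:E) (L a w))%E.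
      apply: integral_supported; rewrite /A !box_cat/=; apply/seteqP; split=> w /=; tauto.
    have ms' : measurable_sets [:: (a + h, setT : set R)] by exact: measurable_sets_cons.
    rewrite (@box_moment _ _ _ T_gt0 f_meas f_ge0 _ _ _ _ L_bridge l1 a
      _ B (fun x => phi x * (\1_I x : R)%:E)%E ml1 ms' mB ok (mphiS I mI) (phiS0 I)).
    apply: eq_integral => z _.
    have := WE _ _ z (mphiS I mI) (phiS0 I) (mEi setT measurableT) (Ei0 setT).
    rewrite /W /indicators /= => ->.
    by apply: (congr1 (fun u => last1 u z)); apply/funext => q; rewrite indicator_setT indicT mulr1 -!muleA.
  + have -> : A = box L (l1 ++ [:: (a, I); (a + h, setT)]) `&` L T @^-1` B.
      by rewrite /A !box_cat/=; apply/seteqP; split=> w /=; tauto.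
    have nel : l1 ++ [:: (a, I); (a + h, setT)] <> [::] by case: (l1).
    rewrite (box_moment_end T_gt0 f_meas f_ge0 L_bridge nel msl mB okl mphi phi0).
    apply: eq_integral => z _.
    have := WE _ _ z (mEi I mI) (Ei0 I) (mEi setT measurableT) (Ei0 setT).
    rewrite /W /indicators map_cat /= => ->.
    have pz0 : 0 <= fine (phi z) by rewrite fine_ge0.
    rewrite -(fineK (phifin z)) /last1 /past_chain -[LHS]adde0.
    have m1 : measurable_fun [set: R * R] (fun q : R * R => (\1_I q.1 : R)%:E * mid h (EFin \o \1_[set: R]) q)%E.
      apply: emeasurable_funM; first exact: measurableT_comp (mEi I mI) measurable_fst.
      by apply: mid_measurable; [exact: mEi|exact: Ei0].
    have m10 q : (0 <= (\1_I q.1 : R)%:E * mid h (EFin \o \1_[set: R]) q)%E.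
      by rewrite mule_ge0// ?lee_fin//; apply: mid_ge0; exact: Ei0.
    rewrite -[X in (_ + X)%E](pf_0 pfc) -(pf_lin pfc)//.
    * apply: (congr1 (fun g => chain T f 0 (rcons (indicators l1) (a, cst 1%E)) g 0)).
      apply/funext => p; rewrite /V adde0 muleCA indicator_setT indicT mulr1.
      by rewrite fineK.
    * exact: (mpair (fun q => V _ q.1 q.2) z (mV _ m1)).
    * by move=> p; apply: V0.
Qed.

End swap.

(** * The exchange on the sigma-algebra outside an interval *)

Section density_measure.
Context d (T : measurableType d) (R : realType) (mu : {measure set T -> \bar R}).
Variable f : T -> \bar R.

Definition density_measure (_ : measurable_fun [set: T] f) (_ : forall x, (0 <= f x)%E)
  (A : set T) : \bar R := (\int[mu]_(x in A) f x)%E.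

Variables (mf : measurable_fun [set: T] f) (f0 : forall x, (0 <= f x)%E).

Let dm0 : density_measure mf f0 set0 = 0%E.
Proof. exact: integral_set0. Qed.

Let dm_ge0 A : (0 <= density_measure mf f0 A)%E.
Proof. by apply: integral_ge0. Qed.

HB.instance Definition _ := isMeasure.Build _ _ _ (density_measure mf f0)
  dm0 dm_ge0 (semi_sigma_additive_nng_induced mf f0).

End density_measure.

(** The positive and the negative part of W are densities of two measures that agree
on a pi-system which exhausts the space. *)
Lemma integral_eq0_on_sigma_algebra d (T : measurableType d) (R : realType)
    (mu : {measure set T -> \bar R}) (G : set (set T)) (g : nat -> set T) (W : T -> R) :
  G `<=` measurable -> setI_closed G -> (forall n, G (g n)) -> \bigcup_n g n = setT ->
  mu.-integrable setT (EFin \o W) ->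
  (forall A, G A -> \int[mu]_(x in A) (W x)%:E = 0)%E ->
  forall A, <<s G >> A -> (\int[mu]_(x in A) (W x)%:E = 0)%E.
Proof.
move=> Gm GI Gg gT iW h.
have mW : measurable_fun setT (EFin \o W) by exact: measurable_int iW.
have mp := measurable_funepos mW; have mn := measurable_funeneg mW.
have p0 x : (0 <= (EFin \o W)^\+ x)%E by exact: funepos_ge0.
have n0 x : (0 <= (EFin \o W)^\- x)%E by exact: funeneg_ge0.
pose m1 := density_measure mu mp p0; pose m2 := density_measure mu mn n0.
have fin1 A : measurable A -> (m1 A \is a fin_num).
  move=> mA; apply: integrable_fin_num => //.
  by apply: integrable_funepos => //; exact: integrableS iW.
have fin2 A : measurable A -> (m2 A \is a fin_num).
  move=> mA; apply: integrable_fin_num => //.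
  by apply: integrable_funeneg => //; exact: integrableS iW.
have intE A : (\int[mu]_(x in A) (W x)%:E = m1 A - m2 A)%E by rewrite integralE.
move=> A GA; rewrite intE.
have mA : measurable A by exact: (smallest_sub (@sigma_algebra_measurable _ T) Gm GA).
suff -> : m1 A = m2 A by rewrite subee// fin2.
apply: (g_sigma_algebra_measure_unique G Gm g) => //.
- move=> B GB /=; have := h B GB; rewrite intE => /eqP.
  by rewrite sube_eq ?fin1 ?fin2 ?add0e ?fin_num_adde_defl ?fin2//; [move=> /eqP|exact: Gm..].
- by move=> k /=; rewrite ltey_eq fin1//; exact: Gm.
Qed.

Section exchange.
Variables (R : realType) (T : R) (f : R -> R -> \bar R).
Hypothesis T_gt0 : 0 < T.
Hypothesis f_meas : forall t, 0 < t <= T -> measurable_fun [set: R] (f t).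
Hypothesis f_ge0 : forall t x, 0 < t <= T -> (0 <= f t x)%E.
Variables (d : measure_display) (Om : measurableType d) (P : probability Om R).
Variable L : R -> {RV P >-> R}.
Hypothesis L_bridge : forall l : seq (R * R), l <> [::] -> path <%R 0 (rcons (unzip1 l) T) ->
  cond_prob_given (L T) [set w | forall p, p \in l -> L p.1 w <= p.2] (levy_bridge_cdf f T l).
Hypothesis L_cadlag : forall w, cadlag_on [set t | 0 <= t <= T] (fun t => L t w).

(** A constraint at a new time is inserted in order, and one at a time already
present is intersected with the old one. *)
Lemma box_add lo hi l t (S : set R) :
  path <%R lo (rcons (unzip1 l) hi) -> lo < t < hi -> measurable_sets l -> measurable S ->
  exists l', [/\ path <%R lo (rcons (unzip1 l') hi), measurable_sets l' &
                 box L l' = L t @^-1` S `&` box L l].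
Proof.
elim: l lo => [|[u A] l IH] lo /=.
  move=> _ /andP[lot thi] _ mS; exists [:: (t, S)]; split => //=.
  - by rewrite lot thi.
  - by move=> q [<-|].
move=> /andP[lou pl] /andP[lot thi] ml mS.
have mA : measurable A by apply: (ml (u, A)); left.
have ml' : measurable_sets l by move=> q ql; apply: ml; right.
have [tu|ut|tu] := ltgtP t u.
- exists [:: (t, S), (u, A) & l]; split => //=; first by rewrite lot tu.
  by move=> q [<-//|]; exact: ml.
- have [|l' [pl' ml'' bl']] := IH u pl _ ml' mS; first by rewrite ut thi.
  exists ((u, A) :: l'); split => /=; first by rewrite lou.
  + by move=> q [<-//|]; exact: ml''.
  + by rewrite bl' setICA.
- exists ((u, S `&` A) :: l); split => /=; first by rewrite lou.
  + by move=> q [<-//|]; [exact: measurableI|exact: ml'].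
  + by rewrite tu preimage_setI setIA.
Qed.

Variables (a h : R).
Hypotheses (a_gt0 : 0 < a) (h_gt0 : 0 < h) (ahT : a + h + h <= T).
Let b := a + h + h.
Let near0 (N : nat) : set R := `[- N%:R, N%:R]%classic.

(** Boxes of times outside ]a, b[ on which the values at a and b are bounded:
this keeps the integrals in the balance finite. *)
Definition outer_box (A : set Om) : Prop :=
  exists (l : seq (R * set R)) (N : nat),
    [/\ forall p, List.In p l -> 0 < p.1 <= a \/ b <= p.1 <= T,
        measurable_sets l &
        A = box L l `&` (L a @^-1` near0 N `&` L b @^-1` near0 N)].

(** Putting the constraints in the order of their times; those at a and at b are
absorbed in I and J. *)
Lemma outer_box_inner A : b < T -> outer_box A ->
  exists l1 l2 (I J B : set R) (N : nat),
    [/\ [/\ measurable_sets l1, measurable_sets l2, measurable I, measurable J & measurable B],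
        times_ok T (unzip1 l1 ++ [:: a, a + h, a + h + h & unzip1 l2]),
        I `<=` near0 N, J `<=` near0 N &
        A = box L l1 `&` (L a @^-1` I `&` (L (a + h) @^-1` setT `&`
              (L (a + h + h) @^-1` J `&` box L l2))) `&` L T @^-1` B].
Proof.
move=> bT [l [N [lt ml ->]]].
suff [l1 [l2 [I [J [B [[m1 m2 mI mJ mB] p1 p2 [IN JN] E]]]]]] : exists l1 l2 (I J B : set R),
    [/\ [/\ measurable_sets l1, measurable_sets l2, measurable I, measurable J & measurable B],
        path <%R 0 (rcons (unzip1 l1) a), path <%R b (rcons (unzip1 l2) T),
        I `<=` near0 N /\ J `<=` near0 N &
        box L l `&` (L a @^-1` near0 N `&` L b @^-1` near0 N) =
        box L l1 `&` (L a @^-1` I `&` (L (a + h) @^-1` setT `&`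
              (L (a + h + h) @^-1` J `&` box L l2))) `&` L T @^-1` B].
  exists l1, l2, I, J, B, N; split => //; rewrite /times_ok rcons_cat /= cat_path /=.
  have /andP[-> ->] : path <%R 0 (unzip1 l1) && (last 0 (unzip1 l1) < a) by rewrite -rcons_path.
  by rewrite !ltrDl h_gt0.
elim: l lt ml => [|[t S] l IH] lt ml.
  exists [::], [::], (near0 N), (near0 N), setT; split => //=.
  - by split => //; exact: measurable_itv.
  - by rewrite a_gt0.
  - by rewrite bT.
  - by split.
  - by apply/seteqP; split=> w /=; tauto.
have mS : measurable S by apply: (ml (t, S)); left.
have ml' : measurable_sets l by move=> q ql; apply: ml; right.
have [l1 [l2 [I [J [B [[m1 m2 mI mJ mB] p1 p2 [IN JN] E]]]]]] :=
  IH (fun p pl => lt p (or_intror pl)) ml'.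
rewrite /= -setIA E.
have /= [/andP[t0 ta]|/andP[bt tT]] := lt (t, S) (or_introl erefl).
- move: ta; rewrite le_eqVlt => /orP[/eqP ta|ta].
    exists l1, l2, (S `&` I), J, B; split => //.
    + by split=> //; exact: measurableI.
    + by split=> // x [_ /IN].
    + by rewrite ta preimage_setI; apply/seteqP; split=> w /=; tauto.
  have [l1' [p1' m1' E']] := box_add p1 (introT andP (conj t0 ta)) m1 mS.
  exists l1', l2, I, J, B; split => //.
  by rewrite E'; apply/seteqP; split=> w /=; tauto.
- move: tT; rewrite le_eqVlt => /orP[/eqP tT|tT].
    exists l1, l2, I, J, (S `&` B); split => //.
    + by split=> //; exact: measurableI.
    + by rewrite tT preimage_setI; apply/seteqP; split=> w /=; tauto.
  move: bt; rewrite le_eqVlt => /orP[/eqP bt|bt].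
    exists l1, l2, I, (S `&` J), B; split => //.
    + by split=> //; exact: measurableI.
    + by split=> // x [_ /JN].
    + by rewrite -bt preimage_setI; apply/seteqP; split=> w /=; tauto.
  have [l2' [p2' m2' E']] := box_add p2 (introT andP (conj bt tT)) m2 mS.
  exists l1, l2', I, J, B; split => //.
  by rewrite E'; apply/seteqP; split=> w /=; tauto.
Qed.

Lemma outer_box_end A : b = T -> outer_box A ->
  exists l1 (I B : set R) (N : nat),
    [/\ [/\ measurable_sets l1, measurable I & measurable B],
        times_ok T (unzip1 l1 ++ [:: a; a + h]),
        I `<=` near0 N, B `<=` near0 N &
        A = box L l1 `&` (L a @^-1` I `&` L (a + h) @^-1` setT) `&` L T @^-1` B].
Proof.
move=> bT [l [N [lt ml ->]]].
suff [l1 [I [B [[m1 mI mB] p1 [IN BN] E]]]] : exists l1 (I B : set R),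
    [/\ [/\ measurable_sets l1, measurable I & measurable B],
        path <%R 0 (rcons (unzip1 l1) a), I `<=` near0 N /\ B `<=` near0 N &
        box L l `&` (L a @^-1` near0 N `&` L b @^-1` near0 N) =
        box L l1 `&` (L a @^-1` I `&` L (a + h) @^-1` setT) `&` L T @^-1` B].
  exists l1, I, B, N; split => //; rewrite /times_ok rcons_cat /= cat_path /=.
  have /andP[-> ->] : path <%R 0 (unzip1 l1) && (last 0 (unzip1 l1) < a) by rewrite -rcons_path.
  by rewrite -bT !ltrDl h_gt0.
elim: l lt ml => [|[t S] l IH] lt ml.
  exists [::], (near0 N), (near0 N); split => //=.
  - by split => //; exact: measurable_itv.
  - by rewrite a_gt0.
  - by split.
  - by rewrite bT; apply/seteqP; split=> w /=; tauto.
have mS : measurable S by apply: (ml (t, S)); left.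
have ml' : measurable_sets l by move=> q ql; apply: ml; right.
have [l1 [I [B [[m1 mI mB] p1 [IN BN] E]]]] :=
  IH (fun p pl => lt p (or_intror pl)) ml'.
rewrite /= -setIA E.
have /= [/andP[t0 ta]|/andP[bt tT]] := lt (t, S) (or_introl erefl).
- move: ta; rewrite le_eqVlt => /orP[/eqP ta|ta].
    exists l1, (S `&` I), B; split => //.
    + by split=> //; exact: measurableI.
    + by split=> // x [_ /IN].
    + by rewrite ta preimage_setI; apply/seteqP; split=> w /=; tauto.
  have [l1' [p1' m1' E']] := box_add p1 (introT andP (conj t0 ta)) m1 mS.
  exists l1', I, B; split => //.
  by rewrite E'; apply/seteqP; split=> w /=; tauto.
- have tE : t = T by apply/eqP; rewrite eq_le tT -bT.
  exists l1, I, (S `&` B); split => //.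
  + by split=> //; exact: measurableI.
  + by split=> // x [_ /BN].
  + by rewrite tE preimage_setI; apply/seteqP; split=> w /=; tauto.
Qed.

Let D1 (w : Om) : R := L (a + h) w - L a w.
Let D2 (w : Om) : R := L b w - L (a + h) w.
Hypothesis D1_int : P.-integrable setT (EFin \o D1).
Hypothesis D2_int : P.-integrable setT (EFin \o D2).

Let pos (x : R) : R := Num.max x 0.
Let neg (x : R) : R := Num.max (- x) 0.

Lemma outer_box_measurable A : outer_box A -> measurable A.
Proof.
move=> [l [N [_ ml ->]]]; apply: measurableI; first exact: measurable_box.
by apply: measurableI; apply: measurable_funPTI; exact: measurable_itv.
Qed.

(** On a box where L a and L b are bounded and the increments are integrable, all
terms of the balance are integrable, and subtracting its two sides gives
2 L (a + h) - L a - L b, the difference of the increments. *)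
Lemma outer_box_exchange A : outer_box A -> (\int[P]_(w in A) (D1 w - D2 w)%:E = 0)%E.
Proof.
move=> bA; have mA := outer_box_measurable bA.
have [N AN] : exists N : nat, forall w, A w -> `|L a w| <= N%:R /\ `|L b w| <= N%:R.
  have [l [N [_ _ ->]]] := bA; exists N => w [_ [/=]].
  by rewrite /near0/= !in_itv/= !ler_norml.
have bal : (\int[P]_(w in A) (2 * pos (L (a + h) w) + (neg (L a w) + neg (L b w)))%:E =
   \int[P]_(w in A) (2 * neg (L (a + h) w) + (pos (L a w) + pos (L b w)))%:E)%E.
  move: ahT; rewrite -/b le_eqVlt => /orP[/eqP bT|bT].
    have [l1 [I [B [M [[m1 mI mB] ok _ _ ->]]]]] := outer_box_end bT bA.
    rewrite bT; exact: (box_balance_end T_gt0 f_meas f_ge0 L_bridge).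
  have [l1 [l2 [I [J [B [M [[m1 m2 mI mJ mB] ok _ _ ->]]]]]]] := outer_box_inner bT bA.
  exact: (box_balance_inner T_gt0 f_meas f_ge0 L_bridge).
have mpos : measurable_fun [set: R] pos by exact: measurable_maxr.
have mneg : measurable_fun [set: R] neg by apply: measurable_maxr => //; apply: measurableT_comp.
have mL t (g : R -> R) : measurable_fun [set: R] g -> measurable_fun [set: Om] (fun w => g (L t w)).
  by move=> mg; exact: measurableT_comp.
pose U w := 2 * pos (L (a + h) w) + (neg (L a w) + neg (L b w)).
pose V w := 2 * neg (L (a + h) w) + (pos (L a w) + pos (L b w)).
have mU : measurable_fun setT (EFin \o U).
  apply/measurable_EFinP; apply: measurable_funD; first by apply: measurable_funM => //; exact: mL.
  by apply: measurable_funD; exact: mL.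
have mV : measurable_fun setT (EFin \o V).
  apply/measurable_EFinP; apply: measurable_funD; first by apply: measurable_funM => //; exact: mL.
  by apply: measurable_funD; exact: mL.
pose bd w : R := 2 * `|D1 w| + 4 * N%:R.
have ibd : P.-integrable A (EFin \o bd).
  apply: (integrableS measurableT) => //.
  have -> : EFin \o bd = (fun w => 2%:E * (abse \o (EFin \o D1)) w + (cst (4 * N%:R)%:E) w)%E by [].
  apply: integrableD => //; last exact: finite_measure_integrable_cst.
  by apply: integrableZl => //; exact: integrable_abse.
have posneg x : [/\ 0 <= pos x, 0 <= neg x, pos x <= `|x|, neg x <= `|x| & pos x - neg x = x].
  rewrite /pos /neg; case: (leP x 0) => hx; case: (leP (- x) 0) => hx'.
  - by split => //; lra.
  - by rewrite ler0_norm//; split; lra.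
  - by rewrite gtr0_norm//; split; lra.
  - by split; lra.
have bound (Z : Om -> R) : measurable_fun setT (EFin \o Z) ->
    (forall w, A w -> `|Z w| <= bd w) -> P.-integrable A (EFin \o Z).
  move=> mZ hZ; apply: (le_integrable mA _ _ ibd); first exact: measurable_funTS.
  by move=> w Aw; rewrite /= lee_fin (le_trans (hZ w Aw))// ler_norm.
have tri w : `|L (a + h) w| <= `|D1 w| + `|L a w|.
  by rewrite (_ : L (a + h) w = D1 w + L a w) ?ler_normD// /D1 subrK.
have iU : P.-integrable A (EFin \o U).
  apply: bound => // w /AN[h1 h2]; rewrite /U /bd.
  have [x1 x2 x3 x4 _] := posneg (L (a + h) w).
  have [y1 y2 y3 y4 _] := posneg (L a w).
  have [z1 z2 z3 z4 _] := posneg (L b w).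
  by have tw := tri w; rewrite ger0_norm; lra.
have iV : P.-integrable A (EFin \o V).
  apply: bound => // w /AN[h1 h2]; rewrite /V /bd.
  have [x1 x2 x3 x4 _] := posneg (L (a + h) w).
  have [y1 y2 y3 y4 _] := posneg (L a w).
  have [z1 z2 z3 z4 _] := posneg (L b w).
  by have tw := tri w; rewrite ger0_norm; lra.
transitivity (\int[P]_(w in A) ((EFin \o U) w - (EFin \o V) w))%E.
  apply: eq_integral => w _; rewrite /= -EFinB; congr (_%:E).
  have [_ _ _ _ x5] := posneg (L (a + h) w).
  have [_ _ _ _ y5] := posneg (L a w).
  have [_ _ _ _ z5] := posneg (L b w).
  by rewrite /D1 /D2 /U /V -[in LHS]x5 -[in LHS]y5 -[in LHS]z5; ring.
rewrite integralB//= bal subee//.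
by apply: integrable_fin_num => //; exact: iV.
Qed.

Definition outer_events : set (set Om) :=
  [set A | exists t (B : set R), [/\ 0 <= t <= a \/ b <= t <= T, measurable B & A = L t @^-1` B]].

Lemma outer_events_sub : <<s outer_events >> `<=` <<s outer_box >>.
Proof.
apply: smallest_sub; first exact: smallest_sigma_algebra.
pose GT := g_sigma_algebraType outer_box.
have pos_case t (B : set R) : 0 < t <= a \/ b <= t <= T -> measurable B ->
    <<s outer_box >> (L t @^-1` B).
  move=> ht mB.
  have -> : L t @^-1` B = \bigcup_N (L t @^-1` B `&` (L a @^-1` near0 N `&` L b @^-1` near0 N)).
    apply/seteqP; split=> w /=; last by move=> [N _ []].
    move=> hw; pose M := Num.max `|L a w| `|L b w|.
    exists (Num.bound M) => //; split=> //.
    have M0 : 0 <= M by rewrite le_max normr_ge0.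
    have := ltW (archi_boundP M0); rewrite ge_max => /andP[h1 h2].
    by split; rewrite /near0/= in_itv/= -ler_norml.
  apply: (@bigcupT_measurable _ GT) => N; apply: sub_sigma_algebra.
  exists [:: (t, B)], N; split => //=.
  - by move=> p [<-|//].
  - by move=> p [<-|//].
  - by rewrite setIT.
move=> _ [t [B [ht mB ->]]].
have [t0|t0] := eqVneq t 0; last first.
  apply: pos_case => //; case: ht; last by right.
  by move=> /andP[h1 h2]; left; rewrite lt_neqAle eq_sym t0 h1.
rewrite t0 {t t0 ht}.
(* the law of a bridge says nothing at the time 0, which right continuity recovers *)
have mL0 : measurable_fun [set: GT] (L 0 : GT -> R).
  pose u (k : nat) : R := a / k.+1%:R.
  have u_in k : 0 < u k <= a.
    by rewrite divr_gt0//= ler_pdivrMr// ler_peMr ?ler1n// ltW.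
  apply: (@measurable_fun_cvg _ GT R setT (fun k => L (u k) : GT -> R)).
  - move=> k _ Y mY; rewrite setTI; apply: pos_case => //; left; exact: u_in.
  - move=> w _.
    have D0 : [set t | 0 <= t <= T] (0 : R) by rewrite /= lexx ltW.
    have [r0 _] := L_cadlag w D0.
    have u0 : u k @[k --> \oo] --> within [set t | 0 <= t <= T] (at_right (0 : R)).
      have cu : u k @[k --> \oo] --> (0 : R).
        rewrite -[X in _ --> X](mulr0 a); apply: cvgMr; exact: cvg_harmonic.
      move=> X /= [e /= e0 hX].
      suff : \forall k \near \oo, X (u k) by [].
      have : \forall k \near \oo, ball (0 : R) e (u k) by exact: (cu _ (nbhsx_ballx (0 : R) e e0)).
      apply: filterS => k /= hk; apply: hX => //.
      + by rewrite /=; have /andP[-> ] := u_in k.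
      + have /andP[h1 h2] := u_in k; rewrite /= ltW//= (le_trans h2)//.
        by apply: le_trans ahT; rewrite -addrA lerDl addr_ge0// ltW.
    exact: (cvg_comp _ _ u0 r0).
by have := mL0 measurableT B mB; rewrite setTI.
Qed.

Theorem increments_exchange A : <<s outer_events >> A ->
  (\int[P]_(w in A) (D1 w - D2 w)%:E = 0)%E.
Proof.
move=> /outer_events_sub; move: A.
apply: (integral_eq0_on_sigma_algebra (g := fun N =>
  box L [::] `&` (L a @^-1` near0 N `&` L b @^-1` near0 N))).
- exact: outer_box_measurable.
- move=> _ _ [l1 [N1 [t1 m1 ->]]] [l2 [N2 [t2 m2 ->]]].
  exists (l1 ++ l2), (minn N1 N2); split.
  + by move=> p /(@List.in_app_or _ _ _ _)[/t1|/t2].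
  + exact/measurable_sets_cat.
  + rewrite box_cat.
    have nE : near0 (minn N1 N2) = near0 N1 `&` near0 N2.
      apply/seteqP; split => x /=; rewrite /near0/= !in_itv/= -!ler_norml.
      * move=> hx; split; rewrite (le_trans hx)// ler_nat; [exact: geq_minl|exact: geq_minr].
      * by move=> [h1 h2]; rewrite /minn; case: ifP.
    by rewrite nE !preimage_setI; apply/seteqP; split=> w /=; tauto.
- by move=> N; exists [::], N; split.
- apply/seteqP; split => // w _; pose M := Num.max `|L a w| `|L b w|.
  exists (Num.bound M) => //; split=> //.
  have M0 : 0 <= M by rewrite le_max normr_ge0.
  have := ltW (archi_boundP M0); rewrite ge_max => /andP[h1 h2].
  by split; rewrite /near0/= in_itv/= -ler_norml.
- have -> : EFin \o (fun w => D1 w - D2 w) = ((EFin \o D1) \- (EFin \o D2))%E by [].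
  exact: integrableB.
- exact: outer_box_exchange.
Qed.

End exchange.

(** * The increments of a generalised Liouville process *)

(** Both sides are integrals against the common image measure. *)
Lemma integral_equal_law d1 d2 d3 (X : measurableType d1) (Y : measurableType d2)
    (Z : measurableType d3) (R : realType)
    (mu : {measure set X -> \bar R}) (nu : {measure set Y -> \bar R}) (phi : X -> Z) (psi : Y -> Z)
    (g : Z -> R) (A : set Z) :
  measurable_fun setT phi -> measurable_fun setT psi -> measurable_fun setT g ->
  (forall B, measurable B -> mu (phi @^-1` B) = nu (psi @^-1` B)) ->
  mu.-integrable setT (EFin \o (g \o phi)) -> measurable A ->
  nu.-integrable setT (EFin \o (g \o psi)) /\
  (\int[mu]_(x in phi @^-1` A) (g (phi x))%:E = \int[nu]_(y in psi @^-1` A) (g (psi y))%:E)%E.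
Proof.
move=> mphi mpsi mg law ig mA.
have mEg : measurable_fun setT (EFin \o g) by exact/measurable_EFinP.
have eqm (h : Z -> \bar R) (D : set Z) : measurable D ->
    (\int[pushforward mu phi]_(z in D) h z = \int[pushforward nu psi]_(z in D) h z)%E.
  by move=> mD; apply: eq_measure_integral => // B mB _; exact: law.
have ig2 : nu.-integrable setT (EFin \o (g \o psi)).
  apply/integrableP; split; first exact: measurableT_comp mEg mpsi.
  have mabs : measurable_fun setT (abse \o (EFin \o g)) by exact: measurableT_comp.
  have -> : (\int[nu]_x `|(EFin \o (g \o psi)) x| = \int[mu]_x `|(EFin \o (g \o phi)) x|)%E.
    have := @ge0_integral_pushforward _ _ _ _ R psi mpsi nu setT (abse \o (EFin \o g))
      measurableT mabs (fun _ _ => abse_ge0 _).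
    rewrite preimage_setT => <-; rewrite -eqm//.
    have := @ge0_integral_pushforward _ _ _ _ R phi mphi mu setT (abse \o (EFin \o g))
      measurableT mabs (fun _ _ => abse_ge0 _).
    by rewrite preimage_setT => ->.
  by have /integrableP[] := ig.
split => //.
have mS1 : measurable (phi @^-1` A) by rewrite -[X in measurable X]setTI; exact: mphi.
have mS2 : measurable (psi @^-1` A) by rewrite -[X in measurable X]setTI; exact: mpsi.
have i1 : mu.-integrable (phi @^-1` A) ((EFin \o g) \o phi).
  exact: (integrableS measurableT mS1 _ ig).
have i2 : nu.-integrable (psi @^-1` A) ((EFin \o g) \o psi).
  exact: (integrableS measurableT mS2 _ ig2).
have e1 := integral_pushforward mphi mEg i1 mA.
have e2 := integral_pushforward mpsi mEg i2 mA.
by rewrite -[LHS]e1 -[RHS]e2 eqm.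
Qed.

(** The events that differ from one of <<s G>> inside a null set only form a
sigma-algebra. *)
Lemma completed_sigma_algebra d (T : measurableType d) (R : realType)
    (mu : {measure set T -> \bar R}) (G : set (set T)) (A : set T) :
  G `<=` measurable ->
  <<s G `|` [set N | measurable N /\ mu N = 0%E] >> A ->
  exists B N, [/\ <<s G >> B, measurable N, mu N = 0%E & A `\` N = B `\` N].
Proof.
move=> Gm; move: A; pose GT := g_sigma_algebraType G.
apply: smallest_sub.
- split.
  + exists set0, set0; split => //; exact: (@measurable0 _ GT).
  + move=> A [B [N [GB mN N0 AB]]]; exists (setT `\` B), N; split => //.
      by rewrite setTD; exact: (@measurableC _ GT).
    apply/seteqP; split => x /= [[_ nA] nN]; split => //; split=> // xB; apply: nA.
    * by have [] : (A `\` N) x by rewrite AB.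
    * by have [] : (B `\` N) x by rewrite -AB.
  + move=> A /choice[B /choice[N h]]; exists (\bigcup_k B k), (\bigcup_k N k); split.
    * by apply: (@bigcupT_measurable _ GT) => k; have [] := h k.
    * by apply: bigcupT_measurable => k; have [] := h k.
    * have mN : measurable (\bigcup_k N k) by apply: bigcupT_measurable => k; have [] := h k.
      apply/(negligibleP _ mN); apply: negligible_bigcup => k.
      by have [_ mNk N0 _] := h k; exact: ((negligibleP _ mNk).2 N0).
    * apply/seteqP; split => x [[k _ Ak] nN]; split => //; exists k => //.
      - have [_ _ _ E] := h k; have [] // : (B k `\` N k) x.
        by rewrite -E; split => // Nk; apply: nN; exists k.
      - have [_ _ _ E] := h k; have [] // : (A k `\` N k) x.
        by rewrite E; split => // Nk; apply: nN; exists k.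
- move=> A [GA|[mA A0]].
  + by exists A, set0; split => //; exact: sub_sigma_algebra.
  + exists set0, A; split => //; first exact: (@measurable0 _ GT).
    by rewrite setDv set0D.
Qed.

Section partial_sums.
Variables (R : realType) (n : nat) (m : 'I_n -> R).
Hypothesis m_gt0 : forall i, 0 < m i.

Lemma partial_sum0 : partial_sum m 0 = 0.
Proof. by rewrite /partial_sum big_pred0. Qed.

Lemma partial_sumS (i : 'I_n) : partial_sum m i.+1 = partial_sum m i + m i.
Proof.
rewrite /partial_sum (bigD1 i)//= addrC; congr (_ + _).
by apply: eq_bigl => j; rewrite ltnS (ltn_neqAle j i) andbC.
Qed.

Lemma partial_sum_le k l : (k <= l)%N -> partial_sum m k <= partial_sum m l.
Proof.
move=> kl; rewrite /partial_sum [leRHS](bigID (fun j : 'I_n => (j < k)%N))/=.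
have -> : \sum_(j < n | (j < l)%N && (j < k)%N) m j = \sum_(j < n | (j < k)%N) m j.
  apply: eq_bigl => j; have [jk|] := boolP (j < k)%N; last by rewrite andbF.
  by rewrite andbT (leq_trans jk kl).
by rewrite lerDl sumr_ge0// => j _; exact: ltW.
Qed.

Lemma partial_sum_ge0 k : 0 <= partial_sum m k.
Proof. by rewrite -partial_sum0; exact: partial_sum_le. Qed.

End partial_sums.

Section glp.
Variables (R : realType) (n : nat) (m : 'I_n -> R)
    (nu : probability (measurableTypeR R) R)
    (d : measure_display) (Om : measurableType d) (P : probability Om R)
    (xi : R -> 'I_n -> {RV P >-> R}).
Hypothesis m_gt0 : forall i, 0 < m i.
Hypothesis xi_glp : generalised_liouville_process m nu xi.
Hypothesis xi_int : forall t i, 0 < t <= 1 -> P.-integrable setT (EFin \o xi t i).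

Let xif := fun t i w => xi t i w.

Let path_coord_measurable t i : 0 <= t <= 1 ->
  measurable_fun [set: g_sigma_algebraType (@cylinders R n)] (fun x : R -> 'I_n -> R => x t i).
Proof.
move=> t01 _ B mB; rewrite setTI; apply: sub_sigma_algebra.
by exists t, i, B.
Qed.

Let path_measurable d' (Om' : measurableType d') (eta : R -> 'I_n -> Om' -> R) :
  (forall t i, measurable_fun setT (eta t i)) ->
  measurable_fun setT (fun w => (fun t i => eta t i w) : g_sigma_algebraType (@cylinders R n)).
Proof.
move=> meta; apply: (@measurability _ _ _ (g_sigma_algebraType (@cylinders R n)) _ _ (@cylinders R n)) => //.
move=> _ [_ [t [i [B [_ mB ->]]]] <-].
exact: (meta t i).
Qed.

(** An event of the past is a condition on the path, which can then be imposed on the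
path of another process. *)
Let raw_path (s : R) (A : set Om) : <<s raw_events xif s >> A ->
  forall d' (Om' : measurableType d') (eta : R -> 'I_n -> Om' -> R),
  exists C : set (R -> 'I_n -> R),
    [/\ <<s @cylinders R n >> C, A = [set w | C (fun t i => xi t i w)] &
        <<s raw_events eta s >> [set w | C (fun t i => eta t i w)]].
Proof.
move=> + d' Om' eta; move: A; apply: smallest_sub.
- pose GT := g_sigma_algebraType (@cylinders R n); pose GE := g_sigma_algebraType (raw_events eta s).
  split.
  + exists set0; split => //; [exact: (@measurable0 _ GT)|exact: (@measurable0 _ GE)].
  + move=> _ [C [mC -> eC]]; exists (~` C); split.
    * exact: (@measurableC _ GT).
    * by rewrite setTD.
    * exact: (@measurableC _ GE).
  + move=> F /choice[C h]; exists (\bigcup_k C k); split.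
    * by apply: (@bigcupT_measurable _ GT) => k; have [] := h k.
    * by apply: eq_bigcup => // k _; have [_ ->] := h k.
    * by apply: (@bigcupT_measurable _ GE) => k; have [] := h k.
- move=> _ [u [i [B [us mB ->]]]]; exists [set x | B (x u i)]; split => //.
  + apply: sub_sigma_algebra; exists u, i, B; split => //.
    by case/andP: us => -> /=; rewrite le_min => /andP[].
  + by apply: sub_sigma_algebra; exists u, i, B.
Qed.

Lemma raw_events_measurable s : raw_events xif s `<=` measurable.
Proof. by move=> _ [u [i [B [_ mB ->]]]]; exact: measurable_funPTI. Qed.

(** In terms of the bridge, these are two adjacent increments inside the i-th
interval ]u_(i-1), u_i], and the coordinates up to time s do not involve the
bridge between them: those with index below i live on earlier intervals, those
above on later ones, and the i-th one stops at or before the first increment. *)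
Lemma midpoint_increments s al h i A : 0 <= s <= al -> 0 < al -> 0 < h -> al + h + h <= 1 ->
  <<s raw_events xif s >> A ->
  (\int[P]_(w in A) ((xi (al + h) i w - xi al i w) - (xi (al + h + h) i w - xi (al + h) i w))%:E = 0)%E.
Proof.
move=> /andP[s0 sal] al0 h0 ah1 GA.
have [xi_cad [d' [Om' [P' [L [Lb law]]]]]] := xi_glp.
have [T0 [d'' [Om'' [Q [X [f [_ dens_f L_cad L_T L_b]]]]]]] := Lb.
have f_meas := dens_meas dens_f; have f_ge0 := @dens_ge0 _ _ _ _ _ _ _ _ dens_f.
pose eta t i w := L (t * m i + partial_sum m i) w - L (partial_sum m i) w.
have meta t j : measurable_fun setT (eta t j) by apply: measurable_funB.
have [C [mC AE outC]] := raw_path GA eta.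
pose g (x : R -> 'I_n -> R) : R := (x (al + h) i - x al i) - (x (al + h + h) i - x (al + h) i).
pose PS := g_sigma_algebraType (@cylinders R n).
have in01 : [/\ 0 <= al <= 1, 0 <= al + h <= 1 & 0 <= al + h + h <= 1].
  by split; apply/andP; split; lra.
have [i1 i2 i3] := in01.
have mdiff (u v : R) : 0 <= u <= 1 -> 0 <= v <= 1 ->
    measurable_fun [set: PS] (fun x : R -> 'I_n -> R => x u i - x v i).
  by move=> hu hv; apply: measurable_funB; exact: path_coord_measurable.
have mg : measurable_fun [set: PS] g by apply: measurable_funB; exact: mdiff.
have mXi : measurable_fun setT (fun w => (fun t i => xi t i w) : PS).
  by apply: path_measurable => t j.
have mEta : measurable_fun setT (fun w => (fun t i => eta t i w) : PS) by exact: path_measurable.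
have intx (u : R) : 0 < u <= 1 -> P.-integrable setT (EFin \o xi u i) by exact: xi_int.
have idiff (u v : R) : 0 < u <= 1 -> 0 < v <= 1 ->
    P.-integrable setT (EFin \o (fun w => xi u i w - xi v i w)).
  by move=> hu hv; exact: (integrableB measurableT (intx u hu) (intx v hv)).
have j1 : 0 < al <= 1 by apply/andP; split; lra.
have j2 : 0 < al + h <= 1 by apply/andP; split; lra.
have j3 : 0 < al + h + h <= 1 by apply/andP; split; lra.
have ig : P.-integrable setT (EFin \o (g \o (fun w => (fun t i => xi t i w) : PS))).
  by apply: (integrableB measurableT (idiff _ _ j2 j1) (idiff _ _ j3 j2)).
have law' B : measurable B -> P ((fun w => (fun t i => xi t i w) : PS) @^-1` B) =
    P' ((fun w => (fun t i => eta t i w) : PS) @^-1` B) by move=> mB; exact: law.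
have [_ E] := integral_equal_law mXi mEta mg law' ig mC.
rewrite AE; rewrite [LHS](_ : _ = (\int[P]_(x in (fun w => (fun t i => xi t i w) : PS) @^-1` C) (g (fun t i => xi t i x))%:E)%E)// E.
pose a := al * m i + partial_sum m i; pose h' := h * m i.
have a0 : 0 < a by rewrite ltr_wpDr ?mulr_gt0// partial_sum_ge0.
have h'0 : 0 < h' by rewrite mulr_gt0.
have bE : a + h' + h' = (al + h + h) * m i + partial_sum m i by rewrite /a /h'; ring.
have aE : a + h' = (al + h) * m i + partial_sum m i by rewrite /a /h'; ring.
have b_le : a + h' + h' <= partial_sum m i.+1.
  by rewrite bE partial_sumS addrC lerD2l ler_piMl// ltW.
have bT : a + h' + h' <= partial_sum m n by rewrite (le_trans b_le)// partial_sum_le.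
have gE w : g (fun t i => eta t i w) = (L (a + h') w - L a w) - (L (a + h' + h') w - L (a + h') w).
  by rewrite /g /eta -aE -bE -/a; ring.
have [iD1 _] := integral_equal_law mXi mEta (mdiff _ _ i2 i1) law' (idiff _ _ j2 j1) (@measurableT _ PS).
have [iD2 _] := integral_equal_law mXi mEta (mdiff _ _ i3 i2) law' (idiff _ _ j3 j2) (@measurableT _ PS).
have {}iD1 : P'.-integrable setT (EFin \o (fun w => L (a + h') w - L a w)).
  congr (P'.-integrable _ _) : iD1; apply/funext => w /=.
  by rewrite /eta aE -/a; congr (_%:E); ring.
have {}iD2 : P'.-integrable setT (EFin \o (fun w => L (a + h' + h') w - L (a + h') w)).
  congr (P'.-integrable _ _) : iD2; apply/funext => w /=.
  by rewrite /eta bE aE; congr (_%:E); ring.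
have := increments_exchange T0 f_meas f_ge0 L_b L_cad a0 h'0 bT iD1 iD2.
move=> ex; rewrite -[RHS](ex ((fun w => (fun t i => eta t i w) : PS) @^-1` C)).
  by apply: eq_integral => w _; rewrite gE.
(* coordinates of the process up to time s only involve the bridge outside ]a, b[ *)
apply: (smallest_sub _ _ outC); first exact: smallest_sigma_algebra.
pose GT := g_sigma_algebraType (outer_events (partial_sum m n) L a h').
move=> _ [u [j [B [/andP[u0 us] mB ->]]]].
have {us}[us u1] : u <= s /\ u <= 1 by move: us; rewrite le_min => /andP.
have outer v : 0 <= v <= a \/ a + h' + h' <= v <= partial_sum m n ->
    measurable_fun [set: GT] (L v : GT -> R).
  by move=> hv _ Y mY; rewrite setTI; apply: sub_sigma_algebra; exists v, Y.
have umj : 0 <= u * m j by rewrite mulr_ge0// ltW.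
have umj1 : u * m j + partial_sum m j <= partial_sum m j.+1.
  by rewrite partial_sumS addrC lerD2l ler_piMl// ltW.
have pj0 := @partial_sum_ge0 _ _ _ m_gt0 j.
have pjT : partial_sum m j.+1 <= partial_sum m n by rewrite partial_sum_le.
have um_out v : 0 <= v -> v <= s -> v <= 1 ->
    0 <= v * m j + partial_sum m j <= a \/
    a + h' + h' <= v * m j + partial_sum m j <= partial_sum m n.
  move=> v0 vs v1.
  have vm0 : 0 <= v * m j by rewrite mulr_ge0// ltW.
  have vm1 : v * m j + partial_sum m j <= partial_sum m j.+1.
    by rewrite partial_sumS addrC lerD2l ler_piMl// ltW.
  have [ji|ij|/val_inj ji] := ltngtP j i.
  - left; rewrite addr_ge0//= (le_trans vm1)//.
    have al_m : 0 <= al * m i by rewrite mulr_ge0// ltW.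
    by rewrite (le_trans (partial_sum_le m_gt0 ji))// /a lerDr.
  - right; rewrite (le_trans vm1)// andbT (le_trans b_le)//.
    by rewrite (le_trans (partial_sum_le m_gt0 ij))// lerDr.
  - left; rewrite addr_ge0//= ji /a lerD2r ler_wpM2r// ?(le_trans vs sal)//.
    exact: ltW.
have meas_eta : measurable_fun [set: GT] (fun w : GT => eta u j w).
  apply: measurable_funB; apply: outer; first exact: um_out.
  by have := um_out 0 (lexx _) s0 ler01; rewrite mul0r add0r.
by have := meas_eta measurableT B mB; rewrite setTI.
Qed.

Definition completed_past (s : R) : set (set Om) :=
  <<s raw_events xif s `|` [set N | measurable N /\ P N = 0%E] >>.

Lemma completed_past_measurable s : completed_past s `<=` measurable.
Proof.
apply: smallest_sub; first exact: sigma_algebra_measurable.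
by move=> A [|[]//]; exact: raw_events_measurable.
Qed.

Lemma integral_completed_past s A (f : Om -> R) : completed_past s A ->
  P.-integrable setT (EFin \o f) ->
  exists2 B, <<s raw_events xif s >> B &
    (\int[P]_(w in A) (f w)%:E = \int[P]_(w in B) (f w)%:E)%E.
Proof.
move=> HA fi; have mA := completed_past_measurable HA.
have [B [N [GB mN N0 AB]]] := completed_sigma_algebra (@raw_events_measurable s) HA.
exists B => //.
have mB : measurable B.
  by apply: (smallest_sub (@sigma_algebra_measurable _ Om) (@raw_events_measurable s)).
rewrite (negligible_integral mN mA (integrableS measurableT mA _ fi) N0)//.
by rewrite AB -(negligible_integral mN mB (integrableS measurableT mB _ fi) N0).
Qed.

Let idiff i (u v : R) : 0 < u <= 1 -> 0 < v <= 1 ->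
  P.-integrable setT (EFin \o (fun w => xi u i w - xi v i w)).
Proof. by move=> hu hv; exact: (integrableB measurableT (xi_int i hu) (xi_int i hv)). Qed.

(** Equal increments have equal integrals over events of the past, so that on a
regular grid of [s, 1] these integrals grow linearly. *)
Lemma grid_harness s i A (N k : nat) : 0 < s < 1 -> (k <= N)%N -> (0 < N)%N ->
  completed_past s A ->
  \int[P]_(w in A) (xi (s + k%:R * ((1 - s) / N%:R)) i w - xi s i w) =
  k%:R / N%:R * \int[P]_(w in A) (xi 1 i w - xi s i w).
Proof.
move=> /andP[s0 s1] kN N0 HA.
pose h := (1 - s) / N%:R.
have NR0 : 0 < N%:R :> R by rewrite ltr0n.
have h0 : 0 < h by rewrite divr_gt0// subr_gt0.
have Nh : N%:R * h = 1 - s by rewrite /h mulrCA divff ?mulr1// gt_eqF.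
have mA := completed_past_measurable HA.
pose t (k : nat) : R := s + k%:R * h.
have tS j : t j.+1 = t j + h by rewrite /t -natr1 mulrDl mul1r addrA.
have t01 j : (j <= N)%N -> 0 < t j <= 1.
  move=> jN; apply/andP; split; first by rewrite /t ltr_pwDl// mulr_ge0// ltW.
  rewrite /t -lerBrDl -Nh.
  by rewrite ler_pM2r ?ler_nat.
have iA u v : 0 < u <= 1 -> 0 < v <= 1 ->
    P.-integrable A (EFin \o (fun w => xi u i w - xi v i w)).
  by move=> hu hv; exact: (integrableS measurableT mA _ (idiff i hu hv)).
pose de (j : nat) := \int[P]_(w in A) (xi (t j.+1) i w - xi (t j) i w).
have de_eq j : (j.+1 < N)%N -> de j.+1 = de j.
  move=> jN.
  have t1 := t01 _ (ltnW jN); have t2 := t01 _ jN.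
  have t0 := t01 _ (ltnW (ltnW jN)).
  apply/esym/eqP; rewrite -subr_eq0 -RintegralB//; try exact: iA.
  have ii : P.-integrable setT (EFin \o (fun w =>
      (xi (t j.+1) i w - xi (t j) i w) - (xi (t j.+2) i w - xi (t j.+1) i w))).
    exact: (integrableB measurableT (idiff i t1 t0) (idiff i t2 t1)).
  rewrite /Rintegral; have [B GB ->] := integral_completed_past HA ii.
  rewrite (tS j.+1) (tS j) (@midpoint_increments s (t j) h i B)//.
  - by rewrite ltW//= lerDl mulr_ge0// ltW.
  - by case/andP: t0.
  - by rewrite -!tS; case/andP: t2.
have de0 j : (j < N)%N -> de j = de 0%N.
  by elim: j => // j IH jN; rewrite de_eq// IH// ltnW.
have sum j : (j <= N)%N -> \int[P]_(w in A) (xi (t j) i w - xi s i w) = j%:R * de 0%N.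
  elim: j => [_|j IH jN].
    rewrite mul0r /t mul0r addr0; under eq_Rintegral do rewrite subrr.
    by rewrite Rintegral_cst// mul0r.
  have ts : 0 < s <= 1 by rewrite s0 ltW.
  transitivity (\int[P]_(w in A) ((xi (t j.+1) i w - xi (t j) i w) + (xi (t j) i w - xi s i w))).
    by apply: eq_Rintegral => w _; rewrite addrA subrK.
  rewrite RintegralD//; last 2 first.
  - by apply: iA; apply: t01; rewrite ?(ltnW jN).
  - by apply: iA => //; apply: t01; exact: ltnW.
  by rewrite IH ?(ltnW jN)// -/(de j) de0// -natr1 mulrDl mul1r addrC.
rewrite -/h -/(t k) sum//.
have t1 : t N = 1 by rewrite /t Nh addrC subrK.
by have := sum N (leqnn N); rewrite t1 => ->; rewrite mulrA divfK// gt_eqF.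
Qed.

End glp.

(** * Conditional expectations *)

Section integrable_helpers.
Context d (Om : measurableType d) (R : realType) (P : probability Om R).
Implicit Types f g : Om -> R.

Lemma integrable_bounded f (C : R) : measurable_fun setT f -> (forall w, `|f w| <= C) ->
  P.-integrable setT (EFin \o f).
Proof.
move=> mf fC; apply: (@le_integrable _ _ _ P setT measurableT _ (cst C%:E)).
- exact/measurable_EFinP.
- by move=> w _ /=; rewrite lee_fin (le_trans (fC w))// ler_norm.
- exact: finite_measure_integrable_cst.
Qed.

Lemma integrable_dominated f g : measurable_fun setT f -> P.-integrable setT (EFin \o g) ->
  (forall w, `|f w| <= `|g w|) -> P.-integrable setT (EFin \o f).
Proof.
move=> mf ig fg; apply: (le_integrable measurableT _ _ ig); first exact/measurable_EFinP.
by move=> w _ /=; rewrite lee_fin.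
Qed.

Lemma integrable_mul_bounded f g (C : R) : measurable_fun setT f -> (forall w, `|f w| <= C) ->
  P.-integrable setT (EFin \o g) -> P.-integrable setT (EFin \o (fun w => f w * g w)).
Proof.
move=> mf fC ig.
have mg : measurable_fun setT g by apply/measurable_EFinP; exact: measurable_int ig.
apply: (@integrable_dominated _ (fun w => C * g w)); first exact: measurable_funM.
  exact: (integrableZl measurableT C ig).
by move=> w; rewrite !normrM ler_wpM2r// (le_trans (fC w))// ler_norm.
Qed.

Lemma integrable_lin (a : R) f g : P.-integrable setT (EFin \o f) -> P.-integrable setT (EFin \o g) ->
  P.-integrable setT (EFin \o (fun w => a * f w + g w)).
Proof.
by move=> fi gi; exact: (integrableD measurableT (integrableZl measurableT a fi) gi).
Qed.

Lemma integrable_sub f g : P.-integrable setT (EFin \o f) -> P.-integrable setT (EFin \o g) ->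
  P.-integrable setT (EFin \o (fun w => f w - g w)).
Proof. by move=> fi gi; exact: (integrableB measurableT fi gi). Qed.

Lemma integrable_add f g : P.-integrable setT (EFin \o f) -> P.-integrable setT (EFin \o g) ->
  P.-integrable setT (EFin \o (fun w => f w + g w)).
Proof. by move=> fi gi; exact: (integrableD measurableT fi gi). Qed.

Lemma integrable_measurable f : P.-integrable setT (EFin \o f) -> measurable_fun setT f.
Proof. by move=> fi; apply/measurable_EFinP; exact: measurable_int fi. Qed.

Lemma integrable_on f A : measurable A -> P.-integrable setT (EFin \o f) ->
  P.-integrable A (EFin \o f).
Proof. by move=> mA; exact: integrableS. Qed.

Lemma integrable_normr f : P.-integrable setT (EFin \o f) ->
  P.-integrable setT (EFin \o (fun w => `|f w|)).
Proof. exact: integrable_norm. Qed.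

Lemma Rintegral_setC_split f A : measurable A -> P.-integrable setT (EFin \o f) ->
  \int[P]_w f w = \int[P]_(w in A) f w + \int[P]_(w in ~` A) f w.
Proof.
move=> mA fi; rewrite -Rintegral_setU//.
- by rewrite setUv.
- exact: measurableC.
- by rewrite setUv.
- by apply/disj_setPS; rewrite setICr.
Qed.

Lemma norm_le_ae0 f : P.-integrable setT (EFin \o f) -> \int[P]_w `|f w| <= 0 ->
  {ae P, forall w, f w = 0}.
Proof.
move=> fi h; have mf := measurable_int _ fi.
have : (\int[P]_w `|(EFin \o f) w| = 0)%E.
  have fin : (\int[P]_w `|(EFin \o f) w| \is a fin_num)%E.
    by apply: integrable_fin_num => //; exact: integrable_abse.
  apply/eqP; rewrite eq_le integral_ge0// andbT.
  by rewrite -(fineK fin) lee_fin.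
move=> /(ae_eq_integral_abs P measurableT mf).
by apply: filterS => w /(_ I) [].
Qed.

End integrable_helpers.

Section truncation.
Context (R : realType).
Implicit Types K z : R.

Definition truncate K z := Num.max (- K) (Num.min K z).

Lemma measurable_truncate d (T : measurableType d) K (f : T -> R) :
  measurable_fun setT f -> measurable_fun setT (fun x => truncate K (f x)).
Proof. by move=> mf; apply: measurable_maxr => //; exact: measurable_minr. Qed.

Lemma truncate_bound K z : 0 <= K -> `|truncate K z| <= K.
Proof. by move=> K0; rewrite ler_norml /truncate le_max lexx/= ge_max ge_min lexx andbT; lra. Qed.

Lemma truncate_id K z : `|z| <= K -> truncate K z = z.
Proof. by rewrite ler_norml => /andP[h1 h2]; rewrite /truncate min_r// max_r. Qed.

Lemma truncate_dist_le K z : 0 <= K -> `|z - truncate K z| <= `|z|.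
Proof.
move=> K0; rewrite /truncate; have [Kz|zK] := leP K z.
  by rewrite max_r ?ger0_norm; lra.
have [zK'|Kz] := leP z (- K); first by rewrite !ler0_norm; lra.
by rewrite subrr normr0.
Qed.

Lemma truncate_cvg z : \forall k \near \oo, truncate k%:R z = z.
Proof.
exists (Num.bound `|z|) => // k /= hk; apply: truncate_id.
by rewrite (le_trans (ltW (archi_boundP (normr_ge0 _))))// ler_nat.
Qed.

End truncation.

Section conditional_expectation.
Context d (Om : measurableType d) (R : realType) (P : probability Om R).
Variable G : set (set Om).
Hypotheses (sG : sigma_algebra setT G) (Gm : G `<=` measurable).
Let GT := g_sigma_algebraType G.
Implicit Types X Y Z W : Om -> R.

Let GE : <<s G >> = G. Proof. exact: sigma_algebra_id. Qed.

Definition adapted_to Y := forall B : set R, measurable B -> G (Y @^-1` B).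

Lemma adapted_toP Y : adapted_to Y <-> measurable_fun [set: GT] Y.
Proof.
split=> [h _ B mB|h B mB]; first by rewrite setTI; apply: sub_sigma_algebra; exact: h.
by have := h measurableT B mB; rewrite setTI /measurable/= GE.
Qed.

Lemma sub_id_measurable : measurable_fun [set: Om] (id : Om -> GT).
Proof. by move=> _ A; rewrite setTI /measurable/= GE => /Gm. Qed.

Lemma adapted_measurable Y : adapted_to Y -> measurable_fun [set: Om] Y.
Proof. by move=> h _ B mB; rewrite setTI; exact/Gm/h. Qed.

(** An alias of the indefinite integral of Z, typed on the measurable space of G so
that it can be given a charge structure there. *)
Definition restricted_charge Z (iZ : P.-integrable setT (EFin \o Z)) (A : set GT) : \bar R :=
  induced_charge iZ A.

Section restricted_charge.
Variables (Z : Om -> R) (iZ : P.-integrable setT (EFin \o Z)).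
Let rc := restricted_charge iZ.

Let rc0 : rc set0 = 0%E.
Proof. exact: charge0. Qed.

Let sub (A : set GT) : measurable A -> d.-measurable (A : set Om).
Proof. by rewrite /measurable/= GE => /Gm. Qed.

Let rc_fin (A : set GT) : measurable A -> rc A \is a fin_num.
Proof. by move=> /sub mA; exact: fin_num_measure. Qed.

Let rc_sigma : semi_sigma_additive rc.
Proof.
move=> F mF tF mUF.
by apply: (@charge_semi_sigma_additive _ _ _ (induced_charge iZ) F) => //; [move=> i|]; exact: sub.
Qed.

HB.instance Definition _ := isCharge.Build _ _ _ (restricted_charge iZ) rc0 rc_fin rc_sigma.

End restricted_charge.

(** The density, on the sigma-algebra G, of the indefinite integral of Z with
respect to the restriction of P (Radon-Nikodym). *)
Lemma cond_exp_exists Z : P.-integrable setT (EFin \o Z) -> exists Y, cond_exp P G Z Y.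
Proof.
move=> iZ; have mid := sub_id_measurable.
pose X : {mfun Om >-> GT} := HB.pack (id : Om -> GT) (isMeasurableFun.Build _ _ _ _ _ mid).
pose mu := distribution P X.
pose la : {charge set GT -> \bar R} := restricted_charge iZ.
have dom : la `<< mu.
  apply/null_content_dominatesP => A mA A0.
  have GA : G A by move: mA; rewrite /measurable/= GE.
  rewrite /la /= /restricted_charge /induced_charge.
  apply: null_set_integral => //.
  - exact: Gm.
  - by apply: measurable_funTS; exact: measurable_int iZ.
pose f := Radon_Nikodym la mu.
have ffin x : f x \is a fin_num by exact: Radon_Nikodym_fin_num.
have fi : mu.-integrable setT f by exact: Radon_Nikodym_integrable.
have mf : measurable_fun [set: GT] f by exact: measurable_int fi.
pose Y : Om -> R := fine \o f.
have YE : EFin \o Y = f by apply/funext => w; rewrite /= fineK.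
have aY : adapted_to Y by apply/adapted_toP; exact: measurableT_comp.
have iY : P.-integrable setT (EFin \o Y).
  apply/integrableP; split; first by apply/measurable_EFinP; exact: adapted_measurable.
  have /integrableP[_] := fi.
  rewrite /mu /distribution (@ge0_integral_pushforward _ _ Om GT R X mid)//.
    by rewrite YE.
  by apply: measurableT_comp.
exists Y; split => // A GA.
have mGA : (measurable : set (set GT)) A by rewrite /measurable/= GE.
have := Radon_Nikodym_integral dom mGA.
rewrite /la /= /restricted_charge /induced_charge => ->.
rewrite /mu /distribution (@integral_pushforward _ _ Om GT R X mid)//.
- by apply: eq_integral => w _; exact: (congr1 (@^~ w) YE).
- by rewrite -[X in P.-integrable _ X]/f -YE; apply: (integrableS measurableT) => //; exact: Gm.
Qed.

Lemma cond_exp_adapted Z Y : cond_exp P G Z Y -> adapted_to Y.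
Proof. by case. Qed.

Lemma cond_exp_integrable Z Y : cond_exp P G Z Y -> P.-integrable setT (EFin \o Y).
Proof. by case. Qed.

Lemma cond_exp_Rintegral Z Y A : cond_exp P G Z Y -> G A ->
  \int[P]_(w in A) Y w = \int[P]_(w in A) Z w.
Proof. by move=> [_ _ h] GA; rewrite /Rintegral h. Qed.

Lemma cond_expI Z Y : adapted_to Y -> P.-integrable setT (EFin \o Y) ->
  P.-integrable setT (EFin \o Z) ->
  (forall A, G A -> \int[P]_(w in A) Y w = \int[P]_(w in A) Z w) -> cond_exp P G Z Y.
Proof.
move=> aY iY iZ h; split => // A GA; have mA := Gm GA.
rewrite -[LHS]fineK; last by apply: integrable_fin_num => //; exact: integrable_on.
rewrite -[RHS]fineK; last by apply: integrable_fin_num => //; exact: integrable_on.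
by congr (_%:E); exact: h.
Qed.

Lemma cond_exp_lin (a : R) Z1 Y1 Z2 Y2 :
  P.-integrable setT (EFin \o Z1) -> P.-integrable setT (EFin \o Z2) ->
  cond_exp P G Z1 Y1 -> cond_exp P G Z2 Y2 ->
  cond_exp P G (fun w => a * Z1 w + Z2 w) (fun w => a * Y1 w + Y2 w).
Proof.
move=> iZ1 iZ2 c1 c2.
have iY1 := cond_exp_integrable c1; have iY2 := cond_exp_integrable c2.
apply: cond_expI; try exact: integrable_lin.
- apply/adapted_toP; apply: measurable_funD; last by apply/adapted_toP; exact: cond_exp_adapted c2.
  by apply: measurable_funM => //; apply/adapted_toP; exact: cond_exp_adapted c1.
- move=> A GA; have mA := Gm GA.
  have lin (U V : Om -> R) : P.-integrable setT (EFin \o U) -> P.-integrable setT (EFin \o V) ->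
      \int[P]_(w in A) (a * U w + V w) = a * \int[P]_(w in A) U w + \int[P]_(w in A) V w.
    move=> iU iV; rewrite RintegralD//; last 2 first.
    - exact: (integrableZl mA a (integrable_on mA iU)).
    - exact: integrable_on.
    by rewrite RintegralZl//; exact: integrable_on.
  by rewrite !lin// (cond_exp_Rintegral c1)// (cond_exp_Rintegral c2).
Qed.

Lemma cond_exp_sub Z1 Y1 Z2 Y2 :
  P.-integrable setT (EFin \o Z1) -> P.-integrable setT (EFin \o Z2) ->
  cond_exp P G Z1 Y1 -> cond_exp P G Z2 Y2 ->
  cond_exp P G (fun w => Z1 w - Z2 w) (fun w => Y1 w - Y2 w).
Proof.
move=> i1 i2 c1 c2; have := cond_exp_lin (-1) i2 i1 c2 c1.
have E (U V : Om -> R) : (fun w => -1 * U w + V w) = (fun w => V w - U w).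
  by apply/funext => w; rewrite mulN1r addrC.
by rewrite !E.
Qed.

(** The space is split according to the sign of Y, which is an event of G. *)
Lemma cond_exp_contraction Z Y : P.-integrable setT (EFin \o Z) -> cond_exp P G Z Y ->
  \int[P]_w `|Y w| <= \int[P]_w `|Z w|.
Proof.
move=> iZ cY; have iY := cond_exp_integrable cY.
pose A := Y @^-1` `[0, +oo[.
have GA : G A by apply: (cond_exp_adapted cY); exact: measurable_itv.
have GAc : G (~` A).
  have -> : ~` A = Y @^-1` (~` `[0, +oo[) by [].
  by apply: (cond_exp_adapted cY); apply: measurableC; exact: measurable_itv.
have mA := Gm GA; have mAc := Gm GAc.
rewrite (Rintegral_setC_split mA (integrable_normr iY)) (Rintegral_setC_split mA (integrable_normr iZ)).
apply: lerD.
- have -> : \int[P]_(w in A) `|Y w| = \int[P]_(w in A) Y w.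
    by apply: eq_Rintegral => w; rewrite inE /A/= in_itv/= andbT => /ger0_norm.
  rewrite (cond_exp_Rintegral cY)//; apply: le_Rintegral => //; try exact: integrable_on.
  + by apply: integrable_on => //; exact: integrable_normr.
  + by move=> w _; exact: ler_norm.
- have -> : \int[P]_(w in ~` A) `|Y w| = - \int[P]_(w in ~` A) Y w.
    rewrite -[RHS]mulN1r -RintegralZl//; last exact: integrable_on.
    apply: eq_Rintegral => w; rewrite inE /A/= in_itv/= andbT mulN1r => /negP.
    by rewrite -ltNge => /ltr0_norm.
  rewrite (cond_exp_Rintegral cY)// -[leLHS]mulN1r -RintegralZl//; last exact: integrable_on.
  apply: le_Rintegral => //.
  + exact: (integrableZl mAc (-1) (integrable_on mAc iZ)).
  + by apply: integrable_on => //; exact: integrable_normr.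
  + by move=> w _; rewrite mulN1r -normrN ler_norm.
Qed.

Lemma cond_exp_unique Z Y1 Y2 : P.-integrable setT (EFin \o Z) ->
  cond_exp P G Z Y1 -> cond_exp P G Z Y2 -> {ae P, forall w, Y1 w = Y2 w}.
Proof.
move=> iZ c1 c2; have := cond_exp_sub iZ iZ c1 c2 => c.
have := cond_exp_contraction (integrable_sub iZ iZ) c.
have -> : \int[P]_w `|Z w - Z w| = 0.
  under eq_Rintegral do rewrite subrr normr0; by rewrite Rintegral_cst// mul0r.
move=> /(norm_le_ae0 (cond_exp_integrable c)).
by apply: filterS => w /eqP; rewrite subr_eq0 => /eqP.
Qed.

(** For nonnegative Z, the contraction makes the mean of |Y| - Y at most zero. *)
Lemma cond_exp_ge0 Z Y : P.-integrable setT (EFin \o Z) -> (forall w, 0 <= Z w) ->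
  cond_exp P G Z Y -> {ae P, forall w, 0 <= Y w}.
Proof.
move=> iZ Z0 cY; have iY := cond_exp_integrable cY.
have iD := integrable_sub (integrable_normr iY) iY.
suff : \int[P]_w `| `|Y w| - Y w| <= 0.
  by move=> /(norm_le_ae0 iD); apply: filterS => w /eqP; rewrite subr_eq0 => /eqP <-.
under eq_Rintegral do rewrite ger0_norm ?subr_ge0 ?ler_norm//.
have GT1 : G setT by case: sG => g0 gC _; rewrite -(setD0 setT); exact: gC.
rewrite RintegralB//; last exact: integrable_normr.
rewrite (cond_exp_Rintegral cY GT1) subr_le0 (le_trans (cond_exp_contraction iZ cY))//.
by apply: le_Rintegral => // [|w _]; [exact: integrable_normr|rewrite ger0_norm].
Qed.

(** Bounds on Z hold almost surely for any version, which can thus be truncated. *)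
Lemma cond_exp_bounded Z (K : R) : P.-integrable setT (EFin \o Z) -> (forall w, `|Z w| <= K) ->
  exists2 Y, cond_exp P G Z Y & forall w, `|Y w| <= K.
Proof.
move=> iZ ZK; have [Y0 c0] := cond_exp_exists iZ.
have iY0 := cond_exp_integrable c0; have aY0 := cond_exp_adapted c0.
have K0 : 0 <= K by rewrite (le_trans _ (ZK point)).
have iK : P.-integrable setT (EFin \o (fun _ : Om => K)) by exact: finite_measure_integrable_cst.
have cK : cond_exp P G (fun _ => K) (fun _ => K).
  by apply: cond_expI => //; apply/adapted_toP; exact: measurable_cst.
have up := cond_exp_ge0 (integrable_sub iK iZ) _ (cond_exp_sub iK iZ cK c0).
have lo := cond_exp_ge0 (integrable_lin 1 iZ iK) _ (cond_exp_lin 1 iZ iK c0 cK).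
have Y0K : {ae P, forall w, truncate K (Y0 w) = Y0 w}.
  have bd w : - K <= Z w <= K by have := ZK w; rewrite ler_norml.
  apply: filterS2 (up _) (lo _) => [w h1 h2|w|w]; last 2 first.
  - by have /andP[_ h] := bd w; rewrite subr_ge0.
  - by have /andP[h _] := bd w; rewrite mul1r; lra.
  by apply: truncate_id; rewrite ler_norml; apply/andP; split; lra.
have aY : adapted_to (fun w => truncate K (Y0 w)).
  by apply/adapted_toP; apply: measurable_truncate; apply/adapted_toP.
have YK w : `|truncate K (Y0 w)| <= K by exact: truncate_bound.
have iY : P.-integrable setT (EFin \o (fun w => truncate K (Y0 w))).
  by apply: integrable_bounded YK; exact: adapted_measurable.
exists (fun w => truncate K (Y0 w)) => //; apply: cond_expI => // A GA; have mA := Gm GA.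
rewrite -(cond_exp_Rintegral c0)// /Rintegral; congr fine; apply: ae_eq_integral => //.
- by apply: measurable_funTS; exact: measurable_int iY.
- by apply: measurable_funTS; exact: measurable_int iY0.
- by apply: filterS Y0K => w -> _.
Qed.

(** The functionals that take phi to the means of W^+ * phi(X) and W^- * phi(X) agree
on indicators of rays, as X lies in a ray on an event of G; hence they agree on the
positive and the negative part of the identity. *)
Lemma integral_mul_adapted_eq0 X W : adapted_to X -> P.-integrable setT (EFin \o W) ->
  P.-integrable setT (EFin \o (fun w => X w * W w)) ->
  (forall A, G A -> \int[P]_(w in A) W w = 0) -> \int[P]_w (X w * W w) = 0.
Proof.
move=> aX iW iXW hW.
have mX := adapted_measurable aX; have mW := integrable_measurable iW.
pose pos (x : R) := Num.max x 0; pose neg (x : R) := Num.max (- x) 0.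
have mpos : measurable_fun [set: R] pos by exact: measurable_maxr.
have mneg : measurable_fun [set: R] neg by apply: measurable_maxr => //; apply: measurableT_comp.
have posneg x : [/\ 0 <= pos x, 0 <= neg x, `|pos x| <= `|x|, `|neg x| <= `|x| & x = pos x - neg x].
  rewrite /pos /neg; case: (leP x 0) => hx; case: (leP (- x) 0) => hx';
  by split; rewrite ?normr0 ?normrN //; lra.
pose Wp w := pos (W w); pose Wn w := neg (W w).
have mWp : measurable_fun setT Wp by exact: measurableT_comp.
have mWn : measurable_fun setT Wn by exact: measurableT_comp.
have Wp0 w : 0 <= Wp w by have [] := posneg (W w).
have Wn0 w : 0 <= Wn w by have [] := posneg (W w).
have iWp : P.-integrable setT (EFin \o Wp).
  by apply: integrable_dominated iW _ => // w; have [] := posneg (W w).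
have iWn : P.-integrable setT (EFin \o Wn).
  by apply: integrable_dominated iW _ => // w; have [] := posneg (W w).
have pn A : G A -> \int[P]_(w in A) Wp w = \int[P]_(w in A) Wn w.
  move=> GA; have mA := Gm GA; apply/eqP; rewrite -subr_eq0 -RintegralB//; try exact: integrable_on.
  by rewrite -[eqbRHS](hW A GA); apply/eqP; apply: eq_Rintegral => w _; have [] := posneg (W w).
pose La V (phi : R -> \bar R) := (\int[P]_(w in setT) ((V w)%:E * phi (X w)))%E.
have pfLa (V : Om -> R) : measurable_fun setT V -> (forall w, 0 <= V w) -> positive_functional (La V).
  move=> mV V0; apply: (@positive_functional_integral _ Om R P setT X (EFin \o V)) => //.
  exact/measurable_EFinP.
have ray (V : Om -> R) (x : R) : P.-integrable setT (EFin \o V) ->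
    La V (EFin \o \1_(`]-oo, x]%classic)) = (\int[P]_(w in X @^-1` `]-oo, x]) V w)%:E.
  move=> iV; have mr : measurable (X @^-1` `]-oo, x]).
    by rewrite -[X in measurable X]setTI; apply: mX => //; exact: measurable_itv.
  rewrite /Rintegral fineK; last by apply: integrable_fin_num => //; exact: integrable_on.
  rewrite [RHS]integral_mkcond; apply: eq_integral => w _.
  by rewrite epatch_indic/= !indicE.
have LaE := positive_functional_rays_eq (pfLa Wp mWp Wp0) (pfLa Wn mWn Wn0).
have part (a : R -> R) : measurable_fun [set: R] a -> (forall x, 0 <= a x) ->
    (forall x, `|a x| <= `|x|) -> P.-integrable setT (EFin \o (fun w => a (X w) * W w)) /\
    \int[P]_w (a (X w) * W w) = 0.
  move=> ma a0 ax; have maX : measurable_fun setT (fun w => a (X w)) by exact: measurableT_comp.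
  have dom (V : Om -> R) : measurable_fun setT V -> (forall w, `|V w| <= `|W w|) ->
      P.-integrable setT (EFin \o (fun w => V w * a (X w))).
    move=> mV VW; apply: integrable_dominated iXW _; first exact: measurable_funM.
    by move=> w; rewrite !normrM mulrC ler_pM.
  have ip : P.-integrable setT (EFin \o (fun w => Wp w * a (X w))).
    by apply: dom => // w; have [] := posneg (W w).
  have in_ : P.-integrable setT (EFin \o (fun w => Wn w * a (X w))).
    by apply: dom => // w; have [] := posneg (W w).
  have aE w : a (X w) * W w = Wp w * a (X w) - Wn w * a (X w).
    by rewrite -mulrBl mulrC; have [_ _ _ _ <-] := posneg (W w).
  split.
    have := integrable_sub ip in_.
    by congr (P.-integrable _ _); apply/funext => w /=; rewrite aE.
  under eq_Rintegral do rewrite aE.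
  rewrite RintegralB//; apply/eqP; rewrite subr_eq0 /Rintegral; apply/eqP; congr fine.
  under eq_integral do rewrite EFinM; under [RHS]eq_integral do rewrite EFinM.
  apply: (LaE _ _ (EFin \o a)) => //.
  - by move=> x; rewrite ray// ltry.
  - move=> x; rewrite !ray// pn//; apply: aX; exact: measurable_itv.
  - exact/measurable_EFinP.
have [i1 e1] : P.-integrable setT (EFin \o (fun w => pos (X w) * W w)) /\
    \int[P]_w (pos (X w) * W w) = 0.
  by apply: part => // x; have [] := posneg x.
have [i2 e2] : P.-integrable setT (EFin \o (fun w => neg (X w) * W w)) /\
    \int[P]_w (neg (X w) * W w) = 0.
  by apply: part => // x; have [] := posneg x.
transitivity (\int[P]_w (pos (X w) * W w - neg (X w) * W w)).
  by apply: eq_Rintegral => w _; rewrite -mulrBl; have [_ _ _ _ <-] := posneg (X w).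
by rewrite RintegralB// e1 e2 subrr.
Qed.

Lemma cond_exp_pull_out Z Y X (C : R) : P.-integrable setT (EFin \o Z) ->
  cond_exp P G Z Y -> adapted_to X -> (forall w, `|X w| <= C) ->
  \int[P]_w (X w * Y w) = \int[P]_w (X w * Z w).
Proof.
move=> iZ cY aX XC; have iY := cond_exp_integrable cY.
have mX := adapted_measurable aX.
have iW := integrable_sub iY iZ; have iXW := integrable_mul_bounded mX XC iW.
apply/eqP; rewrite -subr_eq0 -RintegralB//; last 2 first.
- exact: integrable_mul_bounded mX XC iY.
- exact: integrable_mul_bounded mX XC iZ.
under eq_Rintegral do rewrite -mulrBr; apply/eqP.
apply: integral_mul_adapted_eq0 => // A GA; have mA := Gm GA.
by rewrite RintegralB//; [rewrite (cond_exp_Rintegral cY)// subrr|exact: integrable_on|exact: integrable_on].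
Qed.

End conditional_expectation.

(** * Continuity of conditional expectations along decreasing sigma-algebras *)

Section backward.
Context d (Om : measurableType d) (R : realType) (P : probability Om R).
Variables (H : R -> set (set Om)) (s : R).
Hypothesis sH : forall r, s < r -> sigma_algebra setT (H r).
Hypothesis Hm : forall r, s < r -> H r `<=` measurable.
Hypothesis Hle : forall r r', s < r -> r <= r' -> H r `<=` H r'.

(** The second moments phi r of b r are monotone in r, so that they vary little close
to s, and phi r' - phi r is the second moment of the increment; the bound
x <= x^2 / c + c converts it into a first moment. *)
Lemma backward_cauchy_bounded (Z : Om -> R) (K e : R) (b : R -> Om -> R) :
  P.-integrable setT (EFin \o Z) -> (forall w, `|Z w| <= K) ->
  (forall r, s < r -> cond_exp P (H r) Z (b r)) -> (forall r w, s < r -> `|b r w| <= K) -> 0 < e ->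
  exists2 t, s < t & forall r r', s < r -> r <= r' -> r' <= t ->
    \int[P]_w `|b r' w - b r w| <= e.
Proof.
move=> iZ ZK cb bK e0.
have ib r : s < r -> P.-integrable setT (EFin \o b r) by move=> /cb; exact: cond_exp_integrable.
have mb r : s < r -> measurable_fun setT (b r) by move=> sr; exact: integrable_measurable (ib _ sr).
have ibb r r' : s < r -> s < r' -> P.-integrable setT (EFin \o (fun w => b r w * b r' w)).
  by move=> h h'; exact: (integrable_mul_bounded (mb _ h) (fun w => bK r w h) (ib _ h')).
pose phi r := \int[P]_w (b r w * b r w).
have phi0 r : 0 <= phi r by apply: Rintegral_ge0 => w _; rewrite -expr2 sqr_ge0.
have sq r r' : s < r -> r <= r' ->
    \int[P]_w ((b r' w - b r w) ^+ 2) = phi r' - phi r.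
  move=> sr rr'; have sr' := lt_le_trans sr rr'.
  have cross : \int[P]_w (b r w * b r' w) = phi r.
    have ar : adapted_to (H r) (b r) by exact: cond_exp_adapted (cb _ sr).
    have ar' : adapted_to (H r') (b r) by move=> B mB; apply: (Hle sr rr'); exact: ar.
    rewrite (cond_exp_pull_out (Hm sr') iZ (cb _ sr') ar' (fun w => bK r w sr)).
    by rewrite -(cond_exp_pull_out (Hm sr) iZ (cb _ sr) ar (fun w => bK r w sr)).
  transitivity (\int[P]_w ((b r' w * b r' w - b r w * b r' w) - (b r w * b r' w - b r w * b r w))).
    by apply: eq_Rintegral => w _; ring.
  have i1 := ibb _ _ sr' sr'; have i2 := ibb _ _ sr sr'; have i3 := ibb _ _ sr sr.
  rewrite RintegralB//; [|exact: integrable_sub|exact: integrable_sub].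
  by rewrite RintegralB// RintegralB// cross -/(phi _) -/(phi _) subrr subr0.
pose c := e / 2; have c0 : 0 < c by rewrite divr_gt0.
pose S := [set phi r | r in [set r | s < r]].
have hS : has_inf S.
  split; first by exists (phi (s + 1)), (s + 1) => //=; rewrite ltrDl.
  by exists 0 => _ [r _ <-].
have [_ [t st <-] ht] := inf_adherent (mulr_gt0 c0 c0) hS.
exists t => // r r' sr rr' r't; have sr' := lt_le_trans sr rr'.
have mono u v : s < u -> u <= v -> phi u <= phi v.
  move=> su uv; rewrite -subr_ge0 -sq//; apply: Rintegral_ge0 => w _; exact: sqr_ge0.
have isq : P.-integrable setT (EFin \o (fun w => (b r' w - b r w) ^+ 2)).
  have ii := integrable_sub (ib _ sr') (ib _ sr).
  apply: (@integrable_bounded _ _ _ _ _ ((K + K) ^+ 2)).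
    by apply: measurable_funX; exact: integrable_measurable ii.
  move=> w; rewrite normrX.
  have h : `|b r' w - b r w| <= K + K by rewrite (le_trans (ler_normB _ _))// lerD// bK.
  by apply: lerXn2r => //; rewrite nnegrE// (le_trans (normr_ge0 _) h).
have le1 : phi r' - phi r <= c * c.
  have h1 : inf S <= phi r by apply: (ge_inf hS.2); exists r.
  have h2 := mono _ _ sr' r't.
  lra.
apply: (@le_trans _ _ (\int[P]_w (c^-1 * (b r' w - b r w) ^+ 2 + c))).
  apply: le_Rintegral => //.
  - by apply: integrable_normr; exact: integrable_sub (ib _ sr') (ib _ sr).
  - have ic : P.-integrable setT (EFin \o (fun _ : Om => c)) by exact: finite_measure_integrable_cst.
    exact: (integrable_lin c^-1 isq ic).
  - move=> w _; set x := b r' w - b r w.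
    have : 0 <= c^-1 * (`|x| - c / 2) ^+ 2 by rewrite mulr_ge0 ?sqr_ge0// invr_ge0 ltW.
    rewrite -(real_normK (num_real x)).
    set y := `|x|; have -> : c^-1 * (y - c / 2) ^+ 2 = c^-1 * y ^+ 2 - y + c / 4 by field; rewrite gt_eqF.
    by lra.
have ic : P.-integrable setT (EFin \o (fun _ : Om => c)) by exact: finite_measure_integrable_cst.
rewrite RintegralD//; last exact: (integrableZl measurableT c^-1 isq).
rewrite RintegralZl// sq// Rintegral_cst//.
have -> : fine (P [set: Om]) = 1 by rewrite probability_setT.
have : c^-1 * (phi r' - phi r) <= c^-1 * (c * c) by rewrite ler_wpM2l// invr_ge0 ltW.
rewrite mulrA mulVf ?gt_eqF// mul1r mulr1 /c; lra.
Qed.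

(** By truncation of Z, as conditional expectations contract the L1 norm. This is the
backward martingale convergence theorem in Cauchy form, without the limit, which
is identified separately in each application. *)
Lemma backward_cauchy (Z : Om -> R) (e : R) (m : R -> Om -> R) :
  P.-integrable setT (EFin \o Z) ->
  (forall r, s < r -> cond_exp P (H r) Z (m r)) -> 0 < e ->
  exists2 t, s < t & forall r r', s < r -> s < r' -> r <= t -> r' <= t ->
    \int[P]_w `|m r w - m r' w| <= e.
Proof.
move=> iZ cm e0.
have mZ := integrable_measurable iZ.
pose tr (k : nat) w : R := truncate k%:R (Z w).
have mtr k : measurable_fun setT (tr k) by exact: measurable_truncate.
have trK k w : `|tr k w| <= k%:R by exact: truncate_bound.
have itr k : P.-integrable setT (EFin \o tr k) by exact: integrable_bounded (mtr k) (trK k).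
have trle k w : `|Z w - tr k w| <= `|Z w| by exact: truncate_dist_le.
have [k hk] : exists k, \int[P]_w `|Z w - tr k w| <= e / 4.
  have mdiff k : measurable_fun setT (fun w => (`|Z w - tr k w|)%:E).
    exact: measurable_int (integrable_normr (integrable_sub iZ (itr k))).
  have cv0 : {ae P, forall w, setT w -> (`|Z w - tr k w|)%:E @[k --> \oo] --> 0%E}.
    apply: aeW => w _; apply: cvg_near_cst.
    by apply: filterS (truncate_cvg (Z w)) => k tE; rewrite /tr tE subrr normr0.
  have ile : {ae P, forall w k, setT w -> (`|(`|Z w - tr k w|)%:E| <= (`|Z w|)%:E)%E}.
    by apply: aeW => w k _; rewrite abse_EFin lee_fin normr_id.
  have [_ _ cv] := @dominated_convergence _ Om R P setT measurableT _ _ _ mdiff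
    (measurable_cst 0%E) cv0 (integrable_normr iZ) ile.
  have lt0 : (0 < (e / 4)%:E :> \bar R)%E by rewrite lte_fin divr_gt0.
  rewrite integral0 in cv.
  have : \forall k \near \oo, (\int[P]_w (`|Z w - tr k w|)%:E < (e / 4)%:E)%E.
    move/fine_cvgP : cv => [fin cv]; have e4 : 0 < e / 4 by rewrite divr_gt0.
    have [k1 _ h1] := fin; have [k2 _ h2] := cvgr_lt _ cv _ e4.
    exists (maxn k1 k2) => // k /=; rewrite geq_max => /andP[k1k k2k].
    by have := h2 k k2k; rewrite /= -lte_fin fineK//; exact: h1.
  move=> [k _ /(_ k (leqnn k)) hk]; exists k.
  rewrite -lee_fin /Rintegral fineK ?ltW//.
  by apply: integrable_fin_num => //; exact: (integrable_normr (integrable_sub iZ (itr k))).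
have /choice[b hb] r : exists br : Om -> R, s < r -> cond_exp P (H r) (tr k) br /\ forall w, `|br w| <= k%:R.
  have [sr|rs] := ltP s r; last by exists (cst 0).
  have [br c1 c2] := cond_exp_bounded (sH sr) (Hm sr) (itr k) (trK k).
  by exists br.
have e4 : 0 < e / 2 by rewrite divr_gt0.
have [t st ht] := backward_cauchy_bounded (itr k) (trK k) (fun r sr => (hb r sr).1)
  (fun r w sr => (hb r sr).2 w) e4.
exists t => //.
have main r r' : s < r -> r <= r' -> r' <= t -> \int[P]_w `|m r w - m r' w| <= e.
  move=> sr rr' r't; have sr' := lt_le_trans sr rr'.
  have [c1 _] := hb r sr; have [c1' _] := hb r' sr'.
  have cs := cond_exp_contraction (Hm sr) (integrable_sub iZ (itr k))
    (cond_exp_sub (sH sr) (Hm sr) iZ (itr k) (cm _ sr) c1).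
  have cs' := cond_exp_contraction (Hm sr') (integrable_sub iZ (itr k))
    (cond_exp_sub (sH sr') (Hm sr') iZ (itr k) (cm _ sr') c1').
  have i1 := cond_exp_integrable (cm _ sr); have i1' := cond_exp_integrable (cm _ sr').
  have i2 := cond_exp_integrable c1; have i2' := cond_exp_integrable c1'.
  have n1 := integrable_normr (integrable_sub i1 i2).
  have n2 := integrable_normr (integrable_sub i2' i2).
  have n3 := integrable_normr (integrable_sub i1' i2').
  apply: (@le_trans _ _ (\int[P]_w (`|m r w - b r w| + (`|b r' w - b r w| + `|m r' w - b r' w|)))).
    apply: le_Rintegral => //.
    - exact: integrable_normr (integrable_sub i1 i1').
    - exact: (integrableD measurableT n1 (integrableD measurableT n2 n3)).
    - move=> w _; rewrite -[X in _ <= _ + (X + _)]normrN -[X in _ <= _ + (_ + X)]normrN.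
      apply: le_trans (lerD (lexx _) (ler_normD _ _)); apply: le_trans (ler_normD _ _).
      by rewrite (_ : m r w - m r' w = (m r w - b r w) + (- (b r' w - b r w) + - (m r' w - b r' w)))//; ring.
  rewrite RintegralD//; last exact: (integrableD measurableT n2 n3).
  rewrite RintegralD//.
  have := ht r r' sr rr' r't.
  lra.
move=> r r' sr sr' rt r't; have [rr'|/ltW r'r] := leP r r'; first exact: main.
under eq_Rintegral do rewrite distrC; exact: main.
Qed.

End backward.

(** * L1 limits of almost surely convergent sequences *)

(** Fatou's lemma, from which the integrability of the limit follows too. *)
Lemma L1_limit d (Om : measurableType d) (R : realType) (P : probability Om R)
    (X : nat -> Om -> R) (Y Z : Om -> R) (e : R) :
  (forall k, P.-integrable setT (EFin \o X k)) -> P.-integrable setT (EFin \o Z) ->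
  measurable_fun setT Y -> {ae P, forall w, X k w @[k --> \oo] --> Y w} ->
  (forall k, \int[P]_w `|X k w - Z w| <= e) ->
  P.-integrable setT (EFin \o Y) /\ \int[P]_w `|Y w - Z w| <= e.
Proof.
move=> iX iZ mY XY XZ.
have mZ := integrable_measurable iZ.
have mYZ : measurable_fun setT (fun w => `|Y w - Z w|).
  by apply: measurableT_comp => //; exact: measurable_funB.
have iXZ k := integrable_normr (integrable_sub (iX k) iZ).
have le1 : (\int[P]_w (`|Y w - Z w|)%:E <= e%:E)%E.
  have ft := @fatou _ Om R P setT measurableT (fun k w => (`|X k w - Z w|)%:E)
    (fun k => measurable_int _ (iXZ k)) (fun k w _ => normr_ge0 _).
  apply: (@le_trans _ _ (\int[P]_w limn_einf (fun k => (`|X k w - Z w|)%:E))%E).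
    apply: ae_ge0_le_integral => //.
    - exact/measurable_EFinP.
    - move=> w _; rewrite limn_einf_lim; apply: lime_ge; first exact: is_cvg_einfs.
      by apply: nearW => k; apply: le_ereal_inf_tmp => _ [p _ <-].
    - rewrite (_ : (fun w => _) =
          (fun w => - limn_esup (fun k => - (`|X k w - Z w|)%:E))%E); last first.
        apply/funext => w; have := limn_esupN (fun k => (`|X k w - Z w|)%:E).
        by rewrite /comp => ->; rewrite oppeK.
      apply: measurableT_comp => //; apply: measurable_fun_limn_esup => k.
      by apply: measurableT_comp => //; exact: measurable_int (iXZ k).
    - apply: filterS XY => w h _.
      have cv : (`|X k w - Z w|)%:E @[k --> \oo] --> (`|Y w - Z w|)%:E.
        apply: cvg_EFin; first by exists 0%N.
        by apply: cvg_norm; apply: cvgB => //; exact: cvg_cst.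
      by have [-> _] := cvg_limn_einf_sup cv.
  apply: (le_trans ft); rewrite limn_einf_lim; apply: lime_le.
    exact: is_cvg_einfs.
  exists 0%N => // k _; apply: (@le_trans _ _ (\int[P]_w (`|X k w - Z w|)%:E)%E).
    by apply: ereal_inf_lbound; exists k => //=.
  rewrite -[leLHS]fineK ?lee_fin//; first exact: XZ.
  by apply: integrable_fin_num => //; exact: iXZ.
have iYZ : P.-integrable setT (EFin \o (fun w => Y w - Z w)).
  apply/integrableP; split; first by apply/measurable_EFinP; exact: measurable_funB.
  by rewrite (le_lt_trans le1)// ltry.
split.
  have := integrable_add iYZ iZ.
  by congr (P.-integrable _ _); apply/funext => w /=; rewrite subrK.
rewrite /Rintegral -lee_fin fineK//.
by apply: integrable_fin_num => //; exact: integrable_normr.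
Qed.

(** * The harness property *)

(** It suffices that (t - r) / (1 - r) be rational. This ratio is a strictly
decreasing function of r, so that it takes rational values arbitrarily close to
s; solving for r gives r = (t - x) / (1 - x) for a rational x. *)
Lemma grid_start_near (R : realType) (s t e : R) : s < t -> t < 1 -> 0 < e ->
  exists r, [/\ s < r < t, r < s + e &
    exists k N : nat, [/\ (k <= N)%N, (0 < N)%N & t = r + k%:R * ((1 - r) / N%:R)]].
Proof.
move=> st t1 e0; pose e' := Num.min e ((t - s) / 2).
have ts : 0 < t - s by rewrite subr_gt0.
have e'0 : 0 < e' by rewrite lt_min e0 divr_gt0.
have e'e : e' <= e by rewrite ge_min lexx.
have e't : e' <= (t - s) / 2 by rewrite ge_min lexx orbT.
clearbody e'; pose la r := (t - r) / (1 - r).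
have se1 : 0 < 1 - (s + e') by lra.
have s1 : 0 < 1 - s by lra.
have la_lt : la (s + e') < la s.
  rewrite /la ltr_pdivrMr// mulrAC ltr_pdivlMr//.
  have : 0 < e' * (1 - t) by rewrite mulr_gt0// subr_gt0.
  nra.
have la0 : 0 < la (s + e') by rewrite divr_gt0//; lra.
have [q] := rat_in_itvoo la_lt; rewrite in_itv/= => /andP[q1 q2].
have q0 : 0 < q by rewrite -(@ltr0q R) (lt_trans la0).
pose x : R := ratr q.
have x1 : x < 1.
  by apply: (lt_le_trans q2); rewrite /la ler_pdivrMr// mul1r; lra.
have x0 : 0 < x by rewrite ltr0q.
have x1' : 0 < 1 - x by rewrite subr_gt0.
pose r := (t - x) / (1 - x).
have rE : r * (1 - x) = t - x by rewrite /r divfK// gt_eqF.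
have sr : s < r.
  move: q2; rewrite -/x /la ltr_pdivlMr// => q2.
  by rewrite /r ltr_pdivlMr//; nra.
have re : r < s + e'.
  move: q1; rewrite -/x /la ltr_pdivrMr// => q1.
  by rewrite /r ltr_pdivrMr//; nra.
have rt : r < t by lra.
exists r; split; [by rewrite sr|by lra|].
have xE : x = (`|numq q|)%:R / (`|denq q|)%:R.
  rewrite /x /ratr -{1}(gtz0_abs (denq_gt0 q)) -{1}(@gtz0_abs (numq q)) ?numq_gt0//.
exists `|numq q|%N, `|denq q|%N; split.
- rewrite -(@ler_nat R); move: (ltW x1); rewrite xE ler_pdivrMr ?mul1r// ltr0n.
  by rewrite absz_gt0 denq_neq0.
- by rewrite absz_gt0 denq_neq0.
- rewrite (_ : _ * (_ / _) = x * (1 - r)); first lra.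
  by rewrite xE; ring.
Qed.

Section harness.
Variables (R : realType) (n : nat) (m : 'I_n -> R)
    (nu : probability (measurableTypeR R) R)
    (d : measure_display) (Om : measurableType d) (P : probability Om R)
    (xi : R -> 'I_n -> {RV P >-> R}).
Hypothesis m_gt0 : forall i, 0 < m i.
Hypothesis xi_glp : generalised_liouville_process m nu xi.
Hypothesis xi_int : forall t i, 0 < t <= 1 -> P.-integrable setT (EFin \o xi t i).

Let xif := fun t i w => xi t i w.
Let H := completed_past xi.
Let F := filtration_of P xif.

Lemma completed_past_sigma_algebra r : sigma_algebra setT (H r).
Proof. exact: smallest_sigma_algebra. Qed.

Lemma completed_past_mono r r' : r <= r' -> H r `<=` H r'.
Proof.
move=> rr'; apply: smallest_sub; first exact: smallest_sigma_algebra.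
move=> A [[u [i [B [/andP[u0 ur] mB ->]]]]|h]; apply: sub_sigma_algebra; last by right.
left; exists u, i, B; split => //; rewrite u0/= le_min.
by move: ur; rewrite le_min => /andP[ur ->]; rewrite (le_trans ur rr').
Qed.

Lemma completed_past_null r N : measurable N -> P N = 0%E -> H r N.
Proof. by move=> mN N0; apply: sub_sigma_algebra; right. Qed.

Lemma xi_adapted u r i : 0 <= u <= 1 -> u <= r -> adapted_to (H r) (xi u i).
Proof.
move=> /andP[u0 u1] ur B mB; apply: sub_sigma_algebra; left; exists u, i, B; split => //.
by rewrite u0 le_min ur.
Qed.

Lemma filtration_sub s r : s < r -> F s `<=` H r.
Proof. by move=> sr A FA; exact: FA. Qed.

Lemma filtration_mono s s' : s <= s' -> F s `<=` F s'.
Proof. by move=> ss' A FA r /= s'r; apply: FA; exact: le_lt_trans s'r. Qed.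

Lemma filtration_measurable s : F s `<=` measurable.
Proof.
move=> A /(_ (s + 1)) h.
by apply: (@completed_past_measurable _ _ _ _ _ xi (s + 1)); apply: h; rewrite /= ltrDl.
Qed.

Lemma filtration_sigma_algebra s : sigma_algebra setT (F s).
Proof.
split.
- by move=> r _; have [] := completed_past_sigma_algebra r.
- by move=> A FA r sr; have [_ h _] := completed_past_sigma_algebra r; apply: h; exact: FA.
- by move=> A FA r sr; have [_ _ h] := completed_past_sigma_algebra r; apply: h => k; exact: FA.
Qed.

Lemma xi_right_continuous i s (r : nat -> R) w : 0 <= s -> (forall k, s < r k <= 1) ->
  r k @[k --> \oo] --> s -> xi (r k) i w @[k --> \oo] --> xi s i w.
Proof.
move=> s0 sr rs.
have s01 : 0 <= s <= 1 by have /andP[h1 h2] := sr 0%N; rewrite s0 ltW// (lt_le_trans h1).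
have [h _] := xi_glp.1 i w s s01; apply: cvg_trans h.
move=> B /= nB; rewrite /fmap/=.
have [e /= e0 he] := nB; move/cvgrPdist_lt/(_ e e0) : rs => [N _ hN].
exists N => // k Nk; have /andP[srk rk1] := sr k; apply: he; first exact: hN.
  exact: srk.
by rewrite rk1 ltW// (le_lt_trans s0).
Qed.

Section fixed_times.
Variables (i : 'I_n) (s t : R).
Hypotheses (s_ge0 : 0 <= s) (st : s < t) (t1 : t < 1).

Let U w := xi t i w - t * xi 1 i w.
Let V w := xi t i w - xi 1 i w.

Let t01 : 0 < t <= 1. Proof. by rewrite (le_lt_trans s_ge0 st) ltW. Qed.
Let one01 : 0 < (1 : R) <= 1. Proof. by rewrite ltr01 lexx. Qed.
Let iV : P.-integrable setT (EFin \o V).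
Proof. exact: integrable_sub (xi_int i t01) (xi_int i one01). Qed.
Let iU : P.-integrable setT (EFin \o U).
Proof.
have := integrable_lin (- t) (xi_int i one01) (xi_int i t01).
by congr (P.-integrable _ _); apply/funext => w; rewrite /U/= mulNr addrC.
Qed.

Let grid : set R := [set r | s < r < t /\
  exists k N : nat, [/\ (k <= N)%N, (0 < N)%N & t = r + k%:R * ((1 - r) / N%:R)]].

Let grid_near (e : R) : 0 < e -> exists2 r, grid r & r < s + e.
Proof. by move=> e0; have [r [srt re kN]] := grid_start_near st t1 e0; exists r. Qed.

(** The grid identity solved for xi r: it is a combination, with coefficients that
are continuous in r, of conditional expectations of fixed variables. *)
Let grid_cond_exp r : grid r ->
  cond_exp P (H r) (fun w => - r * V w + U w) (fun w => (1 - t) * xi r i w).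
Proof.
move=> [/andP[sr rt] [k [N [kN N0 tE]]]].
have r01 : 0 < r < 1 by rewrite (le_lt_trans s_ge0 sr) (lt_trans rt).
have r01' : 0 < r <= 1 by case/andP: r01 => -> /ltW.
have ir := xi_int i r01'.
have ar : adapted_to (H r) (fun w => (1 - t) * xi r i w).
  apply/(adapted_toP (completed_past_sigma_algebra r)); apply: measurable_funM => //.
  apply/(adapted_toP (completed_past_sigma_algebra r)).
  by apply: xi_adapted => //; case/andP: r01' => /ltW -> ->.
apply: cond_expI => //.
- exact: completed_past_measurable.
- exact: (integrableZl measurableT (1 - t) ir).
- exact: integrable_lin.
move=> A HA; have mA := completed_past_measurable HA.
have N0' : N%:R != 0 :> R by rewrite pnatr_eq0 -lt0n.
have := grid_harness m_gt0 xi_glp xi_int i r01 kN N0 HA.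
rewrite -tE RintegralB//; last 2 first.
- exact: integrable_on (xi_int i t01).
- exact: integrable_on ir.
rewrite RintegralB//; last 2 first.
- exact: integrable_on (xi_int i one01).
- exact: integrable_on ir.
have -> : \int[P]_(w in A) (- r * V w + U w) =
    (1 - r) * \int[P]_(w in A) xi t i w - (t - r) * \int[P]_(w in A) xi 1 i w.
  transitivity (\int[P]_(w in A) ((1 - r) * xi t i w - (t - r) * xi 1 i w)).
    by apply: eq_Rintegral => w _; rewrite /U /V; ring.
  rewrite RintegralB//; last 2 first.
  - exact: (integrableZl mA (1 - r) (integrable_on mA (xi_int i t01))).
  - exact: (integrableZl mA (t - r) (integrable_on mA (xi_int i one01))).
  by rewrite !RintegralZl//; apply: integrable_on => //; exact: xi_int.
rewrite RintegralZl//; last exact: integrable_on ir.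
set a := \int[P]_(w in A) xi t i w; set b := \int[P]_(w in A) xi r i w.
set c := \int[P]_(w in A) xi 1 i w => h.
have lE : k%:R / N%:R * (1 - r) = t - r by rewrite tE; field.
have : (1 - r) * (a - b) = (t - r) * (c - b) by rewrite h -lE; ring.
by nra.
Qed.

(* three terms: the conditional expectations of U, those of V, and the variation of
   the coefficient r *)
Let grid_cauchy (e : R) : 0 < e -> exists2 u, s < u & forall r r', grid r -> grid r' ->
  r <= u -> r' <= u -> \int[P]_w `|xi r i w - xi r' i w| <= e.
Proof.
move=> e0.
have ce (Z : Om -> R) : P.-integrable setT (EFin \o Z) -> exists mZ : R -> Om -> R,
    forall r, s < r -> cond_exp P (H r) Z (mZ r).
  move=> iZ; have /choice[mZ h] r : exists Y, cond_exp P (H r) Z Y.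
    exact: (cond_exp_exists (completed_past_sigma_algebra r) (@completed_past_measurable _ _ _ _ _ xi r) iZ).
  by exists mZ.
have [mU hU] := ce U iU; have [mV hV] := ce V iV.
have bc := backward_cauchy (fun r (_ : s < r) => completed_past_sigma_algebra r)
  (fun r (_ : s < r) => @completed_past_measurable _ _ _ _ _ xi r)
  (fun r r' (_ : s < r) rr' => completed_past_mono rr').
pose c := (1 - t) * e / 3.
have t10 : 0 < 1 - t by rewrite subr_gt0.
have c0 : 0 < c by rewrite divr_gt0// mulr_gt0.
have [u1 su1 h1] := bc P U c mU iU hU c0.
have [u2 su2 h2] := bc P V c mV iV hV c0.
pose EV := \int[P]_w `|V w|.
have EV0 : 0 <= EV by apply: Rintegral_ge0.
pose u3 := s + c / (EV + 1).
have su3 : s < u3 by rewrite ltrDl divr_gt0// ltr_wpDl.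
exists (Num.min u1 (Num.min u2 u3)); first by rewrite !lt_min su1 su2 su3.
move=> r r' gr gr'; rewrite !le_min => /and3P[r1 r2 r3] /and3P[r'1 r'2 r'3].
have [/andP[sr rt] _] := gr; have [/andP[sr' r't] _] := gr'.
have r01 : 0 < r <= 1 by rewrite (le_lt_trans s_ge0 sr) ltW// (lt_trans rt).
have r'01 : 0 < r' <= 1 by rewrite (le_lt_trans s_ge0 sr') ltW// (lt_trans r't).
have xiE v : grid v -> {ae P, forall w, (1 - t) * xi v i w = - v * mV v w + mU v w}.
  move=> gv; have [/andP[sv _] _] := gv.
  have c1 := cond_exp_lin (completed_past_sigma_algebra v) (@completed_past_measurable _ _ _ _ _ xi v)
    (- v) iV iU (hV v sv) (hU v sv).
  apply: (cond_exp_unique (completed_past_sigma_algebra v) (@completed_past_measurable _ _ _ _ _ xi v)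
    (integrable_lin (- v) iV iU) _ c1).
  exact: grid_cond_exp.
have iVr := cond_exp_integrable (hV r sr); have iVr' := cond_exp_integrable (hV r' sr').
have iUr := cond_exp_integrable (hU r sr); have iUr' := cond_exp_integrable (hU r' sr').
have nU := integrable_normr (integrable_sub iUr iUr').
have nV := integrable_normr (integrable_sub iVr iVr').
have nV' := integrable_normr iVr'.
have nx := integrable_normr (integrable_sub (xi_int i r01) (xi_int i r'01)).
have ilin := integrable_lin `|r - r'| nV' nV.
pose bd w := `|mU r w - mU r' w| + (`|r - r'| * `|mV r' w| + `|mV r w - mV r' w|).
have ibd : P.-integrable setT (EFin \o bd).
  exact: integrable_add nU ilin.
have hEV : \int[P]_w `|mV r' w| <= EV.
  exact: (cond_exp_contraction (@completed_past_measurable _ _ _ _ _ xi r') iV (hV r' sr')).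
have step : (1 - t) * \int[P]_w `|xi r i w - xi r' i w| <= \int[P]_w bd w.
  rewrite -RintegralZl//.
  rewrite /Rintegral; apply: fine_le.
  - apply: integrable_fin_num => //; exact: (integrableZl measurableT (1 - t) nx).
  - exact: integrable_fin_num.
  apply: ae_ge0_le_integral => //.
  - by move=> w _; rewrite lee_fin mulr_ge0// ltW.
  - by apply: measurable_int (integrableZl measurableT (1 - t) nx).
  - by move=> w _; rewrite lee_fin !addr_ge0// mulr_ge0.
  - exact: measurable_int ibd.
  - apply: filterS2 (xiE r gr) (xiE r' gr') => w e1 e2 _; rewrite lee_fin.
    rewrite -[X in X * _](gtr0_norm t10) -normrM mulrBr e1 e2 /bd.
    rewrite (_ : _ - _ = (mU r w - mU r' w) + (- ((r - r') * mV r' w) - r * (mV r w - mV r' w))); last by ring.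
    rewrite (le_trans (ler_normD _ _))// lerD2l (le_trans (ler_normB _ _))// normrN !normrM lerD2l.
    rewrite ler_piMl// gtr0_norm; [by case/andP: r01|by case/andP: r01].
have : \int[P]_w bd w <= c + (c + c).
  rewrite RintegralD//.
  rewrite RintegralD//; last exact: (integrableZl measurableT `|r - r'| nV').
  rewrite RintegralZl//.
  apply: lerD; first exact: h1.
  apply: lerD; last exact: h2.
  have rr3 : `|r - r'| <= c / (EV + 1).
    by rewrite ler_norml; rewrite /u3 in r3 r'3; apply/andP; split; lra.
  apply: (@le_trans _ _ (c / (EV + 1) * EV)).
    by apply: ler_pM => //; apply: Rintegral_ge0.
  rewrite mulrAC ler_pdivrMr ?ltr_wpDl// ler_wpM2l ?(ltW c0)//.
  by rewrite lerDl.
move=> h; rewrite -(ler_pM2l t10) (le_trans step)// (le_trans h)//.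
by rewrite /c; lra.
Qed.

(** The Cauchy limit along the grid times is identified by the right continuity of
the paths. For s = 0 this also gives the integrability, which is a
hypothesis at positive times only. *)
Let grid_L1 (e : R) : 0 < e -> P.-integrable setT (EFin \o xi s i) /\
  exists2 u, s < u & forall r, grid r -> r <= u -> \int[P]_w `|xi r i w - xi s i w| <= e.
Proof.
move=> e0; have [u su hu] := grid_cauchy e0.
have /choice[r hr] k : exists r, grid r /\ r < s + Num.min (u - s) (k.+1%:R^-1).
  have k0 : 0 < Num.min (u - s) (k.+1%:R^-1) by rewrite lt_min subr_gt0 su invr_gt0 ltr0n.
  by have [r gr h] := grid_near k0; exists r.
have sr k : s < r k <= 1.
  have [[/andP[srk rkt] _] _] := hr k.
  by rewrite srk ltW// (lt_trans rkt).
have ru k : r k <= u.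
  have [_ h] := hr k; rewrite ltW// (lt_le_trans h)// -lerBrDl.
  by rewrite ge_min lexx.
have rs : r k @[k --> \oo] --> s.
  apply: (@squeeze_cvgr _ _ _ _ (fun k => s) (fun k => s + k.+1%:R^-1)).
  - apply: nearW => k; have /andP[/ltW -> _] := sr k; have [_ h] := hr k.
    by rewrite ltW// (lt_le_trans h)// lerD2l ge_min lexx orbT.
  - exact: cvg_cst.
  - rewrite -[X in _ --> X]addr0; apply: cvgD; first exact: cvg_cst.
    exact: cvg_harmonic.
have ixi v : s < v <= 1 -> P.-integrable setT (EFin \o xi v i).
  by move=> /andP[sv v1]; apply: xi_int; rewrite v1 (le_lt_trans s_ge0 sv).
have lim v : grid v -> v <= u -> P.-integrable setT (EFin \o xi s i) /\
    \int[P]_w `|xi s i w - xi v i w| <= e.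
  move=> gv vu; have [/andP[sv vt] _] := gv.
  apply: (@L1_limit _ _ _ _ (fun k => xi (r k) i)).
  - by move=> k; exact: ixi.
  - by apply: ixi; rewrite sv ltW// (lt_trans vt).
  - by [].
  - by apply: aeW => w; exact: xi_right_continuous s_ge0 sr rs.
  - by move=> k; apply: hu => //; have [] := hr k.
have [g0 _] := hr 0%N; have [is_ _] := lim _ g0 (ru 0%N).
split => //; exists u => // v gv vu; have [_] := lim _ gv vu.
by under eq_Rintegral do rewrite distrC.
Qed.

Lemma start_integrable : P.-integrable setT (EFin \o xi s i).
Proof. by have [] := grid_L1 ltr01. Qed.

(** An event of F s is in the past of all grid times r > s, where the grid identity
holds, and both sides of that identity are continuous as r decreases to s. *)
Lemma harness_at_start A : F s A -> (1 - t) * \int[P]_(w in A) xi s i w =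
  (1 - s) * \int[P]_(w in A) xi t i w - (t - s) * \int[P]_(w in A) xi 1 i w.
Proof.
move=> FA.
have mA := filtration_measurable FA.
set a := \int[P]_(w in A) xi t i w; set b := \int[P]_(w in A) xi s i w.
set c := \int[P]_(w in A) xi 1 i w.
have t10 : 0 < 1 - t by rewrite subr_gt0.
apply/eqP; rewrite -subr_eq0 -normr_le0; apply/ler_addgt0Pl => e e0; rewrite addr0.
pose K := `|c - a| + 1.
have K0 : 0 < K by rewrite ltr_wpDl.
have e2 : 0 < e / 2 by rewrite divr_gt0.
have [_ [u su hu]] := grid_L1 e2.
have m0 : 0 < Num.min (u - s) (e / 2 / K) by rewrite lt_min subr_gt0 su divr_gt0.
have [r gr re] := grid_near m0; have [/andP[sr rt] _] := gr.
have ru : r <= u by rewrite ltW// (lt_le_trans re)// -lerBrDl ge_min lexx.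
have rK : (r - s) * K <= e / 2.
  by rewrite -ler_pdivlMr// lerBlDl ltW// (lt_le_trans re)// lerD2l ge_min lexx orbT.
have r01 : 0 < r <= 1 by rewrite (le_lt_trans s_ge0 sr) ltW// (lt_trans rt).
have ir := xi_int i r01; have it := xi_int i t01; have i1 := xi_int i one01.
have := cond_exp_Rintegral (grid_cond_exp gr) (filtration_sub sr FA).
rewrite RintegralZl//; last exact: integrable_on.
have -> : \int[P]_(w in A) (- r * V w + U w) = (1 - r) * a - (t - r) * c.
  transitivity (\int[P]_(w in A) ((1 - r) * xi t i w - (t - r) * xi 1 i w)).
    by apply: eq_Rintegral => w _; rewrite /U /V; ring.
  rewrite RintegralB//; last 2 first.
  - exact: (integrableZl mA (1 - r) (integrable_on mA it)).
  - exact: (integrableZl mA (t - r) (integrable_on mA i1)).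
  by rewrite !RintegralZl//; exact: integrable_on.
set b' := \int[P]_(w in A) xi r i w => h.
have ists := start_integrable.
have bb : `|b' - b| <= e / 2.
  rewrite /b' /b -RintegralB//; try exact: integrable_on.
  have ib := integrable_sub ir start_integrable.
  apply: (le_trans _ (hu r gr ru)); apply: (le_trans (le_normr_Rintegral mA (integrable_on mA ib))).
  have mAc := measurableC mA.
  rewrite (Rintegral_setC_split mA (integrable_normr ib)) lerDl.
  by apply: Rintegral_ge0.
have -> : (1 - t) * b - ((1 - s) * a - (t - s) * c) =
    - ((1 - t) * (b' - b)) + (r - s) * (c - a) by rewrite mulrBr h; ring.
rewrite (le_trans (ler_normD _ _))// normrN !normrM (gtr0_norm t10) [`|r - s|]gtr0_norm ?subr_gt0//.
have h1 : (1 - t) * `|b' - b| <= `|b' - b|.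
  by rewrite ler_piMl// gerBl (ltW (le_lt_trans s_ge0 st)).
have h2 : (r - s) * `|c - a| <= (r - s) * K by rewrite ler_wpM2l ?subr_ge0 ?(ltW sr)// lerDl.
lra.
Qed.

End fixed_times.

Lemma xi_integrable t i : 0 <= t <= 1 -> P.-integrable setT (EFin \o xi t i).
Proof.
move=> /andP[]; rewrite le_eqVlt => /predU1P[<- _|t0 t1]; last by apply: xi_int; rewrite t0.
have h : (0 : R) < 2^-1 by [].
by apply: (@start_integrable i 0 2^-1) => //; lra.
Qed.

(** The integrals of the process over A, as functions of the time, are affine on
[s, 1]; written without division. *)
Lemma harness i s t A : 0 <= s -> s <= t -> t < 1 -> F s A ->
  (1 - s) * (\int[P]_(w in A) xi t i w - \int[P]_(w in A) xi s i w) =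
  (t - s) * (\int[P]_(w in A) xi 1 i w - \int[P]_(w in A) xi s i w).
Proof.
move=> s0; rewrite le_eqVlt => /predU1P[->|st] t1 FA; first by rewrite !subrr mulr0 mul0r.
have := harness_at_start i s0 st t1 FA; set a := Rintegral _ _ _; set b := Rintegral _ _ _.
set c := Rintegral _ _ _ => h.
have -> : (1 - s) * (b - a) = (1 - s) * b - (t - s) * c - (1 - t) * a + (t - s) * (c - a) by ring.
by rewrite h; ring.
Qed.

End harness.

(** * Jointly measurable versions of conditional expectations *)

Lemma limn_esup_shift (R : realType) (u : nat -> \bar R) k :
  limn_esup (fun j => u (j + k)%N) = limn_esup u.
Proof.
rewrite !limn_esup_lim.
have -> : esups (fun j => u (j + k)%N) = fun j => esups u (j + k)%N.
  apply/funext => j; congr ereal_sup; apply/seteqP; split => x.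
  - by move=> [p /= jp <-]; exists (p + k)%N => //=; rewrite leq_add2r.
  - move=> [p /= jp <-]; exists (p - k)%N => /=; first by rewrite leq_subRL ?(leq_trans _ jp) ?leq_addl// addnC.
    by rewrite subnK// (leq_trans _ jp)// leq_addl.
have cv : esups u @ \oo --> limn (esups u) by exact: is_cvg_esups.
by apply: cvg_lim => //; rewrite (cvg_shiftn k).
Qed.

(** The preimage of B is a countable union of rectangles. *)
Lemma measurable_countable_choice d1 d2 (S : measurableType d1) (T : measurableType d2)
    (R : realType) (N : S -> nat) (g : nat -> T -> R) :
  (forall n, measurable [set s | N s = n]) -> (forall n, measurable_fun setT (g n)) ->
  measurable_fun setT (fun p : S * T => g (N p.1) p.2).
Proof.
move=> mN mg _ B mB; rewrite setTI.
have -> : (fun p : S * T => g (N p.1) p.2) @^-1` B =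
    \bigcup_n ([set s | N s = n] `*` (g n @^-1` B)).
  apply/seteqP; split => [p /= Bp|p [n _ [/= <- //]]].
  by exists (N p.1).
apply: bigcupT_measurable => n; apply: measurableX => //.
by rewrite -[X in measurable X]setTI; exact: mg.
Qed.

Section fast_cauchy.
Context d (Om : measurableType d) (R : realType) (P : probability Om R).
Let eps (j : nat) : R := 1 / (2 ^ j.+1)%:R.

Lemma eps_gt0 j : 0 < eps j.
Proof. by rewrite divr_gt0// ltr0n expn_gt0. Qed.

Lemma eps_small (x : R) : 0 < x -> exists j, eps j < x.
Proof.
move=> x0; exists (Num.bound x^-1); rewrite /eps ltr_pdivrMr ?ltr0n ?expn_gt0//.
rewrite -ltr_pdivrMl// mulr1; apply: (lt_trans (archi_boundP _)); first by rewrite invr_ge0 ltW.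
by rewrite ltr_nat (ltn_trans (ltnSn _))// ltn_expl.
Qed.

(** The sum of the absolute increments is integrable, hence almost surely finite. *)
Lemma fast_L1_cauchy_cvg (y : nat -> Om -> R) :
  (forall j, P.-integrable setT (EFin \o y j)) ->
  (forall j, \int[P]_w `|y j.+1 w - y j w| <= eps j) ->
  {ae P, forall w, cvgn (fun j => y j w)}.
Proof.
move=> iy hy.
have iyy j := integrable_normr (integrable_sub (iy j.+1) (iy j)).
pose g j w := (`|y j.+1 w - y j w|)%:E.
have mg j : measurable_fun setT (g j) by exact: measurable_int (iyy j).
have g0 j w : setT w -> (0 <= g j w)%E by rewrite lee_fin.
have le1 : (\int[P]_w (\sum_(j <oo) g j w) <= 1%:E)%E.
  rewrite integral_nneseries//; apply: le_trans (epsilon_trick0 predT (@ler01 R)).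
  apply: lee_nneseries => [j _ _|j _]; first by apply: integral_ge0 => w; exact: g0.
  rewrite -[leLHS]fineK ?lee_fin; first exact: hy.
  by apply: integrable_fin_num => //; exact: iyy.
have isum : P.-integrable setT (fun w => \sum_(j <oo) g j w)%E.
  apply/integrableP; split.
    by apply: ge0_emeasurable_sum => // j w _ _; exact: g0.
  rewrite (eq_integral (fun w => \sum_(j <oo) g j w)%E).
    by rewrite (le_lt_trans le1)// ltry.
  by move=> w _; rewrite gee0_abs//; apply: nneseries_ge0 => j _ _; exact: g0.
have := integrable_ae measurableT isum; apply: filterS => w /(_ I) fin.
have : cvgn (series (telescope (fun j => y j w))).
  pose v n := `|telescope (fun j => y j w) n|.
  apply: normed_cvg; apply: nondecreasing_is_cvgn.
    apply/nondecreasing_seqP => k; change (series v k <= series v k.+1).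
    by rewrite seriesSr lerDl; exact: normr_ge0.
  exists (fine (\sum_(j <oo) g j w)) => _ [k _ <-].
  change (series v k <= fine (\sum_(j <oo) g j w)%E).
  rewrite -lee_fin fineK// seriesEnat/= -sumEFin.
  exact: (@nneseries_lim_ge _ (g^~ w) predT 0%N k (fun j _ _ => g0 j w I)).
move=> /cvg_ex[l hl]; apply/cvg_ex; exists (y 0%N w + l).
rewrite (_ : (fun j => y j w) = (fun j => y 0%N w + series (telescope (fun j => y j w)) j)).
  by apply: cvgD => //; exact: cvg_cst.
by apply/funext => j; rewrite [LHS](eq_sum_telescope (fun j => y j w)).
Qed.

End fast_cauchy.

Section backward_version.
Context d (Om : measurableType d) (R : realType) (P : probability Om R).
Variable H : R -> set (set Om).
Hypothesis sH : forall r, sigma_algebra setT (H r).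
Hypothesis Hm : forall r, H r `<=` measurable.
Hypothesis Hle : forall r r', r <= r' -> H r `<=` H r'.

Let F s : set (set Om) := \bigcap_(r in [set r : R | s < r]) H r.
Let q (n : nat) : R := ratr (odflt 0 (unpickle n : option rat)).

Let rational_between (a b : R) : a < b -> exists n, a < q n < b.
Proof.
move=> /rat_in_itvoo[x]; rewrite in_itv/= => xab.
by exists (pickle x); rewrite /q pickleK.
Qed.

(** The first rational, in a fixed enumeration, that is good for s depends on s in a
measurable way as soon as each rational is good for an interval of times s. *)
Section rational_choice.
Variable good : nat -> nat -> R -> Prop.
Hypothesis good_interval : forall j n, is_interval [set s | good j n s].
Hypothesis good_ex : forall j s, exists n, good j n s.

Let first_ex j s : exists n, [pred n | `[< good j n s >]] n.
Proof. by have [n h] := good_ex j s; exists n; exact/asboolP. Qed.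

Definition first_good j s : nat := ex_minn (first_ex j s).

Lemma first_goodP j s : good j (first_good j s) s.
Proof. by rewrite /first_good; case: ex_minnP => n /asboolP. Qed.

Lemma first_good_measurable j n :
  measurable ([set s | first_good j s = n] : set (measurableTypeR R)).
Proof.
have mgood k : measurable ([set s | good j k s] : set (measurableTypeR R)).
  exact: is_interval_measurable.
have -> : [set s | first_good j s = n] =
    [set s | good j n s] `\` \bigcup_(k in [set k | (k < n)%N]) [set s | good j k s].
  apply/seteqP; split => s /=; rewrite /first_good; case: ex_minnP => l /asboolP gl lmin.
  - move=> <-; split => // -[k /= kl gk].
    by have := lmin k; rewrite leqNgt kl => h; have : false by apply: h; apply/asboolP.
  - move=> [gn nk]; apply/eqP; rewrite eqn_leq lmin/=; last exact/asboolP.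
    by rewrite leqNgt; apply/negP => ln; apply: nk; exists l.
by apply: measurableD => //; apply: bigcup_measurable => k _.
Qed.

End rational_choice.

(** The process is the limit of its values at the first enumerated rational in
]s, s + 1 / (j + 1)], cut at 1. *)
Lemma right_continuous_measurable (x : R -> Om -> R) :
  (forall t, measurable_fun setT (x t)) ->
  (forall s w (r : nat -> R), 0 <= s < 1 -> (forall k, s < r k <= 1) ->
     r k @[k --> \oo] --> s -> x (r k) w @[k --> \oo] --> x s w) ->
  measurable_fun ([set s : R | 0 <= s < 1] `*` [set: Om])
      (fun p : measurableTypeR R * Om => x p.1 p.2).
Proof.
move=> mx rcx.
pose good j n s := s < q n <= s + j.+1%:R^-1.
have gi j n : is_interval [set s | good j n s].
  move=> a b /= /andP[a1 a2] /andP[b1 b2] s /andP[as_ sb]; apply/andP; split.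
    exact: le_lt_trans b1.
  by rewrite (le_trans a2)// lerD2r.
have ge j s : exists n, good j n s.
  have [n /andP[n1 /ltW n2]] : exists n, s < q n < s + j.+1%:R^-1.
    by apply: rational_between; rewrite ltrDl invr_gt0 ltr0n.
  by exists n; rewrite /good n1.
pose r j s := Num.min (q (first_good ge j s)) 1.
apply: (@measurable_fun_cvg _ _ _ _ (fun j (p : measurableTypeR R * Om) => x (r j p.1) p.2)).
  move=> j; apply: measurable_funTS.
  apply: (@measurable_countable_choice _ _ (measurableTypeR R) Om R (first_good ge j)
    (fun n => x (Num.min (q n) 1))) => // n.
  exact: first_good_measurable.
move=> [s w] [/= /andP[s0 s1] _].
have rj j : s < r j s <= s + j.+1%:R^-1.
  have /andP[h1 h2] := first_goodP ge j s.
  by rewrite /r lt_min h1 s1 ge_min h2.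
apply: rcx; first by rewrite s0.
  by move=> k; have /andP[-> _] := rj k; rewrite /r ge_min lexx orbT.
apply: (@squeeze_cvgr _ _ _ _ (fun k => s) (fun k => s + k.+1%:R^-1)).
- by apply: nearW => k; have /andP[/ltW -> ->] := rj k.
- exact: cvg_cst.
- rewrite -[X in _ --> X]addr0; apply: cvgD; first exact: cvg_cst.
  exact: cvg_harmonic.
Qed.

Section version.
Variables (Z : Om -> R).
Hypothesis iZ : P.-integrable setT (EFin \o Z).

(** The conditional expectations given H r, for r decreasing to s, are followed
along rationals r that depend on s in a measurable way and for which they
converge almost surely. *)
Lemma cond_exp_measurable_version : exists Y : R -> Om -> R,
  measurable_fun setT (fun p : measurableTypeR R * Om => Y p.1 p.2) /\
  forall s, cond_exp P (F s) Z (Y s).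
Proof.
have /choice[m hm] r : exists Y, cond_exp P (H r) Z Y.
  exact: (cond_exp_exists (sH r) (@Hm r) iZ).
pose eps (j : nat) : R := 1 / (2 ^ j.+1)%:R.
pose good j n s := s < q n <= s + j.+1%:R^-1 /\ forall r r', s < r -> s < r' ->
  r <= q n -> r' <= q n -> \int[P]_w `|m r w - m r' w| <= eps j.
have gi j n : is_interval [set s | good j n s].
  move=> a b /= [/andP[a1 a2] ha] [/andP[b1 b2] hb] s /andP[as_ sb]; split.
    apply/andP; split; first exact: le_lt_trans b1.
    by rewrite (le_trans a2)// lerD2r.
  by move=> r r' sr sr'; apply: ha; exact: le_lt_trans as_ _.
have ge j s : exists n, good j n s.
  have [t st ht] := @backward_cauchy _ _ _ P H s (fun r _ => sH r) (fun r _ => @Hm r)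
    (fun r r' _ h => Hle h) Z (eps j) m iZ (fun r _ => hm r) (eps_gt0 _ j).
  have [n /andP[n1 /ltW]] : exists n, s < q n < Num.min t (s + j.+1%:R^-1).
    by apply: rational_between; rewrite lt_min st ltrDl invr_gt0 ltr0n.
  rewrite le_min => /andP[n2 n3].
  exists n; split; first by rewrite n1.
  by move=> r r' sr sr' rq r'q; apply: ht => //; exact: le_trans n2.
pose rho j s := q (first_good ge j s).
have rhoP j s : s < rho j s <= s + j.+1%:R^-1 by have [] := first_goodP ge j s.
pose y j s w := m (rho j s) w.
have iy j s : P.-integrable setT (EFin \o y j s) by exact: cond_exp_integrable (hm _).
have yy s j k : (j <= k)%N -> \int[P]_w `|y k s w - y j s w| <= eps j.
  move=> jk; have [_ hj] := first_goodP ge j s; have [_ hk] := first_goodP ge k s.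
  have /andP[s1 _] := rhoP j s; have /andP[s2 _] := rhoP k s.
  have [h|/ltW h] := leP (rho k s) (rho j s); first exact: hj.
  apply: (le_trans (hk _ _ s2 s1 (lexx _) h)).
  by rewrite /eps ler_pM2l// lef_pV2 ?posrE ?ltr0n ?expn_gt0// ler_nat leq_exp2l.
pose Y s w := fine (limn_esup (fun j => (y j s w)%:E)).
exists Y; split.
  apply: measurableT_comp => //; apply: measurable_fun_limn_esup => j; apply/measurable_EFinP.
  apply: (@measurable_countable_choice _ _ (measurableTypeR R) Om R (first_good ge j)
    (fun n => m (q n))) => n; first exact: first_good_measurable.
  exact: integrable_measurable (cond_exp_integrable (hm _)).
move=> s.
have sF : sigma_algebra setT (F s).
  split.
  - by move=> r _; have [] := sH r.
  - by move=> A FA r sr; have [_ h _] := sH r; apply: h; exact: FA.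
  - by move=> A FA r sr; have [_ _ h] := sH r; apply: h => k; exact: FA.
have FH r : s < r -> F s `<=` H r by move=> sr A FA; exact: FA.
have Fm : F s `<=` measurable.
  by move=> A FA; apply: (@Hm (s + 1)); apply: (@FH (s + 1)) => //; rewrite ltrDl.
have aY : adapted_to (F s) (Y s).
  move=> B mB r /= sr.
  pose k := Num.bound (r - s)^-1.
  have rs0 : 0 < r - s by rewrite subr_gt0.
  have rk j : rho (j + k) s <= r.
    have /andP[_ h] := rhoP (j + k)%N s; rewrite (le_trans h)// -lerBrDl.
    rewrite -[leRHS]invrK lef_pV2 ?posrE ?invr_gt0 ?ltr0n//.
    rewrite ltW// (lt_le_trans (archi_boundP _)) ?invr_ge0 ?(ltW rs0)// ler_nat.
    by rewrite -/k ltnW// ltnS leq_addl.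
  apply: ((adapted_toP (sH r) (Y s)).2 _ B mB).
  rewrite (_ : Y s = fun w => fine (limn_esup (fun j => (y (j + k)%N s w)%:E))); last first.
    by apply/funext => w; rewrite /Y -(limn_esup_shift _ k).
  apply: measurableT_comp => //; apply: measurable_fun_limn_esup => j; apply/measurable_EFinP.
  apply/(adapted_toP (sH r)) => C mC; apply: (Hle (rk j)).
  exact: (cond_exp_adapted (hm _)).
have mY : measurable_fun setT (Y s) by exact: (adapted_measurable Fm aY).
have cvY : {ae P, forall w, y j s w @[j --> \oo] --> Y s w}.
  have := fast_L1_cauchy_cvg (fun j => iy j s) (fun j => yy s j j.+1 (leqnSn j)).
  apply: filterS => w /cvg_ex[l hl]; rewrite /Y.
  have hl' : (y j s w)%:E @[j --> \oo] --> l%:E.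
    by apply: cvg_EFin => //; exists 0%N.
  by have [_ ->] := cvg_limn_einf_sup hl'.
have lim j : P.-integrable setT (EFin \o Y s) /\ \int[P]_w `|Y s w - y j s w| <= eps j.
  apply: (@L1_limit _ _ _ _ (fun k => y (k + j)%N s)) => //.
  - by apply: filterS cvY => w; rewrite -(cvg_shiftn j).
  - by move=> k; apply: yy; exact: leq_addl.
have [iY _] := lim 0%N.
apply: (cond_expI Fm) => // A FA; have mA := Fm _ FA.
apply/eqP; rewrite -subr_eq0 -normr_le0; apply/ler_addgt0Pl => e e0; rewrite addr0.
have [j hj] := eps_small e0; apply: (le_trans _ (ltW hj)).
have [_ hj'] := lim j; apply: (le_trans _ hj').
have /andP[sr _] := rhoP j s.
rewrite -(cond_exp_Rintegral (hm (rho j s)) (FH _ sr _ FA)) -/(y j s).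
have ib := integrable_sub iY (iy j s).
rewrite -RintegralB//; [|exact: integrable_on|exact: (integrable_on mA (iy j s))].
apply: (le_trans (le_normr_Rintegral mA (integrable_on mA ib))).
by rewrite (Rintegral_setC_split mA (integrable_normr ib)) lerDl; exact: Rintegral_ge0.
Qed.

End version.
End backward_version.

(** * Time integrals of the drift *)

Section complete.
Context d (Om : measurableType d) (R : realType) (P : probability Om R).
Variable G : set (set Om).
Hypothesis sG : sigma_algebra setT G.

(** A complete sigma-algebra does not distinguish almost surely equal variables. *)
Lemma adapted_ae_eq (Y Y' : Om -> R) :
  (forall N, measurable N -> P N = 0%E -> G N) ->
  adapted_to G Y -> measurable_fun setT Y' -> {ae P, forall w, Y w = Y' w} -> adapted_to G Y'.
Proof.
move=> Gnull aY mY' [N [mN N0 hN]] B mB.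
pose GT := g_sigma_algebraType G.
have GE : <<s G >> = G by exact: sigma_algebra_id.
have inG A : (measurable : set (set GT)) A -> G A by rewrite /measurable/= GE.
have toG A : G A -> (measurable : set (set GT)) A by rewrite /measurable/= GE.
have mA' : measurable (Y' @^-1` B) by rewrite -[X in measurable X]setTI; exact: mY'.
have YN w : ~ N w -> Y w = Y' w by move=> Nw; apply: contrapT => h; apply: Nw; exact: hN.
have -> : Y' @^-1` B = (Y @^-1` B `\` N) `|` (Y' @^-1` B `&` N).
  apply/seteqP; split=> w /=.
  - by move=> Bw; have [wN|wN] := pselect (N w); [right|left; rewrite YN].
  - by move=> [[Bw wN]|[]//]; rewrite -YN.
apply: inG; apply: measurableU.
- by apply: measurableD; apply: toG; [exact: aY|exact: Gnull].
- apply: toG; apply: Gnull; first exact: measurableI.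
  exact: (subset_measure0 (measurableI _ _ mA' mN) mN (@subIsetr _ _ _) N0).
Qed.

End complete.

Section drift.
Context d (Om : measurableType d) (R : realType) (P : probability Om R).
Variables (F : R -> set (set Om)) (x : R -> Om -> R) (Z : Om -> R).
Hypothesis sF : forall s, sigma_algebra setT (F s).
Hypothesis Fm : forall s, F s `<=` measurable.
Hypothesis Fle : forall s s', s <= s' -> F s `<=` F s'.
Hypothesis Fnull : forall s N, measurable N -> P N = 0%E -> F s N.
Hypothesis mx : measurable_fun ([set s : R | 0 <= s < 1] `*` [set: Om])
  (fun p : measurableTypeR R * Om => x p.1 p.2).
Hypothesis ax : forall s, 0 <= s < 1 -> adapted_to (F s) (x s).
Hypothesis ix : forall s, 0 <= s < 1 -> P.-integrable setT (EFin \o x s).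
Hypothesis iZ : P.-integrable setT (EFin \o Z).
Hypothesis harness : forall s t A, 0 <= s -> s <= t -> t < 1 -> F s A ->
  (1 - s) * (\int[P]_(w in A) x t w - \int[P]_(w in A) x s w) =
  (t - s) * (\int[P]_(w in A) Z w - \int[P]_(w in A) x s w).

Local Notation leb := (lebesgue_measure : {sigma_finite_measure set (measurableTypeR R) -> \bar R}).

Definition terminal_version (Y : R -> Om -> R) :=
  measurable_fun ([set s : R | 0 <= s < 1] `*` [set: Om])
      (fun p : measurableTypeR R * Om => Y p.1 p.2) /\
  forall s : R, 0 <= s < 1 -> cond_exp P (F s) Z (Y s).

Definition drift (Y : R -> Om -> R) s w := (Y s w - x s w) / (1 - s).

(** The drift as a function on the product, cut off outside a set B of times. *)
Definition window Y (B : set R) (p : Om * measurableTypeR R) : R := \1_B p.2 * drift Y p.2 p.1.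

Section one_version.
Variable Y : R -> Om -> R.
Hypothesis hY : terminal_version Y.
Local Notation D := (drift Y).

Let iY s : 0 <= s < 1 -> P.-integrable setT (EFin \o Y s).
Proof. by move=> /hY.2; exact: cond_exp_integrable. Qed.

Lemma drift_integrable s : 0 <= s < 1 -> P.-integrable setT (EFin \o D s).
Proof.
move=> s01; have := integrableZl measurableT (1 - s)^-1 (integrable_sub (iY s01) (ix s01)).
by congr (P.-integrable _ _); apply/funext => w /=; rewrite /drift mulrC.
Qed.

Lemma drift_adapted s : 0 <= s < 1 -> adapted_to (F s) (D s).
Proof.
move=> s01; apply/(adapted_toP (sF s)); apply: measurable_funM => //.
apply: measurable_funB; apply/(adapted_toP (sF s)); last exact: ax.
exact: cond_exp_adapted (hY.2 s s01).
Qed.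

Let drift_int s A : 0 <= s < 1 -> F s A ->
  (1 - s) * \int[P]_(w in A) D s w = \int[P]_(w in A) Z w - \int[P]_(w in A) x s w.
Proof.
move=> s01 FA; have mA := Fm FA.
rewrite -RintegralZl//; last by apply: integrable_on => //; exact: drift_integrable.
rewrite -(cond_exp_Rintegral (hY.2 s s01) FA) -RintegralB//; last 2 first.
- exact: (integrable_on mA (iY s01)).
- exact: (integrable_on mA (ix s01)).
apply: eq_Rintegral => w _; rewrite /drift mulrC divfK// gt_eqF// subr_gt0.
by case/andP: s01.
Qed.

(** The harness property says exactly that the drift is a martingale, the slope
of the conditionally expected path. *)
Lemma drift_cond_exp s t : 0 <= s -> s <= t -> t < 1 -> cond_exp P (F s) (D t) (D s).
Proof.
move=> s0 st t1.
have s01 : 0 <= s < 1 by rewrite s0 (le_lt_trans st).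
have t01 : 0 <= t < 1 by rewrite t1 (le_trans s0).
apply: (cond_expI (@Fm s)); [exact: drift_adapted|exact: drift_integrable|exact: drift_integrable|].
move=> A FA; have h := harness s0 st t1 FA.
have h1 := drift_int s01 FA; have h2 := drift_int t01 (Fle st FA).
have t10 : 1 - t != 0 by rewrite gt_eqF// subr_gt0.
have s10 : 1 - s != 0 by rewrite gt_eqF// subr_gt0 (le_lt_trans st).
apply: (mulfI (mulf_neq0 s10 t10)).
transitivity ((1 - t) * (\int[P]_(w in A) Z w - \int[P]_(w in A) x s w)).
  by rewrite -h1; ring.
rewrite -[RHS]mulrA h2; move: h; set a := \int[P]_(w in A) x s w.
set b := \int[P]_(w in A) x t w; set c := \int[P]_(w in A) Z w => h.
by rewrite (_ : c - b = (c - a) - (b - a)); [rewrite [RHS]mulrBr h; ring|ring].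
Qed.

Lemma drift_increment s t A : 0 <= s -> s <= t -> t < 1 -> F s A ->
  \int[P]_(w in A) x t w - \int[P]_(w in A) x s w = (t - s) * \int[P]_(w in A) D s w.
Proof.
move=> s0 st t1 FA; have s01 : 0 <= s < 1 by rewrite s0 (le_lt_trans st).
have s10 : 1 - s != 0 by rewrite gt_eqF// subr_gt0 (le_lt_trans st).
apply: (mulfI s10); rewrite harness// mulrCA drift_int//.
Qed.

Let unit_sub (B : set R) t : t < 1 -> B `<=` `[0, t] -> B `<=` [set s : R | 0 <= s < 1].
Proof.
move=> t1 Bt s /Bt; rewrite /= in_itv/= => /andP[-> st].
exact: le_lt_trans t1.
Qed.

Let unit_measurable : measurable ([set s : R | 0 <= s < 1] : set (measurableTypeR R)).
Proof.
by rewrite (_ : [set s : R | 0 <= s < 1] = `[0, 1[%classic).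
Qed.

Lemma window_measurable (B : set (measurableTypeR R)) t : t < 1 -> measurable B -> B `<=` `[0, t] ->
  measurable_fun setT (window Y B).
Proof.
move=> t1 mB Bt; have B1 := unit_sub t1 Bt.
pose f (p : measurableTypeR R * Om) := D p.1 p.2.
have mf : measurable_fun ([set s : R | 0 <= s < 1] `*` [set: Om]) f.
  apply: measurable_funM; first by apply: measurable_funB; [exact: hY.1|exact: mx].
  apply: (@measurable_comp _ _ _ _ _ _ [set s : R | 0 <= s < 1] (fun s : R => (1 - s)^-1)).
  - exact: unit_measurable.
  - by move=> _ [p [p1 _] <-].
  - apply: subspace_continuous_measurable_fun; first exact: unit_measurable.
    apply: continuous_in_subspaceT => s; rewrite inE /= => /andP[_ s1].
    have s10 : 1 - s != 0 by rewrite subr_eq0 gt_eqF.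
    apply: (cvgV s10); apply: cvgB; [exact: cvg_cst|exact: cvg_id].
  - apply: measurable_funTS; exact: measurable_fst.
have mBT : measurable (B `*` [set: Om]) by exact: measurableX.
have mfB : measurable_fun setT (f \_ (B `*` [set: Om])).
  apply/(measurable_restrictT _ mBT); apply: measurable_funS mf.
    by apply: measurableX => //; exact: unit_measurable.
  by move=> p [/B1].
rewrite (_ : window Y B = (f \_ (B `*` [set: Om])) \o (fun p => (p.2, p.1))); last first.
  apply/funext => -[w s]; rewrite /window /= patchE indicE.
  have -> : ((s, w) \in B `*` [set: Om]) = (s \in B).
    by apply/idP/idP; rewrite !inE => //= -[].
  by case: ifP => h; rewrite ?mul1r ?mul0r.
apply: measurableT_comp => //; exact: measurable_swap.
Qed.

Section bounded_factor.
Variables (t C : R) (B : set (measurableTypeR R)) (X : Om -> R).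
Hypotheses (t01 : 0 <= t < 1) (mB : measurable B) (Bt : B `<=` `[0, t]).
Hypotheses (mX : measurable_fun setT X) (XC : forall w, `|X w| <= C).
Let t1 : t < 1. Proof. by case/andP: t01. Qed.
Let B01 s : B s -> 0 <= s < 1. Proof. by move=> Bs; exact: (unit_sub t1 Bt Bs). Qed.

Let f (p : Om * measurableTypeR R) := (X p.1 * window Y B p)%:E.

Let mf : measurable_fun setT f.
Proof.
apply/measurable_EFinP; apply: measurable_funM.
  by apply: measurableT_comp => //; exact: measurable_fst.
exact: window_measurable t1 mB Bt.
Qed.

Let iXD s : B s -> P.-integrable setT (EFin \o (fun w => X w * D s w)).
Proof. by move=> /B01 s01; exact: integrable_mul_bounded mX XC (drift_integrable s01). Qed.

(** The drift contracts in L1 when time decreases, hence is integrable over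
[0, t] * Om. *)
Lemma product_integrable : (P \x leb)%E.-integrable setT f.
Proof.
apply/(integrable21ltyP _ _ mf).
have C0 : 0 <= C by rewrite (le_trans _ (XC point)).
pose K := \int[P]_w `|D t w|.
pose b := (fun=> (C * K)%:E : \bar R) \_ (`[0, t]%classic : set (measurableTypeR R)).
apply: (@le_lt_trans _ _ (\int[leb]_s b s)%E); last first.
  rewrite /b -integral_mkcond integral_cst//.
  set l := (X in (_ * X)%E); have -> : l = t%:E.
    rewrite /l /= lebesgue_measure_itv/= lte_fin; case: ifP => [t0|/negbT]; first by rewrite oppr0 adde0.
    by rewrite -leNgt => t0; congr (_%:E); apply/eqP; rewrite eq_le t0 andbT; case/andP: t01.
  by rewrite -EFinM ltry.
have CK0 : 0 <= C * K by rewrite mulr_ge0// Rintegral_ge0.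
apply: ge0_le_integral => //.
- by move=> s _; exact: integral_ge0.
- have mabs : measurable_fun setT (abse \o f) by apply: measurableT_comp; [exact: abse_measurable|exact: mf].
  have h := @measurable_fun_fubini_tonelli_G _ _ Om (measurableTypeR R) R P (abse \o f) mabs
    (fun p => abse_ge0 (f p)).
  exact: h.
- have mI : measurable (`[0, t]%classic : set (measurableTypeR R)) by exact: measurable_itv.
  exact: ((measurable_restrictT (fun=> (C * K)%:E) mI).1 (measurable_cst _)).
move=> s _; have [Bs|nBs] := pselect (B s); last first.
  rewrite (eq_integral (cst 0%E)); last first.
    by move=> w _; rewrite /f /window/= indicE memNset// mul0r mulr0 normr0.
  by rewrite integral0 /b patchE; case: ifP => // _; rewrite lee_fin.
have s01 := B01 Bs; have st : s <= t by have := Bt Bs; rewrite /= in_itv/= => /andP[].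
rewrite /b patchE mem_set//; last exact: Bt.
rewrite (eq_integral (fun w => (`|X w * D s w|)%:E)); last first.
  by move=> w _; rewrite /f /window/= indicE mem_set// mul1r.
rewrite -[leLHS]fineK; last by apply: integrable_fin_num => //; exact: (integrable_normr (iXD Bs)).
rewrite lee_fin -/(Rintegral _ _ _).
have iD := integrable_normr (drift_integrable s01).
apply: (@le_trans _ _ (\int[P]_w (C * `|D s w|))).
  apply: le_Rintegral => //.
  - exact: (integrable_normr (iXD Bs)).
  - exact: (integrableZl measurableT C iD).
  - by move=> w _; rewrite normrM ler_wpM2r.
rewrite RintegralZl// ler_wpM2l//.
apply: (cond_exp_contraction (@Fm s) (drift_integrable t01)).
by apply: drift_cond_exp => //; case/andP: s01.
Qed.

End bounded_factor.

Section time_integral.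
Variables (t : R) (B : set (measurableTypeR R)).
Hypotheses (t01 : 0 <= t < 1) (mB : measurable B) (Bt : B `<=` `[0, t]).
Let t1 : t < 1. Proof. by case/andP: t01. Qed.
Let B01 s : B s -> 0 <= s < 1. Proof. by move=> Bs; exact: (unit_sub t1 Bt Bs). Qed.

Let slice (X : Om -> R) w : (fun s => (X w * window Y B (w, s))%:E) =
  (fun s => (X w)%:E * ((EFin \o D^~ w) \_ B) s)%E.
Proof.
apply/funext => s; rewrite /window/= patchE indicE.
by case: ifP => _; rewrite ?mul1r ?mul0r ?mulr0 ?mule0//= EFinM.
Qed.

Let one_le (w : Om) : `|cst (1 : R) w| <= 1. Proof. by rewrite normr1. Qed.
Let prod1 := product_integrable t01 mB Bt (measurable_cst (1 : R)) one_le.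
Let slice1 w : (fun s => (cst 1 w * window Y B (w, s))%:E) = (EFin \o D^~ w) \_ B.
Proof. by rewrite slice; apply/funext => s; rewrite mul1e. Qed.

Lemma slices_integrable : {ae P, forall w, leb.-integrable B (EFin \o D^~ w)}.
Proof.
have := ae_integrable1 prod1; apply: filterS => w; rewrite slice1.
exact: (integrable_mkcond _ mB).2.
Qed.

Let time_integralE w : \int[leb]_(s in B) D s w =
  fine (\int[leb]_s (cst 1 w * window Y B (w, s))%:E).
Proof. by rewrite slice1 -integral_mkcond. Qed.

Lemma time_integral_measurable : measurable_fun setT (fun w => \int[leb]_(s in B) D s w).
Proof.
rewrite (_ : (fun w => _) = fine \o fubini_F leb (fun p => (cst 1 p.1 * window Y B p)%:E)).
  by apply: measurableT_comp => //; exact: measurable_fubini_F prod1.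
by apply/funext => w; exact: time_integralE.
Qed.

Lemma time_integral_integrable :
  P.-integrable setT (EFin \o (fun w => \int[leb]_(s in B) D s w)).
Proof.
have iF := integrable_fubini_F prod1.
apply: (le_integrable measurableT _ _ iF).
  by apply/measurable_EFinP; exact: time_integral_measurable.
move=> w _; rewrite /= time_integralE /fubini_F.
by case: (\int[leb]_s _)%E => [r| |]//=; rewrite normr0 leey.
Qed.

Lemma integral_mul_time_integral (X : Om -> R) (C : R) :
  measurable_fun setT X -> (forall w, `|X w| <= C) ->
  \int[P]_w (X w * \int[leb]_(s in B) D s w) = \int[leb]_(s in B) \int[P]_w (X w * D s w).
Proof.
move=> mX XC; have prodX := product_integrable t01 mB Bt mX XC.
have iXI := integrable_mul_bounded mX XC time_integral_integrable.
rewrite /Rintegral; congr fine.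
transitivity (\int[P]_w \int[leb]_s (X w * window Y B (w, s))%:E)%E.
  apply: ae_eq_integral => //.
  - exact: measurable_int iXI.
  - exact: measurable_fubini_F prodX.
  - apply: filterS slices_integrable => w iw _.
    rewrite slice integralZl//; last exact: ((integrable_mkcond _ mB).1 iw).
    by rewrite -integral_mkcond EFinM fineK//; exact: integrable_fin_num.
rewrite (Fubini prodX) [RHS]integral_mkcond.
apply: eq_integral => s _; rewrite patchE; case: ifPn => [|sB].
  rewrite inE => Bs; have s01 := B01 Bs; rewrite fineK; last first.
    apply: integrable_fin_num => //.
    exact: integrable_mul_bounded mX XC (drift_integrable s01).
  by apply: eq_integral => w _; rewrite /window/= indicE mem_set// mul1r.
rewrite (eq_integral (cst 0%E)) ?integral0// => w _.
by rewrite /window/= indicE (negbTE sB) mul0r mulr0.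
Qed.

End time_integral.

Let itv_measurable (a b : R) : measurable (`[a, b]%classic : set (measurableTypeR R)).
Proof. exact: measurable_itv. Qed.
Let itvoc_measurable (a b : R) : measurable (`]a, b]%classic : set (measurableTypeR R)).
Proof. exact: measurable_itv. Qed.

(** The time integral I equals its conditional expectation J given F t: the mean of
|J - I| is that of X * (J - I) for the sign X of J - I, and in it X can be replaced
by its conditional expectation given F t, since the difference W is orthogonal to J
and to each D s, s <= t, hence to I; after this replacement the mean is 0 by the
definition of J. *)
Lemma time_integral_adapted t : 0 <= t < 1 ->
  adapted_to (F t) (fun w => \int[leb]_(s in `[0, t]) D s w).
Proof.
move=> t01; have mB := itv_measurable 0 t.
have BB : `[0, t] `<=` (`[0, t] : set R) by [].
pose I w := \int[leb]_(s in `[0, t]) D s w.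
have mI : measurable_fun setT I by exact: time_integral_measurable t01 mB BB.
have iI : P.-integrable setT (EFin \o I) by exact: time_integral_integrable t01 mB BB.
have [J cJ] := cond_exp_exists (sF t) (@Fm t) iI.
have iJ := cond_exp_integrable cJ; have aJ := cond_exp_adapted cJ.
apply: (adapted_ae_eq (sF t) (@Fnull t) aJ mI).
have iV := integrable_sub iJ iI; have mV := integrable_measurable iV.
suff : \int[P]_w `|J w - I w| <= 0.
  move=> /(norm_le_ae0 iV); apply: filterS => w /eqP.
  by rewrite subr_eq0 => /eqP.
pose X w := Num.sg (J w - I w).
have mX : measurable_fun setT X.
  rewrite (_ : X = fun w => if 0 < J w - I w then 1 else if J w - I w < 0 then -1 else 0).
    apply: measurable_fun_ifT => //; first exact: measurable_fun_ltr.
    by apply: measurable_fun_ifT => //; exact: measurable_fun_ltr.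
  by apply/funext => w; rewrite /X; case: sgrP; rewrite ?ltxx//; case: ltgtP.
have X1 w : `|X w| <= 1 by rewrite /X normr_sg; case: (_ != 0).
have iX : P.-integrable setT (EFin \o X) by exact: integrable_bounded mX X1.
have [EX cEX EX1] := cond_exp_bounded (sF t) (@Fm t) iX X1.
have aEX := cond_exp_adapted cEX; have iEX := cond_exp_integrable cEX.
have mEX := integrable_measurable iEX.
pose W w := X w - EX w.
have mW : measurable_fun setT W by exact: measurable_funB.
have W2 w : `|W w| <= 2.
  by rewrite (le_trans (ler_normB _ _))// -[leRHS]/(1 + 1 : R) lerD.
have W0 A : F t A -> \int[P]_(w in A) W w = 0.
  move=> FA; have mA := Fm FA; rewrite RintegralB//; try exact: integrable_on.
  by rewrite (cond_exp_Rintegral cEX)// subrr.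
have iW : P.-integrable setT (EFin \o W) by exact: integrable_bounded mW W2.
have ortho (V : Om -> R) : adapted_to (F t) V -> P.-integrable setT (EFin \o V) ->
    \int[P]_w (W w * V w) = 0.
  move=> aV iV'; under eq_Rintegral do rewrite mulrC.
  apply: (integral_mul_adapted_eq0 (@Fm t) aV iW) => //.
  have := integrable_mul_bounded mW W2 iV'.
  by congr (P.-integrable _ _); apply/funext => w /=; rewrite mulrC.
have WJ := ortho J aJ iJ.
have WI : \int[P]_w (W w * I w) = 0.
  rewrite (integral_mul_time_integral t01 mB BB mW W2).
  transitivity (\int[leb]_(s in `[0, t]) (0 : R)); last by rewrite Rintegral_cst// mul0r.
  apply: eq_Rintegral => s; rewrite inE/= in_itv/= => /andP[s0 st].
  have s01 : 0 <= s < 1 by rewrite s0 (le_lt_trans st)//; case/andP: t01.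
  apply: ortho (drift_integrable s01).
  by move=> A mA; apply: (Fle st); exact: drift_adapted.
have EXIJ := cond_exp_pull_out (@Fm t) iI cJ aEX EX1.
have -> : \int[P]_w `|J w - I w| = \int[P]_w ((W w * J w + EX w * J w) - (W w * I w + EX w * I w)).
  by apply: eq_Rintegral => w _; rewrite /W /X normrEsg; ring.
have iWJ := integrable_mul_bounded mW W2 iJ; have iWI := integrable_mul_bounded mW W2 iI.
have iEJ := integrable_mul_bounded mEX EX1 iJ; have iEI := integrable_mul_bounded mEX EX1 iI.
rewrite RintegralB//; [|exact: integrable_add|exact: integrable_add].
by rewrite !RintegralD// WJ WI EXIJ subrr.
Qed.

(** By Fubini, the integral over A of I t - I s is the integral over ]s, t] of those of
the drift over A, which are all equal to that of D s; by [drift_increment] this is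
the integral over A of x t - x s. *)
Lemma compensated_martingale (I : R -> Om -> R) s t :
  (forall u, 0 <= u < 1 -> measurable_fun setT (I u)) ->
  (forall u, 0 <= u < 1 -> {ae P, forall w, \int[leb]_(v in `[0, u]) D v w = I u w}) ->
  0 <= s -> s <= t -> t < 1 ->
  cond_exp P (F s) (fun w => x t w - I t w) (fun w => x s w - I s w).
Proof.
move=> mI IE s0 st t1.
have s01 : 0 <= s < 1 by rewrite s0 (le_lt_trans st).
have t01 : 0 <= t < 1 by rewrite t1 (le_trans s0).
have BB (u : R) : `[0, u] `<=` (`[0, u] : set R) by [].
have iI u : 0 <= u < 1 -> P.-integrable setT (EFin \o I u).
  move=> u01; have iu := time_integral_integrable u01 (itv_measurable 0 u) (@BB u).
  apply/integrableP; split; first by apply/measurable_EFinP; exact: mI.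
  have /integrableP[_] := iu; congr (_ < _)%E; apply: ae_eq_integral => //.
  - by apply: measurableT_comp => //; exact: measurable_int iu.
  - by apply: measurableT_comp => //; apply/measurable_EFinP; exact: mI.
  - by apply: filterS (IE u u01) => w /= -> _.
have aI u : 0 <= u < 1 -> adapted_to (F u) (I u).
  move=> u01; exact: (adapted_ae_eq (sF u) (@Fnull u) (time_integral_adapted u01) (mI u u01) (IE u u01)).
have ixI u u01 := integrable_sub (ix u01) (iI u u01).
apply: (cond_expI (@Fm s)); [|exact: ixI|exact: ixI|].
  apply/(adapted_toP (sF s)); apply: measurable_funB; apply/(adapted_toP (sF s)); [exact: ax|exact: aI].
move=> A FA; have mA := Fm FA.
rewrite !RintegralB//; try by apply: integrable_on => //; first [exact: ix|exact: iI].
suff key : \int[P]_(w in A) I t w - \int[P]_(w in A) I s w =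
    \int[P]_(w in A) x t w - \int[P]_(w in A) x s w.
  move: key; set p := \int[P]_(w in A) I t w; set q := \int[P]_(w in A) I s w.
  by set b := \int[P]_(w in A) x t w; set a := \int[P]_(w in A) x s w => h; lra.
have hB : `]s, t] `<=` (`[0, t] : set R).
  by move=> u; rewrite /= !in_itv/= => /andP[su ->]; rewrite (le_trans s0)// ltW.
have m1 : measurable_fun setT (\1_A : Om -> R) by exact: measurable_indic.
have b1 w : `|\1_A w : R| <= 1 by rewrite indicE; case: (_ \in _); rewrite ?normr1 ?normr0.
transitivity (\int[P]_w (\1_A w * \int[leb]_(u in `]s, t]) D u w)).
  rewrite -RintegralB//; last 2 first.
  - exact: (integrable_on mA (iI t t01)).
  - exact: (integrable_on mA (iI s s01)).
  rewrite Rintegral_mkcond patch_indic /Rintegral; congr fine.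
  have iJ := time_integral_integrable t01 (itvoc_measurable s t) hB.
  have mIt := mI t t01; have mIs := mI s s01.
  have mJ := integrable_measurable iJ.
  apply: ae_eq_integral => //.
  - by apply/measurable_EFinP; apply: measurable_funM => //; exact: measurable_funB.
  - by apply/measurable_EFinP; exact: measurable_funM.
  have sl := slices_integrable t01 (itv_measurable 0 t) (@BB t).
  apply: filterS3 (IE t t01) (IE s s01) sl => w et es il _ /=; rewrite -et -es.
  congr (_%:E); rewrite mulrC; congr (_ * _).
  by rewrite (@Rintegral_itvB _ (D^~ w) (BLeft 0) (BRight t) s)// bnd_simp.
rewrite (integral_mul_time_integral t01 (itvoc_measurable s t) hB m1 b1) (drift_increment s0 st t1 FA).
transitivity (\int[leb]_(u in `]s, t]) \int[P]_(w in A) D s w); last first.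
  rewrite Rintegral_cst// mulrC; congr (_ * _).
  rewrite /= lebesgue_measure_itv/= lte_fin; case: ifP => // /negbT.
  by rewrite -leNgt => ts; apply/esym/eqP; rewrite subr_eq0 eq_le ts.
apply: eq_Rintegral => u; rewrite inE/= in_itv/= => /andP[su ut].
have c := drift_cond_exp s0 (ltW su) (le_lt_trans ut t1).
rewrite (cond_exp_Rintegral c FA) [RHS]Rintegral_mkcond patch_indic.
by apply: eq_Rintegral => w _; rewrite /= mulrC.
Qed.

End one_version.

(** Two versions agree almost surely at each time, hence, by Fubini, at almost
all times simultaneously. *)
Lemma time_integrals_unique (Y1 Y2 : R -> Om -> R) t :
  terminal_version Y1 -> terminal_version Y2 -> 0 <= t < 1 ->
  {ae P, forall w, leb.-integrable `[0, t] (EFin \o (drift Y2)^~ w) /\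
    forall u, 0 <= u <= t ->
    \int[leb]_(s in `[0, u]) drift Y1 s w = \int[leb]_(s in `[0, u]) drift Y2 s w}.
Proof.
move=> h1 h2 t01.
have mB : measurable (`[0, t]%classic : set (measurableTypeR R)) by exact: measurable_itv.
have BB : `[0, t] `<=` (`[0, t] : set R) by [].
have t1 : t < 1 by case/andP: t01.
have m1 := window_measurable h1 t1 mB BB; have m2 := window_measurable h2 t1 mB BB.
pose g p := (window Y1 `[0, t] p - window Y2 `[0, t] p)%:E : \bar R.
have mg : measurable_fun [set: Om * measurableTypeR R] g.
  by apply/measurable_EFinP; exact: measurable_funB m1 m2.
have mabs : measurable_fun setT (abse \o g) by apply: measurableT_comp; [exact: abse_measurable|exact: mg].
have ag0 p : (0 <= (abse \o g) p)%E by exact: abse_ge0.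
have int0 : (\int[P]_w \int[leb]_s `|g (w, s)| = 0)%E.
  rewrite (fubini_tonelli (abse \o g) mabs ag0).
  rewrite (eq_integral (cst 0%E)) ?integral0// => s _.
  have [|sB] := boolP (s \in (`[0, t]%classic : set R)).
    rewrite inE/= in_itv/= => /andP[s0 st].
    have s01 : 0 <= s < 1 by rewrite s0 (le_lt_trans st).
    have := cond_exp_unique (sF s) (@Fm s) iZ (h1.2 s s01) (h2.2 s s01) => un.
    rewrite (ae_eq_integral (cst 0%E)) ?integral0//.
      exact: (measurableT_comp mabs (pair2_measurable s)).
    apply: filterS un => w e _; rewrite /g /window /= /drift e.
    by rewrite subrr ?abse0 ?normr0.
  by apply: integral0_eq => w _; rewrite /g /window /= indicE (negbTE sB) !mul0r subrr ?abse0 ?normr0.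
have ae0 : {ae P, forall w, (\int[leb]_s `|g (w, s)| = 0)%E}.
  have mF := @measurable_fun_fubini_tonelli_F _ _ Om (measurableTypeR R) R leb (abse \o g) mabs ag0.
  have : (\int[P]_w `|\int[leb]_s `|g (w, s)| | = 0)%E.
    by rewrite -[RHS]int0; apply: eq_integral => w _; rewrite gee0_abs// integral_ge0.
  move=> /(ae_eq_integral_abs P measurableT mF).
  by apply: filterS => w /(_ I).
have sl1 := slices_integrable h1 t01 mB BB; have sl2 := slices_integrable h2 t01 mB BB.
apply: filterS3 ae0 sl1 sl2 => w e i1 i2; split => // u /andP[u0 ut].
have mu : measurable (`[0, u]%classic : set (measurableTypeR R)) by exact: measurable_itv.
have ut' : `[0, u] `<=` (`[0, t] : set R).
  by move=> s; rewrite /= !in_itv/= => /andP[-> su]; exact: le_trans ut.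
have mgw : measurable_fun setT (fun s : measurableTypeR R => g (w, s)).
  exact: (measurableT_comp mg (pair1_measurable w)).
have /(ae_eq_integral_abs leb measurableT mgw) ge0 := e.
rewrite /Rintegral; congr fine; apply: ae_eq_integral => //.
- exact: (measurable_funS mB ut' (measurable_int _ i1)).
- exact: (measurable_funS mB ut' (measurable_int _ i2)).
apply: filterS ge0 => s /(_ I); rewrite /g /window /= => -[h] us.
move: h; rewrite indicE mem_set; last exact: ut'.
by rewrite !mul1r => /eqP; rewrite subr_eq0 => /eqP ->.
Qed.

End drift.

(** * The semimartingale representation *)

Lemma ae_forall_countable d (Om : measurableType d) (R : realType) (P : {measure set Om -> \bar R})
    (I : countType) (Q : I -> Om -> Prop) :
  (forall i, {ae P, forall w, Q i w}) -> {ae P, forall w, forall i, Q i w}.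
Proof.
move=> h; pose Q' (k : nat) w := if unpickle k is Some i then Q i w else True.
have : {ae P, forall w, forall k, Q' k w}.
  apply: ae_foralln => k; rewrite /Q'; case: (unpickle k) => [i|]; first exact: h.
  exact: aeW.
by apply: filterS => w hw i; have := hw (pickle i); rewrite /Q' pickleK.
Qed.

(** Countably many times suffice to have integrability of the drift up to all t < 1
outside a single null set. *)
Lemma unit_exhaustion (R : realType) (t : R) : t < 1 -> exists k : nat, t < 1 - k.+2%:R^-1.
Proof.
move=> t1; have t10 : 0 < 1 - t by rewrite subr_gt0.
exists (Num.bound (1 - t)^-1); rewrite ltrBrDl -ltrBrDr.
rewrite invf_plt ?posrE ?ltr0n//; apply: (lt_trans (archi_boundP _)); first by rewrite invr_ge0 ltW.
by rewrite ltr_nat.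
Qed.

Lemma exhaustion_unit (R : realType) (k : nat) : 0 <= (1 - k.+2%:R^-1 : R) < 1.
Proof.
by rewrite subr_ge0 invf_le1 ?ler1n ?ltr0n// gtrBl invr_gt0 ltr0n.
Qed.

(** The time integral is continuous. *)
Lemma cadlag_sub_integral (R : realType) (x g : R -> R) :
  cadlag_on [set t | 0 <= t <= 1] x ->
  (forall k : nat, lebesgue_measure.-integrable `[0, 1 - k.+2%:R^-1] (EFin \o g)) ->
  cadlag_on [set t | 0 <= t < 1] (fun t => x t - \int[lebesgue_measure]_(s in `[0, t]) g s).
Proof.
move=> cx ig t /= /andP[t0 t1].
have [k tk] := unit_exhaustion t1; set b := 1 - k.+2%:R^-1 in tk.
have b0 : 0 <= b by rewrite (le_trans t0)// ltW.
have /subspace_continuousP cJ := parameterized_integral_continuous b0 (ig k).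
have tb : `[0, b]%classic t by rewrite /= in_itv/= t0 ltW.
have {}cJ := cJ t tb.
have sub : [set u : R | 0 <= u < 1] `<=` [set u | 0 <= u <= 1].
  by move=> u /= /andP[-> /ltW].
pose J u := \int[lebesgue_measure]_(s in `[0, u]) g s.
have near_b : \forall u \near t, u < b by exact: lt_nbhsl.
have cJ' (G : set R) : J s @[s --> within [set u | 0 <= u < 1] (within G (nbhs t))] --> J t.
  move=> B /cJ hB; have hB' : \forall s \near t, `[0, b]%classic s -> B (J s) by exact: hB.
  change (\forall s \near t, G s -> [set u : R | 0 <= u < 1] s -> B (J s)).
  apply: filterS2 near_b hB' => s sb hs Gs /andP[s0 _]; apply: hs.
  by rewrite /= in_itv/= s0 ltW.
have t01 : 0 <= t <= 1 by rewrite t0 ltW.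
have [xr [l xl]] := cx t t01.
have cx' (G : set R) (l' : R) : x s @[s --> within [set u | 0 <= u <= 1] (within G (nbhs t))] --> l' ->
    x s @[s --> within [set u | 0 <= u < 1] (within G (nbhs t))] --> l'.
  move=> h B /h hB.
  have hB' : \forall s \near t, G s -> [set u : R | 0 <= u <= 1] s -> B (x s) by exact: hB.
  change (\forall s \near t, G s -> [set u : R | 0 <= u < 1] s -> B (x s)).
  by apply: filterS hB' => s hs Gs s01; apply: hs => //; exact: sub.
split; first by apply: cvgB; [exact: cx'|exact: cJ'].
by exists (l - J t); apply: cvgB; [exact: cx'|exact: cJ'].
Qed.

Lemma coordinate_integrable d (Om : measurableType d) (R : realType) (P : probability Om R)
    (n : nat) (x : 'I_n -> {RV P >-> R}) (i : 'I_n) :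
  (\int[P]_w (Num.sqrt (\sum_(j < n) (x j w) ^+ 2))%:E < +oo)%E ->
  P.-integrable setT (EFin \o x i).
Proof.
move=> fin; pose S w := Num.sqrt (\sum_(j < n) (x j w) ^+ 2).
have mS : measurable_fun setT S.
  apply: (@measurableT_comp _ _ _ _ _ _ (@Num.sqrt R)).
    by apply: continuous_measurable_fun; exact: sqrt_continuous.
  by apply: measurable_sum => j; apply: measurable_funX.
apply: (@le_integrable _ _ _ P setT measurableT _ (EFin \o S)).
- exact/measurable_EFinP.
- move=> w _ /=; rewrite lee_fin [leRHS]ger0_norm ?sqrtr_ge0// -sqrtr_sqr ler_sqrt.
    by rewrite (bigD1 i)//= lerDl sumr_ge0// => j _; exact: sqr_ge0.
  by rewrite sumr_ge0// => j _; exact: sqr_ge0.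
- apply/integrableP; split; first exact/measurable_EFinP.
  rewrite (eq_integral (EFin \o S)); first exact: fin.
  by move=> w _ /=; rewrite ger0_norm// sqrtr_ge0.
Qed.

Theorem proposition3p17 (R : realType) (n : nat) (m : 'I_n -> R)
    (nu : probability (measurableTypeR R) R)
    (d : measure_display) (Om : measurableType d) (P : probability Om R)
    (xi : R -> 'I_n -> {RV P >-> R})
    (n_ge2 : (2 <= n)%N) (m_gt0 : forall i, 0 < m i)
    (nu_ncs : no_continuous_singular_part nu)
    (xi_glp : generalised_liouville_process m nu xi)
    (xi_int : forall t : R, 0 < t <= 1 ->
       (\int[P]_w (Num.sqrt (\sum_(i < n) (xi t i w) ^+ 2))%:E < +oo)%E) :
  let F := filtration_of P (fun t i w => xi t i w) in
  let E1 := cond_exp_process P F (fun i w => xi 1 i w) in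
  (exists Y, E1 Y) /\
  exists M : R -> 'I_n -> Om -> R,
    [/\ martingale P F M,
        forall i w, cadlag_on [set t | 0 <= t < 1] (fun t => M t i w) &
        forall Y, E1 Y ->
          {ae P, forall w, forall (t : R) (i : 'I_n), 0 <= t < 1 ->
             lebesgue_measure.-integrable `[0, t]
               (fun s : R => ((Y s i w - xi s i w) / (1 - s))%:E) /\
             xi t i w = \int[lebesgue_measure]_(s in `[0, t])
                          ((Y s i w - xi s i w) / (1 - s)) + M t i w}].
Proof.
move=> F E1.
have xi_int' t i : 0 < t <= 1 -> P.-integrable setT (EFin \o xi t i).
  by move=> /xi_int h; exact: (@coordinate_integrable _ _ _ P n (xi t)).
have one01 : 0 < (1 : R) <= 1 by rewrite ltr01 lexx.
have sF := filtration_sigma_algebra xi; have Fm := @filtration_measurable _ _ _ _ P xi.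
have Fle := @filtration_mono _ _ _ _ P xi.
have Fnull s N : measurable N -> P N = 0%E -> F s N.
  by move=> mN N0 r _; exact: completed_past_null.
have sub01 (s : R) : 0 <= s < 1 -> 0 <= s <= 1 by move=> /andP[-> /ltW].
have mx i : measurable_fun ([set s : R | 0 <= s < 1] `*` [set: Om])
    (fun p : measurableTypeR R * Om => xi p.1 i p.2).
  apply: (right_continuous_measurable (x := fun t => xi t i)) => //.
  move=> s w r /andP[s0 s1] sr rs; exact: (xi_right_continuous xi_glp s0 sr rs).
have ax i s : 0 <= s < 1 -> adapted_to (F s) (xi s i).
  move=> s01 B mB r /= sr; apply: xi_adapted => //; [exact: sub01|exact: ltW].
have ix i s : 0 <= s < 1 -> P.-integrable setT (EFin \o xi s i).
  by move=> /sub01; exact: xi_integrable m_gt0 xi_glp xi_int' s i.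
have iZ i : P.-integrable setT (EFin \o xi 1 i) := xi_int' 1 i one01.
have hn i := harness m_gt0 xi_glp xi_int' i.
have ver i Y : E1 Y -> terminal_version P F (xi 1 i) (fun s => Y s i).
  by move=> /(_ i).
have [Y EY] : exists Y, E1 Y.
  have /choice[Y hY] i := cond_exp_measurable_version
    (completed_past_sigma_algebra xi) (fun r => @completed_past_measurable _ _ _ _ P xi r)
    (@completed_past_mono _ _ _ _ P xi) (iZ i).
  exists (fun s i => Y i s) => i; have [mY cY] := hY i.
  by split; [exact: measurable_funTS|move=> s _; exact: cY].
split; first by exists Y.
have integrable_ae i k : {ae P, forall w, lebesgue_measure.-integrable `[0, 1 - k.+2%:R^-1]
    (EFin \o (drift (fun t => xi t i) (fun s => Y s i))^~ w)}.
  have BB : `[0, 1 - k.+2%:R^-1] `<=` (`[0, 1 - k.+2%:R^-1] : set R) by [].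
  exact: (slices_integrable sF Fm Fle (mx i) (ax i) (ix i) (hn i) (ver i Y EY)
    (exhaustion_unit R k) _ BB).
have [N [mN N0 hN]] := ae_forall_countable (fun i => ae_foralln (integrable_ae i)).
have goodP w : ~ N w -> forall i (k : nat), lebesgue_measure.-integrable `[0, 1 - k.+2%:R^-1]
    (EFin \o (drift (fun t => xi t i) (fun s => Y s i))^~ w).
  by move=> Nw; apply: contrapT => h; apply: Nw; apply: hN.
(* on the exceptional set the time integral is replaced by 0, so that all paths of M
   are cadlag *)
pose I i t : Om -> R := (fun w => \int[lebesgue_measure]_(s in `[0, t])
  drift (fun t => xi t i) (fun s => Y s i) s w) \_ (~` N).
have nN : {ae P, forall w, ~ N w} by exists N; split => // w /= /contrapT.
exists (fun t i w => xi t i w - I i t w); split.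
- move=> i s t s0 st t1.
  apply: (compensated_martingale (I := I i) sF Fm Fle Fnull (mx i) (ax i) (ix i) (hn i) (ver i Y EY)) => //.
  + move=> u u01; apply/(measurable_restrictT _ (measurableC mN)); apply: measurable_funTS.
    have BB : `[0, u] `<=` (`[0, u] : set R) by [].
    exact: (time_integral_measurable sF Fm Fle (mx i) (ax i) (ix i) (hn i) (ver i Y EY) u01 _ BB).
  + by move=> u u01; apply: filterS nN => w Nw; rewrite /I patchE mem_set.
- move=> i w; have [Nw|Nw] := pselect (N w).
    have -> : (fun t => xi t i w - I i t w) =
        (fun t => xi t i w - \int[lebesgue_measure]_(s in `[0, t]) (cst 0 s)).
      by apply/funext => t; rewrite /I patchE memNset ?Rintegral_cst ?mul0r//; apply.
    apply: cadlag_sub_integral; first exact: xi_glp.1.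
    by move=> k; exact: integrable0.
  have -> : (fun t => xi t i w - I i t w) = (fun t => xi t i w -
      \int[lebesgue_measure]_(s in `[0, t]) drift (fun t => xi t i) (fun s => Y s i) s w).
    by apply/funext => t; rewrite /I patchE mem_set.
  apply: cadlag_sub_integral; first exact: xi_glp.1.
  by move=> k; exact: goodP.
(* any other version has the same time integrals, almost surely at all times of the
   exhausting sequence *)
move=> Y2 EY2.
have un i k := time_integrals_unique sF Fm Fle (mx i) (ax i) (ix i) (iZ i) (hn i)
  (ver i Y EY) (ver i Y2 EY2) (exhaustion_unit R k).
have := ae_forall_countable (fun i => ae_foralln (un i)).
move=> h; apply: filterS2 nN h => w Nw h t i /andP[t0 t1].
have [k tk] := unit_exhaustion t1.
have [i2 e] := h i k.
have t0k : 0 <= t <= 1 - k.+2%:R^-1 by rewrite t0 ltW.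
split.
- apply: (integrableS _ _ _ i2); [exact: measurable_itv|exact: measurable_itv|].
  by move=> s; rewrite /= !in_itv/= => /andP[-> st]; rewrite (le_trans st)// ltW.
- by rewrite /I patchE mem_set// e// addrC subrK.
Qed.
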